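(* There is an algorithm which, given a graph $G\in\mathcal{G}_{10,7}$, decides in $O(|V(G)|^{21}(|V(G)|+|E(G)|))$ time whether $G$ admits a $3$-coloring and finds one if it exists.
   Context: All graphs are finite and simple. A $k$-coloring of a graph $G$ is a function $f:V(G)\to\{1,\dots,k\}$ with $f(u)\neq f(v)$ whenever $uv\in E(G)$. $P_t$ and $C_k$ denote the path on $t$ vertices and the cycle on $k$ vertices. A graph is $P_t$-free if it contains no induced subgraph isomorphic to $P_t$. $\mathcal{G}_{10,7}$ is the class of graphs that are $P_{10}$-free and in which every induced odd cycle (triangles included) is a $C_7$. *)

(* Defs.v *)
From mathcomp Require Import all_boot.

Set Implicit Arguments.
Unset Strict Implicit.
Unset Printing Implicit Defensive.

Definition simple_graph (T : finType) (e : rel T) : Prop :=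
  symmetric e /\ irreflexive e.

Definition edge_set (T : finType) (e : rel T) : {set {set T}} :=
  [set [set p.1; p.2] | p : T * T & e p.1 p.2].

(* [h] is isomorphic to the subgraph of [e] induced by the image of [f]. *)
Definition contains_induced (U T : finType) (h : rel U) (e : rel T) : Prop :=
  exists2 f : U -> T, injective f & forall x y, e (f x) (f y) = h x y.

Definition path_graph (t : nat) : rel 'I_t :=
  fun i j => (i.+1 == j) || (j.+1 == i).

(* A simple graph only for [k >= 3]. *)
Definition cycle_graph (k : nat) : rel 'I_k :=
  fun i j => (i.+1 %% k == j) || (j.+1 %% k == i).

Definition path_free (t : nat) (T : finType) (e : rel T) : Prop :=
  ~ contains_induced (@path_graph t) e.

Definition class_G (t l : nat) (T : finType) (e : rel T) : Prop :=
  path_free t e /\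
  forall k, 3 <= k -> odd k -> contains_induced (@cycle_graph k) e -> k = l.

Definition coloring (k : nat) (T : finType) (e : rel T) (f : T -> nat) : Prop :=
  (forall v, 1 <= f v <= k) /\ (forall u v, e u v -> f u <> f v).

(* The model of computation is the word RAM, presented with structured control
   flow.  A memory maps addresses to words; addresses are themselves words, so
   that [Read] and [Write] provide indirect addressing.  Programs do not depend
   on the input. *)
Definition memory := nat -> nat.

Inductive expr : Type :=
  | Const of nat
  | Read of expr
  | Add of expr & expr
  | Sub of expr & expr
  | Mul of expr & expr.

Inductive cmd : Type :=
  | Skip
  | Write of expr & expr
  | Seq of cmd & cmd
  | If of expr & cmd & cmd
  | While of expr & cmd.

Definition word (W v : nat) : option nat := if v < W then Some v else None.

(* All values, including addresses and intermediate results, must be smaller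
   than [W]; on overflow the evaluation fails, and execution is stuck. With
   [W] polynomial in the number of vertices, words have logarithmically many
   bits, and no work can be hidden in unit-cost operations on large numbers.
   [Sub] is truncated subtraction. *)
Fixpoint eval (W : nat) (mu : memory) (a : expr) : option nat :=
  let binop op a1 a2 :=
    if eval W mu a1 is Some v1 then
      if eval W mu a2 is Some v2 then word W (op v1 v2) else None
    else None in
  match a with
  | Const v => word W v
  | Read a1 => if eval W mu a1 is Some i then word W (mu i) else None
  | Add a1 a2 => binop addn a1 a2
  | Sub a1 a2 => binop subn a1 a2
  | Mul a1 a2 => binop muln a1 a2
  end.

(* Each memory access and each arithmetic operation costs one unit. *)
Fixpoint expr_cost (a : expr) : nat :=
  match a with
  | Const _ => 1
  | Read a1 => (expr_cost a1).+1
  | Add a1 a2 | Sub a1 a2 | Mul a1 a2 => (expr_cost a1 + expr_cost a2).+1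
  end.

Definition update (mu : memory) (i v : nat) : memory :=
  fun j => if j == i then v else mu j.

(* [exec W c mu t mu']: started in memory [mu] on a machine with words in
   [0, W), the program [c] halts after [t] time units in memory [mu'].
   A test succeeds when its value is nonzero. *)
Inductive exec (W : nat) : cmd -> memory -> nat -> memory -> Prop :=
  | ExecSkip mu : exec W Skip mu 1 mu
  | ExecWrite mu a b i v :
      eval W mu a = Some i -> eval W mu b = Some v ->
      exec W (Write a b) mu (expr_cost a + expr_cost b).+1 (update mu i v)
  | ExecSeq c1 c2 mu1 mu2 mu3 t1 t2 :
      exec W c1 mu1 t1 mu2 -> exec W c2 mu2 t2 mu3 ->
      exec W (Seq c1 c2) mu1 (t1 + t2) mu3
  | ExecIfTrue b c1 c2 mu mu' v t :
      eval W mu b = Some v.+1 -> exec W c1 mu t mu' ->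
      exec W (If b c1 c2) mu (expr_cost b + t).+1 mu'
  | ExecIfFalse b c1 c2 mu mu' t :
      eval W mu b = Some 0 -> exec W c2 mu t mu' ->
      exec W (If b c1 c2) mu (expr_cost b + t).+1 mu'
  | ExecWhileFalse b c mu :
      eval W mu b = Some 0 ->
      exec W (While b c) mu (expr_cost b).+1 mu
  | ExecWhileTrue b c mu1 mu2 mu3 v t1 t2 :
      eval W mu1 b = Some v.+1 ->
      exec W c mu1 t1 mu2 -> exec W (While b c) mu2 t2 mu3 ->
      exec W (While b c) mu1 (expr_cost b + t1 + t2).+1 mu3.

Lemma exec_deterministic (W : nat) (c : cmd) (mu : memory)
    (t1 t2 : nat) (mu1 mu2 : memory) :
  exec W c mu t1 mu1 -> exec W c mu t2 mu2 -> t1 = t2 /\ mu1 = mu2.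
Proof.
move=> H; elim: H t2 mu2 => {c mu t1 mu1}.
- by move=> mu t2 mu2 H; inversion H.
- by move=> mu a b i v Ha Hb t2 mu2 H; inversion H; subst; split; congruence.
- move=> c1 c2 m1 m2 m3 t1 t2 _ IH1 _ IH2 t mu' H; inversion H; subst.
  match goal with X : exec _ c1 _ _ _ |- _ => case: (IH1 _ _ X) => ? ? end.
  subst.
  by match goal with X : exec _ c2 _ _ _ |- _ => case: (IH2 _ _ X) => ? ? end;
    subst.
- move=> b c1 c2 m m' v t Hb _ IH t2 mu2 H; inversion H; subst; last congruence.
  by match goal with X : exec _ c1 _ _ _ |- _ => case: (IH _ _ X) => -> -> end.
- move=> b c1 c2 m m' t Hb _ IH t2 mu2 H; inversion H; subst; first congruence.
  by match goal with X : exec _ c2 _ _ _ |- _ => case: (IH _ _ X) => -> -> end.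
- by move=> b c m Hb t2 mu2 H; inversion H; subst; [split | congruence].
- move=> b c m1 m2 m3 v t1 t2 Hb _ IH1 _ IH2 t mu' H.
  inversion H; subst; first congruence.
  match goal with X : exec _ c _ _ _ |- _ => case: (IH1 _ _ X) => ? ? end.
  subst.
  by match goal with X : exec _ (While _ _) _ _ _ |- _ =>
    case: (IH2 _ _ X) => ? ? end; subst.
Qed.

(* [s] lists every edge exactly once, in an arbitrary order and with an
   arbitrary order of its two ends. *)
Definition edge_list (n : nat) (e : rel 'I_n) (s : seq ('I_n * 'I_n)) : Prop :=
  perm_eq [seq [set p.1; p.2] | p <- s] (enum (edge_set e)).

(* Input format: the number of vertices, the number of edges, then the two ends
   of each edge; all other cells contain 0. *)
Definition input_memory (n : nat) (s : seq ('I_n * 'I_n)) : memory :=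
  nth 0 (n :: size s :: flatten [seq [:: val p.1; val p.2] | p <- s]).

(* Output format: cell 0 tells whether there is a coloring (1) or not (0); if
   there is one, then the color of the vertex [v] is in cell [v + 1]. *)
Definition correct_output (k n : nat) (e : rel 'I_n) (mu : memory) : Prop :=
  (mu 0 = 1 /\ coloring k e (fun v => mu v.+1)) \/
  (mu 0 = 0 /\ ~ exists f : 'I_n -> nat, coloring k e f).

(* Main.v *)
Require Import Defs.
From Stdlib Require Import NArith.
From mathcomp Require Import all_boot zify.

(** Every graph of the class is 3-colourable, so the program only has to find a colouring, and its
    answer is always 1.

    Reduction.  A vertex [u] whose neighbourhood is contained in that of another vertex [v] can be
    deleted: once the rest is coloured, [u] takes the colour of [v].  So can a vertex with at most two
    neighbours.  Deleting such vertices as long as there are any leaves a set [A] of vertices that is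
    [irreducible]: for distinct [u] and [v] some vertex of [A] is adjacent to [u] and not to [v], and
    every vertex has three neighbours in [A].  The deleted vertices are reinserted in the reverse order
    ([reinsertionP]).

    Components with a seven-cycle.  Let c_0, ..., c_6 induce a C_7 in [A].  The class forbids C_3, C_5,
    C_9 and P_10, so that a vertex is adjacent to c_{i-1} and c_{i+1} only (type D_i, which includes c_i
    itself), to c_i only (type L_i), or to no vertex of the cycle (type R).  Some L_i is empty
    ([exists_gap]); turn the cycle so that L_6 is empty.  Then D_i and L_i are coloured by fixed tables.
    A vertex of type R sees vertices of types D_{s-1}, D_{s+1}, L_{s-2}, L_{s+2} for one [s] only; if it
    sees two of these types it receives the colour of D_s, and if it sees only D_i among the types D and
    L, the colour of L_i, or 1 for i = 6 ([far_colour]).  This is proper ([colour_proper]), and each of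
    the remaining vertices finds a free colour ([rest_free]); two of them are adjacent only in components in which no
    vertex has been coloured ([rest_alone]).

    All these structural facts say that a certain configuration around the cycle does not occur in an
    irreducible graph of the class.  Each has a finite refutation: branch on undecided adjacencies,
    close a branch on a forbidden induced subgraph, and when nothing is left to branch on, add one of
    the vertices that irreducibility provides.  The refutations are found by a search that is evaluated
    once and need not be trusted; [check] verifies them, and [check_sound] says what they prove.  Up to
    the symmetries of the cycle about two hundred configurations suffice.

    Components without a seven-cycle.  They have no induced odd cycle at all, hence are bipartite
    ([bipartition]), and spreading colours greedily from one vertex 2-colours them ([seed_step]).

    The program.  It is written in a language of assignments, conditionals and loops over the vertices,
    whose tests are first-order formulas with quantifiers over the vertices, adjacency being decided by
    scanning the list of edges.  There is no arithmetic, so that all values are at most [n] plus a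
    constant.  Compiled to the RAM, a program of nesting depth [d] takes time O((n+1)^d)
    ([code_sound]); the one used here has depth at most 22 ([program_depth]), which gives the bound
    since n^22 is at most n^21 (n + |E|). *)

Set Implicit Arguments.
Unset Strict Implicit.
Unset Printing Implicit Defensive.

(** * Refutations of partial graphs *)

(** [Leaf] lists a forbidden induced subgraph, [Ban k w] says that [w] violates the [k]-th side
    condition, and [Split] decides an adjacency.  [Fold u v] adds a neighbour of [u] that is not adjacent
    to [v], and [Third u a b] a neighbour of [u] other than [a] and [b]; an irreducible graph has both. *)
Inductive cert : Type :=
  | Leaf of seq nat
  | Ban of nat & nat
  | Split of nat & nat & cert & cert
  | Fold of nat & nat & cert
  | Third of nat & nat & nat & cert.

(** Adjacency matrices with undecided entries [None]; absent entries are undecided too. *)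
Definition known := seq (seq (option bool)).
Definition fact (s : known) i j : option bool := nth None (nth [::] s i) j.
Definition put1 (s : known) i j b : known :=
  set_nth [::] s i (set_nth None (nth [::] s i) j (Some b)).
Definition put s i j b := put1 (put1 s i j b) j i b.

Definition says (o : option bool) (b : bool) : bool :=
  if o is Some c then (if b then c else ~~ c) else false.

Definition path_adj i j := (i.+1 == j) || (j.+1 == i).
Definition cycle_adj k i j := (i.+1 %% k == j) || (j.+1 %% k == i).

Fixpoint row_ok (r : seq (option bool)) (h : nat -> bool) j l : bool :=
  if l is y :: l' then says (nth None r y) (h j) && row_ok r h j.+1 l' else true.
Fixpoint rows_ok s (h : nat -> nat -> bool) i l : bool :=
  if l is x :: l' then
    row_ok (nth [::] s x) (h i) i.+1 l' && rows_ok s h i.+1 l'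
  else true.

(** C_11 and all longer cycles contain an induced P_10, so no longer cycle has to be excluded. *)
Definition forbidden s l : bool :=
  let k := size l in
  if k == 10 then rows_ok s path_adj 0 l
  else (k \in [:: 3; 5; 9]) && rows_ok s (cycle_adj k) 0 l.

(** A side condition excludes the vertices adjacent to all vertices of the first list and to none of
    the second. *)
Definition ban := (seq nat * seq nat)%type.

(** Different indices may stand for the same vertex, but the two vertices of a [Fold] must differ.
    That holds if one of them was chosen to be different or if some third vertex separates them. *)
Definition distinct m s (d : seq (nat * nat)) u v : bool :=
  [|| (u, v) \in d, (v, u) \in d |
   has (fun x => says (fact s u x) true && says (fact s v x) false
              || says (fact s u x) false && says (fact s v x) true) (iota 0 m)].

Fixpoint check (bans : seq ban) m s d (c : cert) : bool :=
  match c with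
  | Leaf l => forbidden s l
  | Ban k w => (k < size bans) && (w < m) &&
      (let b := nth ([::], [::]) bans k in
       all (fun i => says (fact s w i) true) b.1 &&
       all (fun i => says (fact s w i) false) b.2)
  | Split i j c1 c2 => [&& i < m, j < m,
      check bans m (put s i j true) d c1 & check bans m (put s i j false) d c2]
  | Fold u v c1 => [&& u < m, v < m, distinct m s d u v &
      check bans m.+1 (put (put s m u true) m v false) d c1]
  | Third u a b c1 => [&& u < m, a < m, b < m &
      check bans m.+1 (put s m u true) ((m, a) :: (m, b) :: d) c1]
  end.

Fixpoint pbits (p : positive) i : seq nat :=
  match p with xH => [:: i] | xO q => pbits q i.+1 | xI q => i :: pbits q i.+1 end.
Definition bits (m : N) : seq nat := if m is Npos p then pbits p 0 else [::].
Definition bit i : N := N.shiftl 1 (N.of_nat i).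
Definition nthN (l : seq N) i : N := nth N0 l i.
Definition mem_bit (m : N) i : bool := N.testbit m (N.of_nat i).
(** 32 bits exceed the number of vertices in any partial graph that is met below. *)
Definition everything : N := 4294967295.

(** The state of the search: for every vertex the mask of its neighbours and that of its
    non-neighbours, the number of vertices, and the pairs known to be distinct. *)
Record view := View { va : seq N; vb : seq N; vn : nat; vd : seq (nat * nat) }.

Definition or_at (l : seq N) i m := set_nth N0 l i (N.lor (nthN l i) m).
Definition vput v i j (b : bool) : view :=
  if b then View (or_at (or_at (va v) i (bit j)) j (bit i)) (vb v) (vn v) (vd v)
  else View (va v) (or_at (or_at (vb v) i (bit j)) j (bit i)) (vn v) (vd v).
Definition vadd v (pos neg : seq nat) d : view :=
  let n := vn v in
  let v0 := View (rcons (va v) N0) (rcons (vb v) N0) n.+1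
                 ([seq (n, x) | x <- d] ++ vd v) in
  foldl (fun v' x => vput v' n x false) (foldl (fun v' x => vput v' n x true) v0 pos) neg.

Fixpoint first (A B : Type) (f : A -> option B) (l : seq A) : option B :=
  if l is x :: l' then (if f x is Some r then Some r else first f l') else None.

Fixpoint find_cycle v w fuel len r p (ok : N) : option (seq nat) :=
  if fuel is fuel'.+1 then
    let cand := N.land (nthN (va v) r) ok in
    let closing := if len \in [:: 2; 4; 8] then bits (N.land cand (nthN (va v) w)) else [::] in
    if closing is x :: _ then Some (x :: p) else
    if 8 <= len then None else
    first (fun x => find_cycle v w fuel' len.+1 x (x :: p) (N.land ok (nthN (vb v) r)))
          (bits (N.land cand (nthN (vb v) w)))
  else None.

Fixpoint find_left v fuel len l p (ok : N) : option (seq nat) :=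
  if 10 <= len then Some p else
  if fuel is fuel'.+1 then
    first (fun x => find_left v fuel' len.+1 x (x :: p) (N.land ok (nthN (vb v) l)))
          (bits (N.land (nthN (va v) l) ok))
  else None.

(** An induced path through [w] is grown in one direction and then, by [find_left], in the other. *)
Fixpoint find_right v w fuel len r p (ok : N) : option (seq nat) :=
  let okl := foldl (fun m y => if y == w then m else N.land m (nthN (vb v) y)) everything p in
  if find_left v 10 len w (rev p) okl is Some q then Some q else
  if fuel is fuel'.+1 then
    first (fun x => find_right v w fuel' len.+1 x (x :: p) (N.land ok (nthN (vb v) r)))
          (bits (N.land (nthN (va v) r) ok))
  else None.

Definition find_forbidden v w : option (seq nat) :=
  if first (fun x => find_cycle v w 9 2 x [:: x; w] everything) (bits (nthN (va v) w)) is Some p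
  then Some p else find_right v w 9 1 w [:: w] everything.

Definition refuted (bans : seq ban) v w : option cert :=
  let k := find (fun b => all (mem_bit (nthN (va v) w)) b.1 && all (mem_bit (nthN (vb v) w)) b.2) bans in
  if k < size bans then Some (Ban k w) else
  omap Leaf (find_forbidden v w).

Definition script := seq (nat * nat).

(** Only the adjacencies of the newest vertex [w] are undecided.  An adjacency is forced when the
    opposite one is refuted at once; a genuine branch is opened only after a pass without forced values.
    When [w] is settled, the next given vertex of the configuration is added; after these the script
    decides: a hint [(x, y)] asks for a neighbour of [x] that is not adjacent to [y], and [(x, x)] for a
    third neighbour of [x].  Nothing is claimed about the result, which [check] examines. *)
Fixpoint search fuel bans v w (unk : seq nat) (progress : bool) todo
    (given : seq (seq nat * seq nat)) (hs : script) : option (cert * script) :=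
  if fuel isn't fuel'.+1 then None else
  match todo with
  | [::] =>
      if progress then search fuel' bans v w [::] false unk given hs else
      match unk with
      | x :: _ =>
          if search fuel' bans (vput v w x true) w [::] false (behead unk) given hs
            is Some (c1, hs1) then
          if search fuel' bans (vput v w x false) w [::] false (behead unk) given hs1
            is Some (c2, hs2) then Some (Split w x c1 c2, hs2) else None else None
      | [::] =>
          let start v1 given1 hs1 :=
            let w1 := vn v in
            if refuted bans v1 w1 is Some c then Some (c, hs1)
            else search fuel' bans v1 w1 [::] false (iota 0 w1) given1 hs1 in
          if given is (p, q) :: given1 then start (vadd v p q [::]) given1 hs else
          if hs is (x, y) :: hs1 then
            if x != y then
              if start (vadd v [:: x] [:: y] [::]) [::] hs1 is Some (c, hs2)
              then Some (Fold x y c, hs2) else None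
            else
              let ns := bits (nthN (va v) x) in
              let a := nth x ns 0 in let b := nth a ns 1 in
              if start (vadd v [:: x] [::] [:: a; b]) [::] hs1 is Some (c, hs2)
              then Some (Third x a b c, hs2) else None
          else None
      end
  | x :: todo' =>
      if mem_bit (nthN (va v) w) x || mem_bit (nthN (vb v) w) x
      then search fuel' bans v w unk progress todo' given hs else
      let v1 := vput v w x true in let v0 := vput v w x false in
      match refuted bans v1 w, refuted bans v0 w with
      | Some c1, Some c0 => Some (Split w x c1 c0, hs)
      | Some c1, None =>
          if search fuel' bans v0 w unk true todo' given hs is Some (c0, hs')
          then Some (Split w x c1 c0, hs') else None
      | None, Some c0 =>
          if search fuel' bans v1 w unk true todo' given hs is Some (c1, hs')
          then Some (Split w x c1 c0, hs') else None
      | None, None => search fuel' bans v w (rcons unk x) progress todo' given hs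
      end
  end.

(** A configuration around a seven-cycle with indices 0, ..., 6.  The vertex of index [7 + k] is
    described by its type and by its neighbours among the earlier vertices outside of the cycle.  The
    codes of the types are [i] for D_i, [7 + i] for L_i and 14 for R.  The second component lists side
    conditions: [(0, t)] says that no vertex has type [t], and [(v, t)] that all neighbours of [v] have
    type [t] or R. *)
Definition pattern := (seq (nat * seq nat) * seq (nat * nat))%type.
Definition on_cycle t : seq nat :=
  if t < 7 then [:: (t + 6) %% 7; (t + 1) %% 7] else if t < 14 then [:: t - 7] else [::].
Definition off_cycle t : seq nat := [seq i <- iota 0 7 | i \notin on_cycle t].

(** A neighbour of [v] of a type other than [t] and R is adjacent to a cycle vertex that vertices of
    type [t] avoid, or, if [t] is some D_i, to exactly one of c_{i-1} and c_{i+1}. *)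
Definition bans_of (c : nat * nat) : seq ban :=
  let: (v, t) := c in
  if v == 0 then [:: (on_cycle t, off_cycle t)] else
  [seq ([:: v; i], [::]) | i <- off_cycle t] ++
  (if t < 7 then [:: ([:: v; (t + 6) %% 7], [:: (t + 1) %% 7]); ([:: v;
    (t + 1) %% 7], [:: (t + 6) %% 7])] else [::]).
Definition bans (P : pattern) := flatten [seq bans_of c | c <- P.2].

Definition givens (P : pattern) : seq (seq nat * seq nat) :=
  [seq (on_cycle p.1 ++ p.2, off_cycle p.1) | p <- P.1].

Definition view7 : view :=
  foldl (fun v ij => vput v ij.1 ij.2 (cycle_adj 7 ij.1 ij.2))
    (View (nseq 7 N0) (nseq 7 N0) 7 [::])
    [seq p <- [seq (i, j) | i <- iota 0 7, j <- iota 0 7] | p.1 < p.2].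
Definition known7 : known :=
  foldl (fun s ij => put s ij.1 ij.2 (cycle_adj 7 ij.1 ij.2)) (nseq 7 [::])
    [seq p <- [seq (i, j) | i <- iota 0 7, j <- iota 0 7] | p.1 < p.2].

Definition certificate_for (ph : pattern * script) : cert :=
  let P := ph.1 in
  if search 5000 (bans P) view7 6 [::] false [::] (givens P) ph.2 is Some (c, _) then c else Leaf [::].

Definition start_known (P : pattern) : known :=
  (foldl (fun ms pq => (ms.1.+1, foldl (fun s x => put s ms.1 x false)
       (foldl (fun s x => put s ms.1 x true) ms.2 pq.1) pq.2)) (7, known7) (givens P)).2.

Definition verified (P : pattern) (c : cert) : bool :=
  check (bans P) (7 + size P.1) (start_known P) [::] c.

(** * Soundness of refutations *)

Lemma fact_put1 s i j b x y :
  fact (put1 s i j b) x y = if (x == i) && (y == j) then Some b else fact s x y.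
Proof.
rewrite /fact /put1 nth_set_nth /=; case: eqVneq => [->|] //=.
by rewrite nth_set_nth /=; case: eqVneq.
Qed.

Lemma fact_put s i j b x y :
  fact (put s i j b) x y =
  if (x == i) && (y == j) || (x == j) && (y == i) then Some b else fact s x y.
Proof.
rewrite /put !fact_put1.
by case: (x == j); case: (y == i); case: (x == i); case: (y == j).
Qed.

Section Soundness.
Variables (T : finType) (e : rel T) (A : pred T).

(** In other words, no vertex of [A] is dominated by another one or has fewer than three neighbours. *)
Definition irreducible : Prop :=
  (forall u v, A u -> A v -> u != v -> exists w, [/\ A w, e u w & ~~ e v w]) /\
  (forall u a b, A u -> exists w, [/\ A w, e u w, w != a & w != b]).

Hypotheses (Gsimple : simple_graph e) (Gclass : class_G 10 7 e).
Hypothesis Airr : irreducible.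

Definition knows m s (f : nat -> T) : Prop :=
  forall i j b, says (fact s i j) b -> [/\ i < m, j < m & e (f i) (f j) = b].

(** The side conditions concern all vertices of [A], also those outside of the partial graph. *)
Definition respects (bans : seq ban) m (f : nat -> T) : Prop :=
  forall b, b \in bans -> all (gtn m) (b.1 ++ b.2) /\
    forall w, A w ->
      ~~ (all (fun i => e w (f i)) b.1 && all (fun i => ~~ e w (f i)) b.2).

Lemma knows_put m s f i j b :
  i < m -> j < m -> e (f i) (f j) = b -> knows m s f -> knows m (put s i j b) f.
Proof.
move=> im jm eij ks x y c; rewrite fact_put; case: ifP => [|_ /ks //].
have es : symmetric e by case: Gsimple.
by case/orP => /andP[/eqP-> /eqP->]; rewrite 1?(es (f j)) eij /=; case: (b) (c) => [] [].
Qed.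

Definition extend (f : nat -> T) m w i := if i == m then w else f i.

Lemma extend_old f m w i : i < m -> extend f m w i = f i.
Proof. by rewrite /extend; case: eqP => // ->; rewrite ltnn. Qed.

Lemma extend_new f m w : extend f m w m = w.
Proof. by rewrite /extend eqxx. Qed.

Lemma knows_extend m s f w : knows m s f -> knows m.+1 s (extend f m w).
Proof.
move=> ks i j b /ks [im jm eij]; split; try exact: ltnW.
by rewrite !extend_old.
Qed.

Lemma respects_extend bans m f w : respects bans m f -> respects bans m.+1 (extend f m w).
Proof.
move=> rs b /rs[/allP bm bw]; split; first by apply/allP => i /bm /= /ltnW.
move=> v /bw; congr (~~ (_ && _)); apply: eq_in_all => i ib;
  by rewrite extend_old //; apply: bm; rewrite mem_cat ib ?orbT.
Qed.

Lemma row_okP m s f x (h : nat -> bool) j0 l : knows m s f ->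
  row_ok (nth [::] s x) h j0 l ->
  forall j, j < size l -> e (f x) (f (nth 0 l j)) = h (j0 + j).
Proof.
move=> ks; elim: l j0 => //= y l IH j0 /andP[xy /IH{}IH] [_|j /=]; last by move/IH; rewrite addSnnS.
by rewrite addn0; have [] := ks x y _ xy.
Qed.

Lemma rows_okP m s f h i0 l : knows m s f -> rows_ok s h i0 l ->
  forall i j, i < j < size l ->
    e (f (nth 0 l i)) (f (nth 0 l j)) = h (i0 + i) (i0 + j).
Proof.
move=> ks; elim: l i0 => [|x l IH] i0 /=; first by move=> _ i j; rewrite ltn0 andbF.
case/andP=> xl /IH{}IH [|i] [|j] //= ij; last by rewrite IH // !addSnnS.
by rewrite (row_okP ks xl) // addn0 addSnnS.
Qed.

Definition twin_free k (h : nat -> nat -> bool) : bool :=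
  all (fun x => all (fun y => (x == y) || has (fun z => h x z != h y z) (iota 0 k))
    (iota 0 k)) (iota 0 k).

(** Induced copies have to be injective, which the partial graph does not say.  It follows from the
    adjacencies, since no two vertices of [h] have the same neighbours. *)
Lemma rows_induced m s f k h (l : seq nat) : knows m s f -> size l = k ->
  symmetric h -> (forall i, i < k -> h i i = false) -> twin_free k h ->
  rows_ok s h 0 l -> contains_induced (fun i j : 'I_k => h i j) e.
Proof.
move=> ks sl hs hi tf rl; pose g (i : 'I_k) := f (nth 0 l i).
have [es ei] := Gsimple.
have eg i j : e (g i) (g j) = h i j.
  have lt a b : a < b -> b < k -> e (f (nth 0 l a)) (f (nth 0 l b)) = h a b.
    by move=> ab bk; rewrite (rows_okP ks rl) ?ab ?sl.
  case: (ltngtP i j) => [ij|ij|/ord_inj->]; first exact: lt.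
    by rewrite es hs; apply: lt.
  by rewrite ei hi.
exists g => // i j gij; apply/val_inj/eqP.
have := tf; move/allP/(_ (val i)); rewrite mem_iota ltn_ord => /(_ isT).
move/allP/(_ (val j)); rewrite mem_iota ltn_ord => /(_ isT).
case/orP => // /hasP[z]; rewrite mem_iota => /andP[_ zk].
by rewrite -(eg i (Ordinal zk)) -(eg j (Ordinal zk)) gij eqxx.
Qed.

Lemma path_adj_sym : symmetric path_adj.
Proof. by move=> i j; rewrite /path_adj orbC. Qed.
Lemma cycle_adj_sym k : symmetric (cycle_adj k).
Proof. by move=> i j; rewrite /cycle_adj orbC. Qed.

Lemma forbidden_sound m s f l : knows m s f -> forbidden s l -> False.
Proof.
move=> ks; rewrite /forbidden; case: eqP => [sl rl|_ /andP[sl rl]].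
  case: Gclass => pf _; apply: pf; apply: (rows_induced ks sl path_adj_sym _ _ rl).
    by move=> i _; rewrite /path_adj; rewrite orbb; apply/negP => /eqP /esym/n_Sn.
  by vm_compute.
have [k [ek k7]] : exists k, size l = k /\ k \in [:: 3; 5; 9] by exists (size l).
rewrite ek in rl; have k_not7 : k <> 7 by move=> k_7; rewrite k_7 in k7.
have {}k7 : [\/ k = 3, k = 5 | k = 9].
  by move: k7; rewrite !inE => /or3P[]/eqP; [exact: Or31 | exact: Or32 | exact: Or33].
apply: k_not7; case: Gclass => _; apply; try by case: k7 => ->.
apply: (rows_induced ks ek (@cycle_adj_sym k) _ _ rl).
  move=> i ik; apply/negbTE.
  have /allP : all (fun i => ~~ cycle_adj k i i) (iota 0 k) by case: k7 => ->.
  by apply; rewrite mem_iota.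
by case: k7 => ->; vm_compute.
Qed.

Lemma distinct_sound m s d f u v : knows m s f ->
  (forall i j, (i, j) \in d -> f i != f j) -> distinct m s d u v -> f u != f v.
Proof.
move=> ks kd /or3P[/kd //|/kd|]; first by rewrite eq_sym.
case/hasP => x _ /orP[]/andP[ux vx]; apply/eqP => fuv.
  by have [_ _ e1] := ks _ _ _ ux; have [_ _] := ks _ _ _ vx; rewrite -fuv e1.
by have [_ _ e1] := ks _ _ _ ux; have [_ _] := ks _ _ _ vx; rewrite -fuv e1.
Qed.

(** By induction on the refutation: irreducibility provides the vertex by which [Fold] and [Third]
    extend the partial graph, and every case of a [Split] is refuted. *)
Lemma check_sound bans c m s d f :
  (forall i, i < m -> A (f i)) -> knows m s f ->
  (forall i j, (i, j) \in d -> [/\ i < m, j < m & f i != f j]) ->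
  respects bans m f -> check bans m s d c -> False.
Proof.
have [es _] := Gsimple; have [dom thr] := Airr.
elim: c m s d f => [l|k w|i j c1 IH1 c2 IH2|u v c1 IH|u a b c1 IH] m s d f Af ks kd rs /=.
- exact: forbidden_sound ks.
- case/andP=> /andP[kb wm] /andP[/allP pos /allP neg].
  have [_ /(_ _ (Af _ wm))/negP] := rs _ (mem_nth ([::], [::]) kb); apply.
  apply/andP; split; apply/allP => i; first by case/pos/ks => _ _ ->.
  by case/neg/ks => _ _ ->.
- case/and4P=> im jm c1P c2P; case eij: (e (f i) (f j)).
    by apply: (IH1 _ _ _ _ Af (knows_put im jm eij ks) kd rs c1P).
  by apply: (IH2 _ _ _ _ Af (knows_put im jm eij ks) kd rs c2P).
- case/and4P=> um vm uv c1P.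
  have fuv := distinct_sound ks (fun i j ij => let: And3 _ _ h := kd i j ij in h) uv.
  have [w [Aw uw vw]] := dom _ _ (Af _ um) (Af _ vm) fuv.
  apply: (IH _ _ _ (extend f m w) _ _ _ _ c1P).
  + by move=> i; rewrite ltnS leq_eqVlt /extend; case: eqP => //= _ /Af.
  + apply: knows_put; rewrite ?extend_new ?extend_old ?ltnS ?(ltnW vm) //.
      by rewrite es; apply/negbTE.
    apply: knows_put; rewrite ?extend_new ?extend_old ?ltnS ?(ltnW um) //.
      by rewrite es.
    exact: knows_extend.
  + by move=> i j /kd[im jm fij]; split; try exact: ltnW; rewrite !extend_old.
  exact: respects_extend.
case/and4P=> um am bm c1P; have [w [Aw uw wa wb]] := thr _ (f a) (f b) (Af _ um).
apply: (IH _ _ _ (extend f m w) _ _ _ _ c1P).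
- by move=> i; rewrite ltnS leq_eqVlt /extend; case: eqP => //= _ /Af.
- apply: knows_put; rewrite ?extend_new ?extend_old ?ltnS ?(ltnW um) //.
    by rewrite es.
  exact: knows_extend.
- move=> i j; rewrite !inE => /or3P[/eqP[-> ->]|/eqP[-> ->]|/kd[im jm fij]].
  + by split; rewrite ?ltnS ?leqnn ?(ltnW am) // extend_new extend_old.
  + by split; rewrite ?ltnS ?leqnn ?(ltnW bm) // extend_new extend_old.
  by split; try exact: ltnW; rewrite !extend_old.
exact: respects_extend.
Qed.

Definition cyc (f : nat -> T) : Prop :=
  forall i j, i < 7 -> j < 7 -> e (f i) (f j) = cycle_adj 7 i j.
Definition has_type (f : nat -> T) w t : bool :=
  all (fun i => e w (f i)) (on_cycle t) && all (fun i => ~~ e w (f i)) (off_cycle t).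

Definition meets (f : nat -> T) (c : nat * nat) : Prop :=
  forall w, A w -> if c.1 == 0 then ~~ has_type f w c.2 else
    e w (f c.1) ==> (has_type f w c.2 || has_type f w 14).

Definition realizes (f : nat -> T) (P : pattern) : Prop :=
  [/\ forall k, k < size P.1 ->
        let p := nth (0, [::]) P.1 k in
        [/\ A (f (7 + k)), has_type f (f (7 + k)) p.1
          & forall j, j \in p.2 -> e (f (7 + k)) (f j)]
    & forall c, c \in P.2 -> meets f c].

Definition well_formed (P : pattern) : bool :=
  all (fun k => let p := nth (0, [::]) P.1 k in (p.1 < 15) && all (fun j => 7 <= j < 7 + k) p.2)
    (iota 0 (size P.1)) &&
  all (fun c => ((c.1 == 0) || (7 <= c.1 < 7 + size P.1)) && (c.2 < 15)) P.2.

Lemma on_cycle_lt t i : t < 15 -> i \in on_cycle t -> i < 7.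
Proof.
move=> t15 it.
have /allP/(_ t) : all (fun t => all (gtn 7) (on_cycle t)) (iota 0 15) by vm_compute.
by rewrite mem_iota => /(_ t15) /allP/(_ _ it).
Qed.

Lemma off_cycle_lt t i : i \in off_cycle t -> i < 7.
Proof. by rewrite mem_filter mem_iota => /and3P[]. Qed.

Lemma mem_off_cycle t i : i < 7 -> (i \in off_cycle t) = (i \notin on_cycle t).
Proof. by move=> i7; rewrite mem_filter mem_iota leq0n add0n i7 !andbT. Qed.

(** The converse of the reasoning behind [bans_of]: a vertex singled out by one of these
    adjacencies has neither type [t] nor type R. *)
Lemma bans_respected f m c : 7 <= m -> c.1 < m -> c.2 < 15 -> meets f c ->
  respects (bans_of c) m f.
Proof.
case: c => v t /= m7 vm t15 mc b.
have lt7 i : i < 7 -> i < m by move/leq_trans; apply.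
have mod7 i : i %% 7 < 7 by rewrite ltn_mod.
rewrite /bans_of; case: ifP => v0; [rewrite inE => /eqP->|].
  split.
    apply/allP => i; rewrite mem_cat => /orP[/(on_cycle_lt t15)|/off_cycle_lt] //; exact: lt7.
  by move=> w /mc; rewrite /= v0.
have typed w i : A w -> e w (f v) -> e w (f i) -> i < 7 -> (i \in on_cycle t) && has_type f w t.
  move=> Aw wv wi i7; have := mc _ Aw; rewrite /= v0 wv => /orP[wt|].
    rewrite wt andbT; case it: (i \in on_cycle t) => //.
    by case/andP: wt => _ /allP/(_ i); rewrite mem_off_cycle // it wi => /(_ isT).
  by case/andP=> _ /allP/(_ i) wtR; have := wtR; rewrite mem_off_cycle // wi => /(_ isT).
rewrite mem_cat => /orP[/mapP[i ioff ->]|]; last case: ifP => // t7.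
- have i7 := off_cycle_lt ioff; split; first by rewrite /= vm lt7.
  move=> w Aw; apply/negP => /= /andP[/and3P[wv wi _] _].
  by have := typed w i Aw wv wi i7; rewrite mem_off_cycle // in ioff; rewrite (negbTE ioff).
rewrite !inE => /orP[]/eqP->; (split; first by rewrite /= vm !lt7).
  move=> w Aw; apply/negP => /= /andP[/and3P[wv wi _] /andP[wj _]].
  have /andP[_ /andP[/allP/(_ ((t + 1) %% 7))]] := typed w _ Aw wv wi (mod7 _).
  by rewrite /on_cycle t7 !inE eqxx orbT (negbTE wj) => /(_ isT).
move=> w Aw; apply/negP => /= /andP[/and3P[wv wi _] /andP[wj _]].
have /andP[_ /andP[/allP/(_ ((t + 6) %% 7))]] := typed w _ Aw wv wi (mod7 _).
by rewrite /on_cycle t7 !inE eqxx (negbTE wj) => /(_ isT).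
Qed.
End Soundness.

(** * Symmetries of the seven-cycle *)

(** The dihedral group of the cycle, acting on indices: [i] goes to [r + i] or, if [b] holds, to
    [r - i], where 6 stands for -1 modulo 7.  Indices of other vertices are fixed. *)
Definition turn r (b : bool) i :=
  if i < 7 then (if b then (r + 6 * i) %% 7 else (r + i) %% 7) else i.
Definition unturn r (b : bool) := if b then r else (7 - r) %% 7.
Definition turn_type r b t :=
  if t < 7 then turn r b t else if t < 14 then 7 + turn r b (t - 7) else t.
Definition turn_pattern r b (P : pattern) : pattern :=
  ([seq (turn_type r b p.1, p.2) | p <- P.1], [seq (c.1, turn_type r b c.2) | c <- P.2]).
(** One refuted configuration in each orbit of the dihedral group is enough. *)
Definition excluded (ps : seq pattern) (P : pattern) : bool :=
  if well_formed P then
    has (fun r => (turn_pattern r false P \in ps) || (turn_pattern r true P \in ps)) (iota 0 7)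
  else false.

Section Patterns.
Variables (T : finType) (e : rel T) (A : pred T).
Hypotheses (Gsimple : simple_graph e) (Gclass : class_G 10 7 e).
Hypothesis Airr : irreducible e A.

Lemma knows_fold M s (f : nat -> T) m b l : m < M -> knows e M s f ->
  {in l, forall x, x < M /\ e (f m) (f x) = b} ->
  knows e M (foldl (fun s x => put s m x b) s l) f.
Proof.
move=> mM; elim: l s => //= x l IH s ks xl; apply: IH.
  by have [xM fx] := xl x (mem_head _ _); apply: knows_put.
by move=> y yl; apply: xl; rewrite inE yl orbT.
Qed.

Lemma knows_givens M (f : nat -> T) gs m s : m + size gs <= M -> knows e M s f ->
  (forall k, k < size gs -> let g := nth ([::], [::]) gs k in
     {in g.1, forall x, x < M /\ e (f (m + k)) (f x) = true} /\
     {in g.2, forall x, x < M /\ e (f (m + k)) (f x) = false}) ->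
  knows e M (foldl (fun ms pq => (ms.1.+1, foldl (fun s x => put s ms.1 x false)
       (foldl (fun s x => put s ms.1 x true) ms.2 pq.1) pq.2)) (m, s) gs).2 f.
Proof.
elim: gs m s => //= g gs IH m s; rewrite addnS => mM ks kg.
have lt_mM : m < M by apply: leq_trans mM; rewrite ltnS leq_addr.
apply: IH; first by rewrite addSn.
  have [g1 g2] := kg 0 isT; rewrite addn0 in g1 g2.
  by apply: knows_fold => //; apply: knows_fold.
by move=> k km; have := kg k.+1 km; rewrite /= addnS addSn.
Qed.

Lemma knows_cycle M f : 7 <= M -> cyc e f -> knows e M known7 f.
Proof.
move=> M7 cf.
have ksl l s : all (fun p => (p.1 < 7) && (p.2 < 7)) l -> knows e M s f ->
    knows e M (foldl (fun s ij => put s ij.1 ij.2 (cycle_adj 7 ij.1 ij.2)) s l) f.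
  elim: l s => //= -[i j] l IH s /andP[/andP[i7 j7] /IH{}IH] ks.
  by apply: IH; apply: knows_put => //; [exact: leq_trans M7 | exact: leq_trans M7 | exact: cf].
apply: ksl; first by vm_compute.
by move=> i j b; rewrite /fact nth_nseq if_same nth_nil.
Qed.

(** A realization of the pattern is a vertex assignment that agrees with the initial partial graph of
    the refutation. *)
Lemma verified_sound P c f : well_formed P -> verified P c ->
  cyc e f -> (forall i, i < 7 -> A (f i)) -> realizes e A f P -> False.
Proof.
case/andP=> /allP wf1 /allP wf2 vP cf Af [rv rc].
set M := 7 + size P.1.
have kg : knows e M (start_known P) f.
  apply: knows_givens; rewrite ?size_map //; first by apply: knows_cycle; rewrite // leq_addr.
  move=> k kP; rewrite (nth_map (0, [::])) //=.
  have := wf1 k; rewrite mem_iota => /(_ kP) /andP[t15 /allP adj].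
  have [Ak /andP[/allP on /allP off] ek] := rv k kP.
  have lt7M i : i < 7 -> i < M by move/leq_trans; apply; apply: leq_addr.
  split=> x; rewrite ?mem_cat.
    case/orP => xP; last by split; [case/andP: (adj x xP) => _ /leq_trans; apply;
      rewrite leq_add2l ltnW | apply: ek].
    by split; [apply/lt7M/(on_cycle_lt t15) | apply: on].
  by move=> xP; split; [apply/lt7M/(off_cycle_lt xP) | apply/negbTE/off].
apply: (check_sound Gsimple Gclass Airr _ kg _ _ vP) => //.
  move=> i iM; case: (ltnP i 7) => [/Af //|i7].
  have [] := rv (i - 7); rewrite ?subnKC //.
  by rewrite -(ltn_add2l 7) subnKC.
move=> b /flattenP[bs /mapP[x xP ->] bb].
have /andP[x1 x2] := wf2 _ xP.
apply: bans_respected bb => //; last exact: rc.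
by case/orP: x1 => [/eqP->|/andP[]].
Qed.

Lemma turn_lt r b i : i < 7 -> turn r b i < 7.
Proof. by rewrite /turn => ->; case: b; rewrite ltn_mod. Qed.

Lemma turn_big r b i : 7 <= i -> turn r b i = i.
Proof. by rewrite /turn leqNgt => /negbTE->. Qed.

Lemma turn_on_cycle r b t : r < 7 -> t < 15 ->
  perm_eq [seq turn (unturn r b) b i | i <- on_cycle (turn_type r b t)] (on_cycle t).
Proof.
move=> r7 t15.
have /allP/(_ r) : all (fun r => all (fun t => all (fun b =>
   perm_eq [seq turn (unturn r b) b i | i <- on_cycle (turn_type r b t)] (on_cycle t))
   [:: false; true]) (iota 0 15)) (iota 0 7) by vm_compute.
rewrite mem_iota => /(_ r7) /allP/(_ t); rewrite mem_iota => /(_ t15) /allP; apply.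
by case: b.
Qed.

Lemma turn_off_cycle r b t : r < 7 -> t < 15 ->
  perm_eq [seq turn (unturn r b) b i | i <- off_cycle (turn_type r b t)] (off_cycle t).
Proof.
move=> r7 t15.
have /allP/(_ r) : all (fun r => all (fun t => all (fun b =>
   perm_eq [seq turn (unturn r b) b i | i <- off_cycle (turn_type r b t)] (off_cycle t))
   [:: false; true]) (iota 0 15)) (iota 0 7) by vm_compute.
rewrite mem_iota => /(_ r7) /allP/(_ t); rewrite mem_iota => /(_ t15) /allP; apply.
by case: b.
Qed.

(** Turning the cycle back while turning the types forward changes nothing. *)
Lemma has_type_turn f w r b t : r < 7 -> t < 15 ->
  has_type e (fun i => f (turn (unturn r b) b i)) w (turn_type r b t) = has_type e f w t.
Proof.
move=> r7 t15; rewrite /has_type -(perm_all _ (turn_on_cycle b r7 t15)).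
by rewrite -(perm_all _ (turn_off_cycle b r7 t15)) !all_map.
Qed.

Lemma cyc_turn f r b : r < 7 -> cyc e f -> cyc e (fun i => f (turn r b i)).
Proof.
move=> r7 cf i j i7 j7; rewrite cf ?turn_lt //; apply/eqP.
have /allP/(_ r) : all (fun r => all (fun b => all (fun i => all (fun j =>
   cycle_adj 7 (turn r b i) (turn r b j) == cycle_adj 7 i j) (iota 0 7)) (iota 0 7))
   [:: false; true]) (iota 0 7) by vm_compute.
rewrite mem_iota => /(_ r7) /allP/(_ b) h; have {h} := h (_ : b \in [:: false; true]).
case: b => /(_ isT) /allP/(_ i); rewrite mem_iota => /(_ i7) /allP/(_ j);
by rewrite mem_iota => /(_ j7).
Qed.

Lemma realizes_turn f r b P : r < 7 -> well_formed P -> realizes e A f P ->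
  realizes e A (fun i => f (turn (unturn r b) b i)) (turn_pattern r b P).
Proof.
move=> r7 /andP[/allP wf1 /allP wf2] [rv rc].
have u7 : unturn r b < 7 by rewrite /unturn; case: b; rewrite ?ltn_mod.
have e14 : turn_type r b 14 = 14 by [].
split=> [k|c /mapP[x xP ->]].
  rewrite size_map => kP; rewrite (nth_map (0, [::])) //=.
  have := wf1 k; rewrite mem_iota => /(_ kP) /andP[t15 adj].
  have [Ak tk ek] := rv k kP; rewrite turn_big ?leq_addr //; split => //.
    by rewrite has_type_turn.
  by move=> j jP; have := allP adj j jP => /andP[j7 _]; rewrite turn_big // ek.
have /andP[x1 x2] := wf2 _ xP; have := rc _ xP; case: x x1 x2 {xP} => v t /= v7 t15 mf w Aw.
have := mf w Aw; rewrite /= !has_type_turn //.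
have := @has_type_turn f w r b 14 r7 isT; rewrite e14 => ->.
by case/orP: v7 => [/eqP->|/andP[v7 _]] //; rewrite turn_big.
Qed.

Lemma excluded_sound (db : seq pattern) f P :
  (forall Q, Q \in db -> well_formed Q /\ exists c, verified Q c) ->
  excluded db P -> cyc e f -> (forall i, i < 7 -> A (f i)) -> realizes e A f P -> False.
Proof.
move=> dbP; rewrite /excluded; case: ifP => // wf /hasP[r]; rewrite mem_iota => /andP[_ r7] inP cf Af rf.
have [b bP] : exists b, turn_pattern r b P \in db by case/orP: inP; [exists false | exists true].
have [wfQ [c vc]] := dbP _ bP; have u7 : unturn r b < 7 by rewrite /unturn; case: b {bP wfQ vc};
  rewrite ?ltn_mod.
apply: verified_sound wfQ vc _ _ (realizes_turn b r7 wf rf); first exact: cyc_turn.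
by move=> i i7; apply: Af; apply: turn_lt.
Qed.
End Patterns.

(** * The excluded configurations *)

Definition tD i := i %% 7.
Definition tL i := 7 + i %% 7.
Definition tR := 14.
(** The types that a vertex of type R can see lie in {D_{s-1}, D_{s+1}, L_{s-2}, L_{s+2}} for some [s];
    these are the pairs of such types. *)
Definition pairs s : seq (nat * nat) :=
  let a := tD (s + 6) in let b := tD (s + 1) in let c := tL (s + 5) in let d := tL (s + 2) in
  [:: (a, b); (a, c); (a, d); (b, c); (b, d); (c, d)].
Definition on7 (t : nat) := (t, [:: 7]).
Definition on8 (t : nat) := (t, [:: 8]).
Definition edge_pat t t' : pattern := ([:: (t, [::]); (t', [:: 7])], [::]).
(** A vertex of type R with neighbours of the types [ts]. *)
Definition star_pat (ts : seq nat) : pattern := ((tR, [::]) :: [seq on7 t | t <- ts], [::]).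
(** Two adjacent vertices of type R with neighbours of the types [ts] and [ts']. *)
Definition link_pat (ts ts' : seq nat) cs : pattern :=
  ([:: (tR, [::]); (tR, [:: 7])] ++ [seq on7 t | t <- ts] ++ [seq on8 t | t <- ts'], cs).
Definition plain (ps : seq pattern) : seq (pattern * script) := [seq (p, [::]) | p <- ps].
Definition scripted (ps : seq pattern) (h : seq script) := [seq (nth ([::],[::]) ps i,
  nth [::] h i) | i <- iota 0 (size ps)].

(** Up to symmetry, these are the types D and L of vertices that are never adjacent. *)
Definition near_edge_cases := plain [:: edge_pat (tD 0) (tD 0); edge_pat (tD 0) (tD 2);
  edge_pat (tD 0) (tD 3);
   edge_pat (tL 0) (tD 1); edge_pat (tL 0) (tD 3); edge_pat (tL 0) (tL 0); edge_pat (tL 0) (tL 2)].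
(** Two types that do not belong to a common [s], see [pairs]; with [star_triple_cases] they say which
    types a vertex of type R can see. *)
Definition star_pair_cases := plain [:: star_pat [:: tD 0; tD 1]; star_pat [:: tD 0; tD 3];
  star_pat [:: tD 0; tL 0]; star_pat [:: tD 0; tL 2];
   star_pat [:: tL 0; tL 1]; star_pat [:: tL 0; tL 2]].
Definition star_triple_cases : seq (pattern * script) := [:: (star_pat [:: tD 0; tD 2; tL 1], [:: (7, 1);
  (11, 8); (11, 10); (2, 9); (14, 1); (10, 9); (3, 12); (11, 9); (13, 2); (13, 9); (13, 9); (11, 10);
  (10, 9); (2, 9); (2, 9); (11, 10); (2, 9); (14, 1); (10, 9); (14, 1); (12, 7)])].
(** All seven types L_i occur. *)
Definition no_gap_cases : seq (pattern * script) := [:: (([seq (tL i, [::]) | i <- iota 0 7], [::]), [:: (11,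
  3); (6, 14); (11, 5); (2, 14); (13, 0); (4, 14); (11, 5); (2, 14); (13, 0); (13, 5); (11, 3); (11, 5);
  (11, 5); (2, 14); (9, 3); (0, 14); (11, 3); (6, 14); (13, 5); (1, 14); (11, 3); (6, 14); (11, 5); (2, 14);
  (13, 0); (4, 14); (13, 5); (1, 14); (13, 0); (13, 5); (11, 3); (11, 5); (11, 5); (2, 14); (15, 9); (9, 1);
  (4, 14); (9, 1); (9, 3); (9, 1); (4, 14); (9, 1); (9, 3); (9, 1); (9, 3); (9, 3); (9, 3); (0, 14); (9, 3);
  (0, 14); (9, 3); (0, 14); (13, 0); (9, 3); (13, 5); (9, 3); (0, 14); (9, 3); (0, 14); (15, 7); (9, 3);
  (0, 14); (15, 7); (12, 4); (0, 15); (10, 2); (5, 14); (10, 2); (5, 14); (10, 4); (1, 14); (10, 4); (1, 14);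
  (12, 4); (0, 14); (12, 4); (12, 6); (7, 6); (2, 14); (7, 1); (5, 14); (7, 6); (2, 14); (7, 1); (7, 6);
  (7, 6); (2, 14); (10, 4); (1, 14); (12, 4); (0, 14); (7, 6); (2, 14); (12, 4); (0, 14); (12, 4); (12, 6);
  (12, 6); (3, 14); (7, 1); (5, 14); (7, 6); (2, 14); (7, 1); (7, 6); (7, 6); (2, 14); (15, 9); (10, 2);
  (10, 4); (10, 2); (10, 4); (10, 2); (7, 6); (10, 4); (10, 4); (1, 14); (10, 4); (1, 14); (15, 8); (10, 4);
  (1, 14); (7, 1); (7, 6); (7, 6); (7, 6); (2, 14); (15, 9); (11, 5); (2, 15); (8, 0); (3, 14); (13, 0);
  (4, 14); (11, 5); (2, 14); (12, 6); (12, 4); (11, 5); (11, 3); (12, 4); (12, 6); (12, 6); (8, 0); (3, 14);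
  (8, 0); (3, 14); (8, 0); (8, 2); (8, 0); (3, 14); (8, 0); (3, 14); (8, 0); (3, 14); (8, 0); (3, 14);
  (8, 0); (8, 2); (8, 0); (3, 14); (15, 10); (8, 0); (8, 2); (8, 2); (11, 3); (8, 0); (11, 5); (8, 0);
  (3, 14); (15, 10); (12, 6); (3, 15); (9, 3); (9, 1); (8, 2); (6, 14); (8, 2); (6, 14); (8, 2); (6, 14);
  (10, 2); (5, 14); (8, 2); (6, 14); (8, 2); (8, 0); (9, 1); (9, 3); (9, 3); (7, 1); (5, 14); (7, 1);
  (5, 14); (12, 6); (3, 14); (7, 6); (7, 1); (13, 0); (13, 5); (13, 5); (7, 1); (5, 14); (9, 1); (4, 14);
  (12, 4); (9, 1); (12, 6); (7, 1); (5, 14); (9, 1); (4, 14); (7, 1); (5, 14); (15, 12); (9, 1); (4, 14);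
  (15, 11); (13, 0); (4, 15); (10, 4); (10, 2); (11, 3); (6, 14); (10, 2); (10, 4); (10, 4); (8, 2); (6, 14);
  (13, 0); (4, 14); (7, 1); (7, 6); (7, 1); (7, 6); (7, 6); (10, 2); (5, 14); (8, 2); (6, 14); (15, 13);
  (10, 2); (5, 14); (15, 12); (7, 1); (5, 15); (12, 4); (0, 14); (8, 2); (6, 14); (15, 13); (11, 3); (6, 15);
  (11, 3); (11, 5); (11, 5); (7, 1); (5, 14); (8, 0); (8, 2); (8, 2); (7, 1); (5, 14); (15, 12); (10, 2);
  (5, 15); (11, 5); (8, 2); (6, 15); (9, 1); (9, 3); (9, 3); (2, 14); (15, 9); (11, 3); (9, 3); (0, 18);
  (9, 3); (9, 3); (0, 18); (9, 3); (9, 1); (0, 15); (9, 1); (7, 6); (2, 15); (11, 3); (7, 6); (2, 16);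
  (13, 0); (13, 5); (13, 5); (10, 4); (1, 16); (13, 0); (13, 5); (13, 5); (7, 6); (2, 15); (13, 0); (13, 5);
  (13, 5); (9, 1); (4, 15); (9, 1); (4, 15); (16, 11); (13, 0); (4, 16); (9, 1); (4, 15); (16, 11); (13, 0);
  (4, 16)])].

(** For the patterns at distance 2, in their order; most are refuted without adding a vertex. *)
Definition link_hints_2 : seq script :=
  [:: [::]; [::]; [::]; [::]; [::]; [::]; [::]; [::]; [::]; [::];
      [:: (3, 11); (13, 4)]; [::]; [::]; [::]; [::]; [::]; [::]; [::]; [::]; [::]; [::]; [::]; [::]; [::];
        [::]; [::]; [::]; [::]; [::]; [::]; [::]; [::]; [::]; [::]; [::];
      [:: (3, 3); (2, 13); (6, 6); (0, 14); (5, 14); (4, 13)]].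
Definition link_hints_3 : seq script :=
  [:: [::];
      [:: (2, 11); (13, 1); (2, 11); (13, 1)]; [::]; [::]; [::]; [::]; [::];
      [:: (2, 11); (13, 1)]; [::]; [::]; [::]; [::]; [::]; [::]; [::]; [::]; [::]; [::]; [::];
      [:: (2, 11); (13, 1); (2, 11); (13, 1)]].
Definition D_hanging_hints_0 : seq script :=
  [:: [:: (7, 10); (7, 11); (1, 11); (12, 8)];
      [:: (7, 11)];
      [:: (7, 11)];
      [:: (7, 11)];
      [:: (7, 11)];
      [:: (7, 10)]].
Definition D_hanging_hints_1 : seq script :=
  [::].
Definition D_hanging_hints_3 : seq script :=
  [:: [::]; [::]; [::]; [::];
      [:: (7, 11)]].
Definition D_hanging_hints_2 : seq script :=
  [:: [:: (0, 9); (12, 1)]; [::];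
      [:: (0, 9); (12, 1)]; [::];
      [:: (0, 9); (12, 1)]].
Definition D_D_hints : seq script :=
  [:: [::]; [::];
      [:: (0, 9); (11, 1); (3, 10)]].
Definition L_L_hints : seq script :=
  [:: [::];
      [:: (7, 10)];
      [:: (4, 4); (3, 11); (5, 11); (5, 11)];
      [:: (7, 10)]].
Definition L_hanging_hints_0 : seq script :=
  [:: [::]; [::]; [::]; [::]; [::];
      [:: (7, 7); (9, 12); (8, 12)]].
Definition L_hanging_hints_1 : seq script :=
  [:: [:: (7, 11); (2, 11); (2, 11); (5, 5); (6, 14); (4, 14); (7, 11); (2, 11); (5, 5); (6, 14); (4, 14)];
      [:: (7, 11); (7, 11)];
      [:: (7, 11); (7, 11)];
      [:: (7, 11)];
      [:: (7, 11)];
      [:: (7, 10)]].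
Definition L_hanging_hints_2 : seq script :=
  [:: [::]; [::]; [::]; [::];
      [:: (7, 11)]].
Definition L_hanging_hints_3 : seq script :=
  [:: [:: (4, 11); (2, 10); (7, 10); (6, 6); (0, 13); (5, 13)];
      [:: (7, 11)];
      [:: (2, 10); (7, 10)];
      [:: (7, 11)];
      [:: (7, 7); (9, 12); (2, 13); (8, 12); (2, 13); (4, 13); (4, 10)];
      [:: (7, 10)]].
Definition L_D_hints : seq script :=
  [:: [::];
      [:: (8, 9)]].
Definition fork_hints : seq script :=
  [:: [:: (1, 1); (2, 13); (0, 13)];
      [:: (3, 12); (3, 12)]].
Definition remote_L_hints : seq script :=
  [:: [:: (8, 9)]].
Definition remote_D_D_hints : seq script :=
  [:: [:: (8, 9); (8, 10); (0, 9); (2, 10); (11, 7); (8, 8); (7, 13); (11, 13); (4, 4); (3, 13); (5, 13);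
    (5, 5); (6, 13); (4, 13)]].
Definition remote_fork_hints : seq script :=
  [:: [:: (3, 3); (2, 12); (4, 12)]; [::];
      [:: (0, 10)]].
Definition remote_remote_hints : seq script :=
  [:: [:: (9, 7)]].

Definition link_pats s s' cs := [seq link_pat [:: p.1; p.2] [:: q.1; q.2] cs | p <- pairs s, q <- pairs s'].
(** The first vertex sees the type [t] only, apart from R; the second sees a pair of types of index [s]. *)
Definition hanging_pats t s cs := [seq link_pat [:: t] [:: q.1; q.2] ((7, t) :: cs) | q <- pairs s].
(** Each of the two adjacent vertices sees a single type apart from R. *)
Definition singles_pat t t' := link_pat [:: t] [:: t'] [:: (7, t); (8, t')].
(** A vertex with two neighbours of type R, where each of the three sees a single type apart from R. *)
Definition fork_pat t t1 t2 : pattern :=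
  ([:: (tR, [::]); (tR, [:: 7]); (tR, [:: 7]); on7 t; on8 t1; (t2, [:: 9])], [:: (7, t); (8, t1); (9, t2)]).
(** A vertex that sees only vertices of type R, next to one that sees the types [ts]. *)
Definition remote_pat ts : pattern := ([:: (tR, [::]); (tR, [:: 7])] ++ [seq on7 t | t <- ts], [:: (8, tR)]).
(** A vertex that sees only vertices of type R, next to two that see a single type each apart from R. *)
Definition remote_fork_pat t t' : pattern :=
  ([:: (tR, [::]); (tR, [::]); (tR, [:: 7; 8]); on7 t; on8 t'], [:: (9, tR); (7, t); (8, t')]).
(** A path of two vertices that see only type R and a vertex that sees a single type apart from R. *)
Definition remote_remote_pat t : pattern :=
  ([:: (tR, [::]); (tR, [:: 7]); (tR, [:: 8]); on7 t], [:: (8, tR); (9, tR); (7, t)]).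
(** By symmetry the index of the first pair is 0.  Indices at distance 3 are excluded only if an
    L_i between them is empty. *)
Definition link_cases := plain (link_pats 0 0 [::]) ++ scripted (link_pats 0 2 [::]) link_hints_2 ++
  scripted (link_pats 0 3 [:: (0, tL 2)]) link_hints_3.
Definition D_hanging_cases := scripted (hanging_pats (tD 0) 0 [::]) D_hanging_hints_0 ++
  scripted (hanging_pats (tD 0) 1 [::]) D_hanging_hints_1
  ++ scripted (hanging_pats (tD 0) 3 [::]) D_hanging_hints_3 ++
    scripted (hanging_pats (tD 0) 2 [:: (0, tL 0)]) D_hanging_hints_2.
Definition D_D_cases := scripted [seq singles_pat (tD 0) (tD j) | j <- [:: 0; 2; 3]] D_D_hints.
Definition L_L_cases := scripted [seq singles_pat (tL 0) (tL j) | j <- [:: 0; 1; 2; 3]] L_L_hints.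
Definition L_hanging_cases := scripted (hanging_pats (tL 0) 0 [::]) L_hanging_hints_0 ++
  scripted (hanging_pats (tL 0) 1 [::]) L_hanging_hints_1
  ++ scripted (hanging_pats (tL 0) 2 [::]) L_hanging_hints_2 ++
    scripted (hanging_pats (tL 0) 3 [::]) L_hanging_hints_3.
Definition L_D_cases := scripted [seq singles_pat (tL 0) (tD j) | j <- [:: 1; 2]] L_D_hints.
Definition fork_cases := scripted [:: fork_pat (tL 0) (tD 3) (tD 4);
  fork_pat (tL 0) (tD 0) (tD 3)] fork_hints.
Definition remote_cases := scripted [:: remote_pat [:: tL 0]] remote_L_hints ++
  scripted [:: remote_pat [:: tD 0; tD 2]] remote_D_D_hints
  ++ scripted [seq remote_fork_pat (tD 0) (tD j) | j <- [:: 1; 2; 3]] remote_fork_hints ++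
    scripted [:: remote_remote_pat (tD 0)] remote_remote_hints.
Definition cases := near_edge_cases ++ star_pair_cases ++ star_triple_cases ++ no_gap_cases ++ link_cases ++
  D_hanging_cases ++ D_D_cases ++ L_L_cases ++ L_hanging_cases ++ L_D_cases ++ fork_cases ++ remote_cases.
(** The search is evaluated here, once; the proofs below only depend on its result. *)
Definition certificates : seq cert := Eval vm_compute in map certificate_for cases.

Lemma certified : all (fun pc => well_formed pc.1 && verified pc.1 pc.2) (zip (map fst cases) certificates).
Proof. by vm_cast_no_check (erefl true). Qed.

Lemma certified_mem db Q : {subset db <= cases} -> Q \in map fst db ->
  well_formed Q /\ exists c, verified Q c.
Proof.
move=> sub /mapP[ph /sub phA ->].
have sz : size (map fst cases) = size certificates by vm_cast_no_check (erefl (size certificates)).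
have /(nthP ([::], [::])) [i ilt <-] : ph.1 \in map fst cases by apply: map_f.
have := all_nthP (([::], [::]), Leaf [::]) certified i.
rewrite size_zip -sz minnn nth_zip //= => /(_ ilt) /andP[wf vc].
by split=> //; exists (nth (Leaf [::]) certificates i).
Qed.

(** * The colouring around a seven-cycle, and its tables *)

(** The colours of D_0, ..., D_6 and of L_0, ..., L_5; L_6 is supposed to be empty. *)
Definition type_colour t := nth 0 [:: 1; 2; 1; 2; 1; 2; 3; 3; 1; 2; 1; 2; 3] t.
Definition slot_types s := [:: tD (s + 6); tD (s + 1); tL (s + 5); tL (s + 2)].
(** The index [s] of a pair of types, see [pairs]. *)
Definition slot t1 t2 :=
  find (fun s => (t1 \in slot_types s) && (t2 \in slot_types s)) (iota 0 7).
(** The colour of a vertex of type R that sees the types [t1] and [t2], or only [t1] if [t2] is 14.  A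
    vertex with two types gets the colour of D_s, one with D_i the colour of L_i (1 for L_6), and 0 is
    for those that are coloured later: they see no type but R, or only one of the L_i. *)
Definition far_colour t1 t2 :=
  if t2 == 14 then nth 0 [:: 3; 1; 2; 1; 2; 3; 1] t1
  else nth 0 [:: 1; 2; 1; 2; 1; 2; 3] (slot t1 t2).

Definition near_edge_patterns : seq pattern := Eval vm_compute in map fst near_edge_cases.
Definition star_pair_patterns : seq pattern := Eval vm_compute in map fst star_pair_cases.
Definition star_triple_patterns : seq pattern := Eval vm_compute in map fst star_triple_cases.
Definition D_D_patterns : seq pattern := Eval vm_compute in map fst D_D_cases.
Definition L_L_patterns : seq pattern := Eval vm_compute in map fst L_L_cases.
Definition L_D_patterns : seq pattern := Eval vm_compute in map fst L_D_cases.
Definition fork_patterns : seq pattern := Eval vm_compute in map fst fork_cases.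
Definition remote_patterns : seq pattern := Eval vm_compute in map fst remote_cases.
(** The two orders of the types give different patterns. *)
Definition star_excluded t1 t2 := excluded star_pair_patterns (star_pat [:: t1; t2]) ||
  excluded star_pair_patterns (star_pat [:: t2; t1]).
Definition star3_excluded t1 t2 t3 := has (fun p => excluded star_triple_patterns (star_pat p))
  [:: [:: t1; t2; t3]; [:: t1; t3; t2]; [:: t2; t1; t3]; [:: t2; t3; t1]; [:: t3; t1; t2]; [:: t3; t2; t1]].
Definition edge_excluded t t' := excluded near_edge_patterns (edge_pat t t') ||
  excluded near_edge_patterns (edge_pat t' t).
Definition either_order d (p : nat * nat) := (p \in pairs d) || ((p.2, p.1) \in pairs d).
(** Turns the type [t] to D_0 or L_0 in the two possible ways.  All indices of the pair are
    excluded when the empty type L_6 becomes L_0. *)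
Definition hanging_query ds t (p : nat * nat) :=
  let i := if t < 7 then t else t - 7 in
  has (fun rb => let t' x := turn_type rb.1 rb.2 x in
      has (fun d => either_order d (t' p.1, t' p.2))
      (if t' 13 == 7 then [:: 0; 1; 2; 3] else ds))
    [:: ((7 - i) %% 7, false); (i, true)].
Definition singles_excluded pats t t' := excluded pats (singles_pat t t').

(** After turning, the first pair has index 0; the empty type L_6 must become L_2 if the second pair
    has index 3. *)
Definition link_query_at r b (p q : nat * nat) :=
  let t x := turn_type r b x in
  if r < 7 then
    if either_order 0 (t p.1, t p.2) then
      has (fun d => either_order d (t q.1, t q.2))
        (if t 13 == 9 then [:: 0; 2; 3] else [:: 0; 2])
    else false
  else false.
Definition link_query (p q : nat * nat) :=
  let s := slot p.1 p.2 in let s' := slot q.1 q.2 in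
  [|| link_query_at ((7 - s) %% 7) false p q, link_query_at s true p q,
      link_query_at ((7 - s') %% 7) false q p | link_query_at s' true q p].
Definition types := [seq t <- iota 0 14 | t != 13].
Definition type_pairs := [seq p <- [seq (a, b) | a <- types,
  b <- types] | (p.1 < p.2) && ~~ star_excluded p.1 p.2].

Definition far_L := [:: 7; 8; 9; 10; 11; 12].

(** The tables reduce properness to excluded patterns, one table for each combination of sorts of
    vertices.  They use conditionals instead of disjunctions to evaluate the second alternative only
    when it is needed. *)
Lemma table_edge : all (fun t => all (fun t' =>
  if type_colour t == type_colour t' then edge_excluded t t' else true) types) types.
Proof. by vm_cast_no_check (erefl true). Qed.
Lemma table_single : all (fun t =>
  if type_colour t == far_colour t 14 then type_colour t == 0 else true) types.
Proof. by vm_cast_no_check (erefl true). Qed.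
Lemma table_star : all (fun p => all (fun t =>
  if type_colour t == far_colour p.1 p.2 then
    if star_excluded t p.1 then true else if star_excluded t p.2 then true else star3_excluded t p.1 p.2
  else true) types) type_pairs.
Proof. by vm_cast_no_check (erefl true). Qed.
Lemma table_multi : all (fun p => far_colour p.1 p.2 \in [:: 1; 2; 3]) type_pairs.
Proof. by vm_cast_no_check (erefl true). Qed.
Lemma table_single_single : all (fun t => all (fun t' =>
  if far_colour t 14 == far_colour t' 14 then singles_excluded D_D_patterns t t' ||
    singles_excluded D_D_patterns t' t
  else true) (iota 0 7)) (iota 0 7).
Proof. by vm_cast_no_check (erefl true). Qed.
Lemma table_single_multi : all (fun t => all (fun p =>
  if far_colour t 14 == far_colour p.1 p.2 then hanging_query [:: 0; 1; 3] t p else true)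
  type_pairs) (iota 0 7).
Proof. by vm_cast_no_check (erefl true). Qed.
Lemma table_multi_multi : all (fun p => all (fun q =>
  if far_colour p.1 p.2 == far_colour q.1 q.2 then link_query p q else true) type_pairs) type_pairs.
Proof. by vm_cast_no_check (erefl true). Qed.
Lemma table_L_L : all (fun t => all (fun t' => singles_excluded L_L_patterns t t' ||
  singles_excluded L_L_patterns t' t) far_L) far_L.
Proof. by vm_cast_no_check (erefl true). Qed.
Lemma table_L_multi : all (fun t => all (hanging_query [:: 0; 1; 2; 3] t) type_pairs) far_L.
Proof. by vm_cast_no_check (erefl true). Qed.
Lemma table_fork : all (fun t => all (fun t1 => all (fun t2 =>
  if t1 == t2 then true else if singles_excluded L_D_patterns t t1 then true else
  if singles_excluded L_D_patterns t t2 then true else if excluded fork_patterns (fork_pat t t1 t2) then true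
  else excluded fork_patterns (fork_pat t t2 t1)) (iota 0 7)) (iota 0 7)) far_L.
Proof. by vm_cast_no_check (erefl true). Qed.
Lemma table_far_L : all (fun t => excluded remote_patterns (remote_pat [:: t])) far_L.
Proof. by vm_cast_no_check (erefl true). Qed.
Lemma table_far_D : all (fun t => all (fun t' => if t < t' then
   if star_excluded t t' then true else excluded remote_patterns (remote_pat [:: t; t']) ||
     excluded remote_patterns (remote_pat [:: t'; t])
   else true) (iota 0 7)) (iota 0 7).
Proof. by vm_cast_no_check (erefl true). Qed.
Lemma table_far_fork : all (fun t => all (fun t' => if t == t' then true else
   excluded remote_patterns (remote_fork_pat t t') ||
     excluded remote_patterns (remote_fork_pat t' t)) (iota 0 7)) (iota 0 7).
Proof. by vm_cast_no_check (erefl true). Qed.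
Lemma table_far_far : all (fun t => excluded remote_patterns (remote_remote_pat t)) (iota 0 7).
Proof. by vm_cast_no_check (erefl true). Qed.

Lemma allP2 (a b : seq nat) (P : nat -> nat -> bool) x y :
  all (fun t => all (P t) b) a -> x \in a -> y \in b -> P x y.
Proof. by move=> /allP h /h /allP h' /h'. Qed.

Section Colouring.
Variables (T : finType) (e : rel T) (A : pred T).
Hypotheses (Gsimple : simple_graph e) (Gclass : class_G 10 7 e).
Hypothesis Airr : irreducible e A.
Variable f : nat -> T.
Hypotheses (cf : cyc e f) (Af : forall i, i < 7 -> A (f i)).

Local Notation ht := (has_type e f).

(** The cycle followed by further vertices, numbered as in a [pattern]. *)
Definition ext (vs : seq T) i := nth (f 0) ([seq f j | j <- iota 0 7] ++ vs) i.

Lemma ext_lt vs i : i < 7 -> ext vs i = f i.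
Proof.
move=> i7; rewrite /ext nth_cat size_map size_iota i7 (nth_map 0) ?size_iota //.
by rewrite nth_iota.
Qed.

Lemma ext_add vs k : ext vs (7 + k) = nth (f 0) vs k.
Proof. by rewrite /ext nth_cat size_map size_iota ltnNge leq_addr /= addKn. Qed.

Lemma ht_ext vs w t : t < 15 -> has_type e (ext vs) w t = ht w t.
Proof.
move=> t15; rewrite /has_type; congr (_ && _); apply: eq_in_all => i.
  by move/(on_cycle_lt t15)/ext_lt->.
by move/off_cycle_lt/ext_lt->.
Qed.

Lemma cyc_ext vs : cyc e (ext vs).
Proof. by move=> i j i7 j7; rewrite !ext_lt // cf. Qed.

Lemma A_ext vs i : i < 7 -> A (ext vs i).
Proof. by move=> i7; rewrite ext_lt // Af. Qed.

Lemma cases_verified Q : Q \in map fst cases -> well_formed Q /\ exists c, verified Q c.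
Proof. exact: certified_mem. Qed.

Lemma excluded_ext db P vs : {subset db <= map fst cases} -> excluded db P ->
  ~ realizes e A (ext vs) P.
Proof.
move=> sub ex re; apply: (@excluded_sound _ e A Gsimple Gclass Airr db (ext vs) P) => //.
- by move=> Q /sub/cases_verified.
- exact: cyc_ext.
exact: A_ext.
Qed.

Lemma verts_ext vs (P : pattern) :
  (forall k, k < size P.1 -> let p := nth (0, [::]) P.1 k in let x := nth (f 0) vs k in
     [/\ A x, (p.1 < 15) && ht x p.1 & forall j, j \in p.2 -> e x (ext vs j)]) ->
  (forall c, c \in P.2 -> meets e A (ext vs) c) -> realizes e A (ext vs) P.
Proof.
move=> hv hc; split=> // k /hv[Ax /andP[t15 tx] ex]; rewrite ext_add; split => //.
by rewrite ht_ext.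
Qed.

Lemma meets_ext vs v t : 0 < v -> t < 15 ->
  (forall w, A w -> e w (ext vs v) -> ht w t || ht w 14) -> meets e A (ext vs) (v, t).
Proof.
move=> v0 t15 h w Aw /=; rewrite -[v == 0]negbK -lt0n v0 /= !ht_ext //.
by apply/implyP; apply: h.
Qed.

(** Two neighbours at distance 1 on the cycle close a triangle; at distance 3 they close a triangle
    or an induced C_5. *)
Lemma no_chord w i d : A w -> i < 7 -> d \in [:: 1; 3] ->
  ~~ (e w (f i) && e w (f ((i + d) %% 7))).
Proof.
move=> Aw i7 dP; apply/negP => /andP[wi wd].
pose s := put (put known7 7 i true) 7 ((i + d) %% 7) true.
pose leaf := Leaf [:: 7; i; (i + 1) %% 7].
pose c := if d == 1 then leaf else
  Split 7 ((i + 1) %% 7) leaf (Split 7 ((i + 2) %% 7) (Leaf [:: 7; (i + 2) %% 7; (i + 3) %% 7])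
    (Leaf [:: 7; i; (i + 1) %% 7; (i + 2) %% 7; (i + 3) %% 7])).
have d7 : (i + d) %% 7 < 7 by rewrite ltn_mod.
have ks : knows e 8 s (ext [:: w]).
  apply: knows_put => //; first exact: ltnW.
    by rewrite (ext_add _ 0) ext_lt.
  apply: knows_put => //; first exact: ltnW.
    by rewrite (ext_add _ 0) ext_lt.
  by apply: knows_cycle => //; exact: cyc_ext.
apply: (@check_sound _ e A Gsimple Gclass Airr [::] c 8 s [::] (ext [:: w])) => //.
- move=> j; rewrite ltnS leq_eqVlt => /orP[/eqP->|/A_ext //].
  by rewrite (ext_add _ 0).
have /allP/(_ d dP)/allP/(_ i) : all (fun d => all (fun i =>
   check [::] 8 (put (put known7 7 i true) 7 ((i + d) %% 7) true) [::]
    (if d == 1 then Leaf [:: 7; i; (i + 1) %% 7] else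
  Split 7 ((i + 1) %% 7) (Leaf [:: 7; i; (i + 1) %% 7]) (Split 7 ((i + 2) %% 7) (Leaf [:: 7; (i + 2) %% 7;
    (i + 3) %% 7])
    (Leaf [:: 7; i; (i + 1) %% 7; (i + 2) %% 7; (i + 3) %% 7])))) (iota 0 7)) [:: 1; 3] by vm_compute.
by rewrite mem_iota; apply.
Qed.

Definition type_of w := find (ht w) (iota 0 15).

(** By [no_chord] the neighbours on the cycle are pairwise at distance 2, hence are at most two. *)
Lemma typed w : A w -> has (ht w) (iota 0 15).
Proof.
move=> Aw; have h i d : i < 7 -> d \in [:: 1; 3] -> ~~ (e w (f i) && e w (f ((i + d) %% 7))).
  exact: no_chord.
have := (h 0 1 isT isT, h 1 1 isT isT, h 2 1 isT isT, h 3 1 isT isT, h 4 1 isT isT, h 5 1 isT isT,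
  h 6 1 isT isT).
have := (h 0 3 isT isT, h 1 3 isT isT, h 2 3 isT isT, h 3 3 isT isT, h 4 3 isT isT, h 5 3 isT isT,
  h 6 3 isT isT).
rewrite [_ %% _]/= /has_type /=.
case: (e w (f 0)); case: (e w (f 1)); case: (e w (f 2)); case: (e w (f 3));
case: (e w (f 4)); case: (e w (f 5)); case: (e w (f 6));
  by move=> /= [[[[[[]]]]]] // ? ? ? ? ? ? ? [[[[[[]]]]]].
Qed.

Lemma type_of_lt w : A w -> type_of w < 15.
Proof. by move/typed; rewrite has_find size_iota. Qed.

Lemma has_type_of w : A w -> ht w (type_of w).
Proof. by move=> Aw; have := nth_find 0 (typed Aw); rewrite nth_iota ?type_of_lt. Qed.

Lemma type_unique w t t' : t < 15 -> t' < 15 -> ht w t -> ht w t' -> t = t'.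
Proof.
move=> t15 t15' /andP[/allP on /allP off] /andP[/allP on' /allP off']; apply/eqP.
have /allP/(_ t) : all (fun t => all (fun t' => (t == t') ||
   has (fun i => (i \in on_cycle t) != (i \in on_cycle t')) (iota 0 7)) (iota 0 15)) (iota 0 15).
  by vm_compute.
rewrite mem_iota => /(_ t15)/allP/(_ t'); rewrite mem_iota => /(_ t15') /orP[//|].
case/hasP=> i; rewrite mem_iota => /andP[_ i7]; move: (off i) (off' i) (on i) (on' i).
rewrite !mem_off_cycle //; case: (i \in on_cycle t); case: (i \in on_cycle t') => //=.
  by move=> _ /(_ isT)/negP h /(_ isT).
by move=> /(_ isT)/negP h _ _ /(_ isT).
Qed.

End Colouring.

(** * Adjacent vertices far from the cycle *)

Lemma turn_type14 r b : turn_type r b 14 = 14. Proof. by []. Qed.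

Section Base.
Variables (T : finType) (e : rel T) (A : pred T).
Hypotheses (Gsimple : simple_graph e) (Gclass : class_G 10 7 e).
Hypothesis Airr : irreducible e A.

Let es : symmetric e. Proof. by case: Gsimple. Qed.

Definition nbr (f : nat -> T) u t := exists x, [/\ A x, e u x & has_type e f x t].
(** Neighbours of type R are tolerated: they carry no information about the colour of [u]. *)
Definition single (f : nat -> T) u t :=
  forall w, A w -> e w u -> has_type e f w t || has_type e f w 14.
Definition seven f := cyc e f /\ forall i, i < 7 -> A (f i).

Lemma seven_turn f r b : r < 7 -> seven f -> seven (fun i => f (turn (unturn r b) b i)).
Proof.
have u7 : r < 7 -> unturn r b < 7 by rewrite /unturn; case: b; rewrite ?ltn_mod.
by move=> r7 [cf Af]; split; [apply: cyc_turn; auto | move=> i i7; apply/Af/turn_lt].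
Qed.

Lemma nbr_turn f r b u t : r < 7 -> t < 15 -> nbr f u t ->
  nbr (fun i => f (turn (unturn r b) b i)) u (turn_type r b t).
Proof. by move=> r7 t15 [x [Ax ux xt]]; exists x; split; rewrite // has_type_turn. Qed.

Lemma single_turn f r b u t : r < 7 -> t < 15 -> single f u t ->
  single (fun i => f (turn (unturn r b) b i)) u (turn_type r b t).
Proof.
move=> r7 t15 st w Aw wu; rewrite has_type_turn //.
have := @has_type_turn _ e f w r b 14 r7 isT.
by rewrite turn_type14 => ->; apply: st.
Qed.

Lemma type_lt t : t \in types -> t < 15.
Proof. by rewrite mem_filter mem_iota => /and3P[_ _ /ltnW]. Qed.

Lemma pair_lt p d : d < 4 -> p \in pairs d -> (p.1 < 15) && (p.2 < 15).
Proof.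
move=> d4 pd; have /allP/(_ d) : all (fun d => all (fun p =>
  (p.1 < 15) && (p.2 < 15)) (pairs d)) (iota 0 4) by vm_compute.
by rewrite mem_iota => /(_ d4)/allP/(_ _ pd).
Qed.

Lemma realizes_link f u v p q cs : seven f -> A u -> A v -> e v u ->
  has_type e f u 14 -> has_type e f v 14 ->
  (p.1 < 15) && (p.2 < 15) -> (q.1 < 15) && (q.2 < 15) ->
  nbr f u p.1 -> nbr f u p.2 -> nbr f v q.1 -> nbr f v q.2 ->
  (forall t, (0, t) \in cs -> t < 15 /\ forall w, A w -> ~~ has_type e f w t) ->
  all (fun c => c.1 == 0) cs ->
  link_pat [:: p.1; p.2] [:: q.1; q.2] cs \in map fst cases -> False.
Proof.
move=> [cf Af] Au Av vu u14 v14 /andP[p1 p2] /andP[q1 q2] [x [Ax ux x1]] [y [Ay uy y1]]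
  [z [Az vz z1]] [w [Aw vw w1]] hcs cs0 inD.
pose vs := [:: u; v; x; y; z; w].
have [wf [c vc]] := cases_verified inD.
apply: (verified_sound Gsimple Gclass Airr wf vc (cyc_ext cf vs) (@A_ext _ _ _ Af vs)).
apply: verts_ext => //.
  case=> [|[|[|[|[|[|k]]]]]] //= _; (split; [by [] | by rewrite ?p1 ?p2 ?q1 ?q2 |
      by move=> j; rewrite ?inE // => /eqP->; rewrite // es]).
case=> v' t ct; have /= /eqP v0 := allP cs0 _ ct; subst v'.
have [t15 ht] := hcs _ ct; move=> a Aa /=; rewrite ht_ext //; exact: ht.
Qed.

Lemma link_cases_sub : {subset map fst link_cases <= map fst cases}.
Proof. by move=> Q; rewrite /cases !map_cat !mem_cat => ->; rewrite !orbT. Qed.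
Lemma D_hanging_cases_sub : {subset map fst D_hanging_cases <= map fst cases}.
Proof. by move=> Q; rewrite /cases !map_cat !mem_cat => ->; rewrite !orbT. Qed.
Lemma L_hanging_cases_sub : {subset map fst L_hanging_cases <= map fst cases}.
Proof. by move=> Q; rewrite /cases !map_cat !mem_cat => ->; rewrite !orbT. Qed.

Lemma fst_plain ps : map fst (plain ps) = ps.
Proof. by rewrite -map_comp map_id. Qed.
Lemma fst_scripted ps hs : map fst (scripted ps hs) = ps.
Proof.
rewrite /scripted -map_comp; apply: (@eq_from_nth _ ([::], [::])); rewrite size_map size_iota //.
by move=> i ip; rewrite (nth_map 0) ?size_iota // nth_iota.
Qed.

Lemma sub_catl (s1 s2 : seq pattern) : {subset s1 <= s1 ++ s2}.
Proof. by move=> Q h; rewrite mem_cat h. Qed.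
Lemma sub_catr (s1 s2 : seq pattern) : {subset s2 <= s1 ++ s2}.
Proof. by move=> Q h; rewrite mem_cat h orbT. Qed.

Lemma link_casesE : map fst link_cases =
  link_pats 0 0 [::] ++ link_pats 0 2 [::] ++ link_pats 0 3 [:: (0, tL 2)].
Proof. by rewrite /link_cases !map_cat fst_plain !fst_scripted. Qed.
Lemma D_hanging_casesE : map fst D_hanging_cases =
  hanging_pats (tD 0) 0 [::] ++ hanging_pats (tD 0) 1 [::] ++ hanging_pats (tD 0) 3 [::] ++
    hanging_pats (tD 0) 2 [:: (0, tL 0)].
Proof. by rewrite /D_hanging_cases !map_cat !fst_scripted. Qed.
Lemma L_hanging_casesE : map fst L_hanging_cases =
  hanging_pats (tL 0) 0 [::] ++ hanging_pats (tL 0) 1 [::] ++ hanging_pats (tL 0) 2 [::] ++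
    hanging_pats (tL 0) 3 [::].
Proof. by rewrite /L_hanging_cases !map_cat !fst_scripted. Qed.

Definition linkable f u v p q :=
  [/\ seven f, A u /\ A v, e v u, has_type e f u 14 /\ has_type e f v 14 &
   (nbr f u p.1 /\ nbr f u p.2) /\ (nbr f v q.1 /\ nbr f v q.2)].

(** The configurations listed in [link_cases], up to the order of the types in each pair. *)
Lemma link_base f u v p q d : linkable f u v p q ->
  either_order 0 p -> either_order d q ->
  (d \in [:: 0; 2]) || (d == 3) && [forall w, A w ==> ~~ has_type e f w 9] -> False.
Proof.
case=> sf [Au Av] vu [u14 v14] [[np1 np2] [nq1 nq2]] ep eq hd.
have [p' [p0 n1 n2]] : exists p', [/\ p' \in pairs 0, nbr f u p'.1 & nbr f u p'.2].
  by case/orP: ep; [exists p | exists (p.2, p.1)].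
have [q' [q0 m1 m2]] : exists q', [/\ q' \in pairs d, nbr f v q'.1 & nbr f v q'.2].
  by case/orP: eq; [exists q | exists (q.2, q.1)].
have d4 : d < 4 by case/orP: hd => [|/andP[/eqP->//]]; rewrite !inE => /orP[]/eqP->.
have inmm cs : link_pat [:: p'.1; p'.2] [:: q'.1; q'.2] cs \in link_pats 0 d cs.
  by apply/allpairsP; exists (p', q').
have fin := realizes_link sf Au Av vu u14 v14 (pair_lt (isT : 0 < 4) p0) (pair_lt d4 q0) n1 n2 m1 m2.
case/orP: hd => [d02|/andP[/eqP d3 /forallP no]].
  apply: (fin [::]) => //; apply: link_cases_sub; rewrite link_casesE.
  have := inmm [::]; have : d = 0 \/ d = 2 by move: d02; rewrite !inE => /orP[]/eqP; auto.
  by case=> -> h; [apply: sub_catl | apply/sub_catr/sub_catl].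
apply: (fin [:: (0, tL 2)]) => //.
  by move=> t; rewrite inE => /eqP[->]; split=> // w Aw; apply: (implyP (no w)).
by apply: link_cases_sub; rewrite link_casesE -d3; do 2! apply: sub_catr; apply: inmm.
Qed.

Lemma linkable_turn f u v p q r b : r < 7 -> (p.1 < 15) && (p.2 < 15) -> (q.1 < 15) && (q.2 < 15) ->
  linkable f u v p q ->
  linkable (fun i => f (turn (unturn r b) b i)) u v (turn_type r b p.1, turn_type r b p.2)
     (turn_type r b q.1, turn_type r b q.2).
Proof.
move=> r7 /andP[p1 p2] /andP[q1 q2] [sf Auv vu [u14 v14] [[np1 np2] [nq1 nq2]]]; split=> //.
- exact: seven_turn.
- have h w := @has_type_turn _ e f w r b 14 r7 isT; rewrite turn_type14 in h.
  by rewrite !h.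
by split; split; apply: nbr_turn.
Qed.

(** Turning the cycle reduces this to [link_base]; the type L_6 is empty, and its image under the turn
    is the type that has to be empty there. *)
Lemma link_excluded f u v p q : linkable f u v p q ->
  (p.1 < 15) && (p.2 < 15) -> (q.1 < 15) && (q.2 < 15) ->
  (forall w, A w -> ~~ has_type e f w 13) -> link_query p q -> False.
Proof.
move=> L p15 q15 no6.
have at_ r b u' v' p' q' : linkable f u' v' p' q' -> (p'.1 < 15) && (p'.2 < 15) ->
  (q'.1 < 15) && (q'.2 < 15) ->
   link_query_at r b p' q' -> False.
  move=> L' p15' q15'; rewrite /link_query_at; case: ifP => // r7; case: ifP => // e0 /hasP[d dP ed].
  apply: (link_base (linkable_turn b r7 p15' q15' L') e0 ed).
  case: eqP dP => [t13|_ ->] //; rewrite !inE => /or3P[]->; rewrite ?orbT //=.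
  apply/orP; right; apply/forallP => w; apply/implyP => Aw.
  by rewrite -t13 has_type_turn // no6.
have L' : linkable f v u q p.
  by case: L => ? [? ?] ? [? ?] [? ?]; split; rewrite // es.
rewrite /link_query => /or4P[] h. exact: at_ L p15 q15 h. exact: at_ L p15 q15 h. exact: at_ L' q15 p15 h. exact: at_ L' q15 p15 h.
Qed.

Definition hanging f u v t q :=
  [/\ seven f, A u /\ A v, e v u, has_type e f u 14 /\ has_type e f v 14 &
   (nbr f u t /\ single f u t) /\ (nbr f v q.1 /\ nbr f v q.2)].

Lemma realizes_hanging f u v t q cs : hanging f u v t q -> t < 15 -> (q.1 < 15) && (q.2 < 15) ->
  (forall t, (0, t) \in cs -> t < 15 /\ forall w, A w -> ~~ has_type e f w t) ->
  all (fun c => c.1 == 0) cs ->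
  link_pat [:: t] [:: q.1; q.2] ((7, t) :: cs) \in map fst cases -> False.
Proof.
case=> -[cf Af] [Au Av] vu [u14 v14] [[[x [Ax ux x1]] su] [[z [Az vz z1]] [w [Aw vw w1]]]]
  t15 /andP[q1 q2] hcs cs0 inD.
pose vs := [:: u; v; x; z; w].
have [wf [c vc]] := cases_verified inD.
apply: (verified_sound Gsimple Gclass Airr wf vc (cyc_ext cf vs) (@A_ext _ _ _ Af vs)).
apply: verts_ext => //.
  case=> [|[|[|[|[|k]]]]] //= _; (split; [by [] | by rewrite ?t15 ?q1 ?q2 |
      by move=> j; rewrite ?inE // => /eqP->; rewrite // es]).
case=> v' t'; rewrite inE => /orP[/eqP[-> ->]|ct]; first exact: meets_ext.
have /= /eqP v0 := allP cs0 _ ct; subst v'.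
have [t15' ht] := hcs _ ct; move=> a Aa /=; rewrite ht_ext //; exact: ht.
Qed.

Lemma hanging_turn f u v t q r b : r < 7 -> t < 15 -> (q.1 < 15) && (q.2 < 15) ->
  hanging f u v t q ->
  hanging (fun i => f (turn (unturn r b) b i)) u v (turn_type r b t)
     (turn_type r b q.1, turn_type r b q.2).
Proof.
move=> r7 t15 /andP[q1 q2] [sf Auv vu [u14 v14] [[np1 su] [nq1 nq2]]]; split=> //.
- exact: seven_turn.
- have h w := @has_type_turn _ e f w r b 14 r7 isT; rewrite turn_type14 in h.
  by rewrite !h.
by split; split; [apply: nbr_turn | apply: single_turn | apply: nbr_turn | apply: nbr_turn].
Qed.

(** As for [link_excluded], the cycle is turned until the single type is D_0 or L_0. *)
Lemma hanging_excluded f u v t q ds : hanging f u v t q -> (q.1 < 15) && (q.2 < 15) ->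
  (forall w, A w -> ~~ has_type e f w 13) ->
  (t < 7) && (ds == [:: 0; 1; 3]) || (7 <= t < 13) && (ds == [:: 0; 1; 2; 3]) ->
  hanging_query ds t q -> False.
Proof.
move=> H q15 no6 tds /hasP[[r b] rb /hasP[d /= dP ed]].
have t14 : t < 13 by case/orP: tds => [/andP[t7 _]|/andP[/andP[_ //]]]; apply: leq_trans t7 _.
have t15 : t < 15 by apply: leq_trans t14 _.
have r7 : r < 7.
  move: rb; rewrite !inE => /orP[]/eqP[-> _]; rewrite ?ltn_mod //.
  by case: (ltnP t 7) => // t7; rewrite -(ltn_add2l 7) subnKC // (leq_trans t14).
have d4 : d < 4.
  case: ifP dP => _; first by rewrite !inE => /or4P[]/eqP->.
  by case/orP: tds => /andP[_ /eqP->]; rewrite !inE; [case/or3P | case/or4P] => /eqP->.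
have Ht := hanging_turn b r7 t15 q15 H.
have [q' [q0 H']] : exists q', q' \in pairs d /\
    hanging (fun i => f (turn (unturn r b) b i)) u v (turn_type r b t) q'.
  case/orP: ed => qd; first by exists (turn_type r b q.1, turn_type r b q.2).
  exists (turn_type r b q.2, turn_type r b q.1); split=> //.
  by case: Ht => ? ? ? ? [? [? ?]].
have t0 : turn_type r b t = if t < 7 then tD 0 else tL 0.
  have /allP/(_ t) : all (fun t => all (fun rb => turn_type rb.1 rb.2 t == if t < 7 then tD 0 else tL 0)
    [:: ((7 - (if t < 7 then t else t - 7)) %% 7, false); (if t < 7 then t else t - 7, true)]) (iota 0 13).
    by vm_compute.
  by rewrite mem_iota => /(_ t14) /allP/(_ _ rb) /eqP.
have fin := realizes_hanging H' _ (pair_lt d4 q0); rewrite t0 in fin.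
have insm t' cs : link_pat [:: t'] [:: q'.1; q'.2] ((7, t') :: cs) \in hanging_pats t' d cs.
  by apply/mapP; exists q'.
case/orP: tds => [/andP[t7 dsE]|/andP[/andP[t7 _] dsE]].
  rewrite t7 in fin; have [dd|d2] : d \in [:: 0; 1; 3] \/ d = 2 /\ turn_type r b 13 = 7.
    case: eqP dP => [t13|_]; last by rewrite (eqP dsE); left.
    by rewrite !inE => /or4P[]/eqP->; [left | left | right | left].
  - apply: (fin [::]) => //; apply: D_hanging_cases_sub; rewrite D_hanging_casesE.
    have := insm (tD 0) [::]; have : [\/ d = 0, d = 1 | d = 3].
      by move: dd; rewrite !inE => /or3P[]/eqP; [exact: Or31 | exact: Or32 | exact: Or33].
    by case=> -> h; [apply: sub_catl | apply/sub_catr/sub_catl | do 2! apply: sub_catr; apply: sub_catl].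
  case: d2 => d2 t13; apply: (fin [:: (0, tL 0)]) => //.
    move=> t'; rewrite inE => /eqP[->]; split=> // w Aw.
    by rewrite -[tL 0]/7 -t13 has_type_turn // no6.
  by have := insm (tD 0) [:: (0, tL 0)]; rewrite d2 => h; apply: D_hanging_cases_sub;
    rewrite D_hanging_casesE; do 3! apply: sub_catr.
have t7F : (t < 7) = false by rewrite ltnNge t7.
rewrite t7F in fin.
have dd : d \in [:: 0; 1; 2; 3] by case: ifP dP; rewrite // (eqP dsE).
apply: (fin [::]) => //; apply: L_hanging_cases_sub; rewrite L_hanging_casesE.
have := insm (tL 0) [::]; have : [\/ d = 0, d = 1, d = 2 | d = 3].
  by move: dd; rewrite !inE => /or4P[]/eqP; [exact: Or41 | exact: Or42 | exact: Or43 | exact: Or44].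
by case=> -> h; [apply: sub_catl | apply/sub_catr/sub_catl | do 2! apply: sub_catr;
  apply: sub_catl | do 3! apply: sub_catr].
Qed.
End Base.

(** * Properness of the colouring *)

Lemma type_pairsP p : p \in type_pairs -> [/\ p.1 \in types, p.2 \in types & p.1 < p.2].
Proof.
have /allP h : all (fun p => [&& p.1 \in types, p.2 \in types & p.1 < p.2]) type_pairs by vm_compute.
by move/h/and3P.
Qed.

Lemma mem_type_pairs a b : a \in types -> b \in types -> a < b -> star_excluded a b = false ->
  (a, b) \in type_pairs.
Proof.
have h : all (fun a => all (fun b => if a < b then if star_excluded a b then true else (a, b) \in type_pairs
   else true) types) types by vm_cast_no_check (erefl true).
by move=> aT bT ab x; have := allP2 h aT bT; rewrite ab x.
Qed.

Lemma pair_types p : p \in type_pairs -> (p.1 < 15) && (p.2 < 15).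
Proof. by case/type_pairsP => /type_lt-> /type_lt->. Qed.

Opaque type_pairs types.

Section Colour.
Variables (T : finType) (e : rel T) (A : pred T).
Hypotheses (Gsimple : simple_graph e) (Gclass : class_G 10 7 e).
Hypothesis Airr : irreducible e A.
Variable f : nat -> T.
Hypothesis sf : seven e A f.
Hypothesis no6 : forall w, A w -> ~~ has_type e f w 13.

Let es : symmetric e. Proof. by case: Gsimple. Qed.
Let cf : cyc e f. Proof. by case: sf. Qed.
Let Af : forall i, i < 7 -> A (f i). Proof. by case: sf. Qed.
Local Notation ht := (has_type e f).
Local Notation nb := (nbr e A f).
Local Notation sg := (single e A f).
Local Notation tyo := (type_of e f).

Definition tables := [:: near_edge_patterns; star_pair_patterns; star_triple_patterns; D_D_patterns;
  L_L_patterns; L_D_patterns; fork_patterns; remote_patterns].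

Lemma tables_cases Q (db : seq pattern) : db \in tables ->
  Q \in db -> Q \in map fst cases.
Proof.
have h : all (fun db => all (fun Q => Q \in map fst cases) db)
  tables by vm_cast_no_check (erefl true).
by move=> dbin Qin; apply: (allP (allP h _ dbin)).
Qed.

Lemma no_pattern db P vs : db \in tables ->
  excluded db P -> realizes e A (ext f vs) P -> False.
Proof. by move=> dbin; apply: excluded_ext => // Q; apply: tables_cases dbin. Qed.

Lemma edge_no u v t t' : t < 15 -> t' < 15 -> edge_excluded t t' -> A u -> A v -> e u v -> ht u t ->
  ht v t' -> False.
Proof.
move=> t15 t15' /orP[] x Au Av uv ut vt.
  apply: (no_pattern (vs := [:: u; v]) _ x); rewrite ?inE ?eqxx //; apply: verts_ext => //.
  case=> [|[|k]] //= _; (split; [by [] | by rewrite ?t15 ?t15' |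
    by move=> j; rewrite ?inE // => /eqP->; rewrite // es]).
apply: (no_pattern (vs := [:: v; u]) _ x); rewrite ?inE ?eqxx //; apply: verts_ext => //.
case=> [|[|k]] //= _; (split; [by [] | by rewrite ?t15 ?t15' |
    by move=> j; rewrite ?inE // => /eqP->; rewrite // es]).
Qed.

Lemma star_no db v ts : db \in tables ->
  excluded db (star_pat ts) -> A v -> ht v 14 ->
  (forall t, t \in ts -> t < 15 /\ nb v t) -> False.
Proof.
move=> dbin x Av v14 h.
pose g t := odflt v [pick x | [&& A x, e v x & ht x t]].
have gP t : t \in ts -> [/\ t < 15, A (g t), e (g t) v & ht (g t) t].
  move=> /h[t15 [y [Ay vy yt]]]; rewrite /g; case: pickP => [y' /and3P[? ? ?]|/(_ y)].
    by rewrite es.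
  by rewrite Ay vy yt.
apply: (no_pattern (vs := v :: map g ts) dbin x); apply: verts_ext => //.
case=> [|k] /=; first by rewrite v14.
rewrite size_map => kts; have kin := mem_nth 14 kts; have [t15 Ag vg gt] := gP _ kin.
rewrite !(nth_map 14) //=; split=> //; first by rewrite t15.
by move=> j; rewrite inE => /eqP->.
Qed.

Lemma pair_no v t1 t2 : t1 < 15 -> t2 < 15 -> star_excluded t1 t2 -> A v -> ht v 14 -> nb v t1 -> nb v t2 ->
  False.
Proof.
move=> t15 t15' /orP[] x Av v14 n1 n2; apply: (star_no _ x Av v14); rewrite ?inE ?eqxx ?orbT //;
  by move=> t; rewrite !inE => /orP[]/eqP->.
Qed.

Lemma triple_no v t1 t2 t3 : t1 < 15 -> t2 < 15 -> t3 < 15 -> star3_excluded t1 t2 t3 ->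
  A v -> ht v 14 -> nb v t1 -> nb v t2 -> nb v t3 -> False.
Proof.
move=> l1 l2 l3 /hasP[p pin x] Av v14 n1 n2 n3; apply: (star_no _ x Av v14).
  by rewrite !inE eqxx !orbT.
move=> t tp; have : t \in [:: t1; t2; t3].
  by move: pin tp; rewrite !inE => /orP[|/orP[|/orP[|/orP[|/orP[]]]]]/eqP->;
    rewrite !inE => /or3P[]/eqP->; rewrite eqxx ?orbT.
by rewrite !inE => /or3P[]/eqP->.
Qed.

Lemma single_single_no db u v t t' : db \in tables ->
  t < 15 -> t' < 15 -> singles_excluded db t t' ->
  A u -> A v -> e v u -> ht u 14 -> ht v 14 ->
  nb u t -> sg u t -> nb v t' -> sg v t' -> False.
Proof.
move=> dbin t15 t15' x Au Av vu u14 v14 [y [Ay uy yt]] su [z [Az vz zt]] sv.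
apply: (no_pattern (vs := [:: u; v; y; z]) dbin x); apply: verts_ext.
  case=> [|[|[|[|k]]]] //= _; (split; [by [] | by rewrite ?t15 ?t15' |
    by move=> j; rewrite ?inE // => /eqP->; rewrite // es]).
by move=> c; rewrite !inE => /orP[]/eqP->; apply: meets_ext.
Qed.

Lemma fork_no u v w t t1 t2 : t < 15 -> t1 < 15 -> t2 < 15 -> excluded fork_patterns (fork_pat t t1 t2) ->
  A u -> A v -> A w -> e v u -> e w u -> ht u 14 -> ht v 14 -> ht w 14 ->
  nb u t -> sg u t -> nb v t1 -> sg v t1 -> nb w t2 -> sg w t2 -> False.
Proof.
move=> l l1 l2 x Au Av Aw vu wu u14 v14 w14 [x1 [A1 u1 h1]] s1 [x2 [A2 u2 h2]] s2 [x3 [A3 u3 h3]] s3.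
apply: (no_pattern (vs := [:: u; v; w; x1; x2; x3]) _ x); first by rewrite !inE eqxx !orbT.
apply: verts_ext.
  case=> [|[|[|[|[|[|k]]]]]] //= _; (split; [by [] | by rewrite ?l ?l1 ?l2 |
    by move=> j; rewrite ?inE // => /eqP->; rewrite // es]).
by move=> c; rewrite !inE => /or3P[]/eqP->; apply: meets_ext.
Qed.

Lemma remote_no u z ts : excluded remote_patterns (remote_pat ts) -> A u -> A z -> e z u -> ht u 14 ->
  ht z 14 ->
  sg z 14 -> (forall t, t \in ts -> t < 15 /\ nb u t) -> False.
Proof.
move=> x Au Az zu u14 z14 sz h.
pose g t := odflt u [pick x | [&& A x, e u x & ht x t]].
have gP t : t \in ts -> [/\ t < 15, A (g t), e (g t) u & ht (g t) t].
  move=> /h[t15 [y [Ay uy yt]]]; rewrite /g; case: pickP => [y' /and3P[? ? ?]|/(_ y)].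
    by rewrite es.
  by rewrite Ay uy yt.
apply: (no_pattern (vs := u :: z :: map g ts) _ x); first by rewrite !inE eqxx !orbT.
apply: verts_ext; last by move=> c; rewrite !inE => /eqP->; apply: meets_ext.
case=> [|[|k]] /=; first by rewrite u14.
  by rewrite z14; split=> // j; rewrite inE => /eqP->.
rewrite size_map => kts; have kin := mem_nth 14 kts; have [t15 Ag vg gt] := gP _ kin.
rewrite !(nth_map 14) //=; split=> //; first by rewrite t15.
by move=> j; rewrite inE => /eqP->.
Qed.

Lemma remote_fork_no u v z t t' : t < 15 -> t' < 15 -> excluded remote_patterns (remote_fork_pat t t') ->
  A u -> A v -> A z -> e z u -> e z v -> ht u 14 -> ht v 14 -> ht z 14 ->
  nb u t -> sg u t -> nb v t' -> sg v t' -> sg z 14 -> False.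
Proof.
move=> l l1 x Au Av Az zu zv u14 v14 z14 [x1 [A1 u1 h1]] s1 [x2 [A2 u2 h2]] s2 sz.
apply: (no_pattern (vs := [:: u; v; z; x1; x2]) _ x); first by rewrite !inE eqxx !orbT.
apply: verts_ext.
  case=> [|[|[|[|[|k]]]]] //= _; (split; [by [] | by rewrite ?l ?l1 |
    move=> j; rewrite ?inE //; try (by case/orP => /eqP->); by move/eqP->; rewrite // es]).
by move=> c; rewrite !inE => /or3P[]/eqP->; apply: meets_ext.
Qed.

Lemma remote_remote_no u z z' t : t < 15 -> excluded remote_patterns (remote_remote_pat t) ->
  A u -> A z -> A z' -> e z u -> e z' z -> ht u 14 -> ht z 14 -> ht z' 14 ->
  nb u t -> sg u t -> sg z 14 -> sg z' 14 -> False.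
Proof.
move=> l x Au Az Az' zu zz u14 z14 z14' [x1 [A1 u1 h1]] s1 sz sz'.
apply: (no_pattern (vs := [:: u; z; z'; x1]) _ x); first by rewrite !inE eqxx !orbT.
apply: verts_ext.
  case=> [|[|[|[|k]]]] //= _; (split; [by [] | by rewrite ?l |
    by move=> j; rewrite ?inE // => /eqP->; rewrite // es]).
by move=> c; rewrite !inE => /or3P[]/eqP->; apply: meets_ext.
Qed.

(** Two types that [w] sees, if there are two; 14 stands for an absent type. *)
Definition labelled w a b : Prop :=
  if a == 14 then b = 14 /\ sg w 14 else
  [/\ a < 14, nb w a & if b == 14 then sg w a else [/\ b < 14, a != b & nb w b]].

Variable lab : T -> nat * nat.
Hypothesis labP : forall w, A w -> ht w 14 -> labelled w (lab w).1 (lab w).2.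

(** The value 0 is no colour: it marks the vertices that are left for a greedy step. *)
Definition colour w :=
  if ht w 14 then far_colour (lab w).1 (lab w).2 else type_colour (tyo w).

(** The four sorts of vertices of type R; the first two are left uncoloured. *)
Inductive kind (w : T) (c : nat) : Prop :=
  | Isolated of sg w 14 & c = 0
  | LSingle t of t \in far_L & nb w t & sg w t & c = 0
  | DSingle t of t \in iota 0 7 & nb w t & sg w t & c = far_colour t 14 & c \in [:: 1; 2; 3]
  | Multi p of p \in type_pairs & nb w p.1 & nb w p.2 & c = far_colour p.1 p.2 & c \in [:: 1; 2; 3].

Lemma nb_types w t : t < 14 -> nb w t -> t \in types.
Proof.
move=> t14 [x [Ax _ xt]]; rewrite mem_filter mem_iota t14 !andbT.
by apply: contraTneq xt => ->; apply: no6.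
Qed.

Lemma far_colour_sym a b : a != 14 -> b != 14 -> far_colour a b = far_colour b a.
Proof.
rewrite /far_colour => /negbTE-> /negbTE->; congr nth; apply: eq_find => s; exact: andbC.
Qed.

Lemma kindP w : A w -> ht w 14 -> kind w (colour w).
Proof.
move=> Aw w14; rewrite /colour w14; have := labP Aw w14; case: (lab w) => a b /=.
rewrite /labelled; case: eqP => [->|_]; first by case=> -> sw; apply: Isolated.
case=> a14 na; have aT := nb_types a14 na; case: eqP => [-> sa|b14 [{}b14 ab nb_b]].
  case: (ltnP a 7) => a7.
    apply: (@DSingle _ _ a) => //; first by rewrite mem_iota.
    have /allP/(_ a) : all (fun t => far_colour t 14 \in [:: 1; 2; 3]) (iota 0 7) by vm_compute.
    by rewrite mem_iota; apply.
  have /allP/(_ a) : all (fun t => (t < 7) || (t \in far_L) && (far_colour t 14 == 0)) types by vm_compute.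
  rewrite ltnNge a7 => /(_ aT) /andP[aL /eqP c0]; exact: (@LSingle _ _ a).
have bT := nb_types b14 nb_b.
have a15 := type_lt aT; have b15 := type_lt bT.
have xs : star_excluded a b = false by apply/negP => x; apply: (pair_no a15 b15 x Aw w14).
have na14 : a != 14 by rewrite neq_ltn a14.
have nb14 : b != 14 by rewrite neq_ltn b14.
have fin p : p \in type_pairs -> nb w p.1 -> nb w p.2 -> far_colour a b = far_colour p.1 p.2 ->
    kind w (far_colour a b).
  by move=> pT n1 n2 c; apply: (@Multi _ _ p) => //; rewrite c; apply: (allP table_multi).
case: (ltngtP a b) ab => // ab _; first by apply: (fin (a, b)) => //; apply: mem_type_pairs.
apply: (fin (b, a)) => //; last exact: far_colour_sym.
by apply: mem_type_pairs => //; rewrite /star_excluded orbC.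
Qed.

Lemma D_types t : t \in iota 0 7 -> t \in types.
Proof.
have /allP h : all (mem types) (iota 0 7) by vm_compute.
exact: h.
Qed.

Lemma near_type w : A w -> ~~ ht w 14 -> tyo w \in types.
Proof.
move=> Aw w14; have t15 := type_of_lt Gsimple Gclass Airr cf Af Aw.
have tw := has_type_of Gsimple Gclass Airr cf Af Aw.
rewrite mem_filter mem_iota /=; apply/andP; split.
  by apply: contraTneq tw => ->; apply: no6.
by move: t15; rewrite ltnS leq_eqVlt => /orP[/eqP t14|//]; rewrite t14 (negbTE w14) in tw.
Qed.

Lemma near_colour w : A w -> ~~ ht w 14 -> colour w \in [:: 1; 2; 3].
Proof.
move=> Aw w14; rewrite /colour (negbTE w14).
have /allP : all (fun t => type_colour t \in [:: 1; 2; 3]) types by vm_compute.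
by apply; apply: near_type.
Qed.

Lemma near_far u v : A u -> A v -> e v u -> ~~ ht u 14 -> ht v 14 -> colour u = colour v -> False.
Proof.
move=> Au Av vu u14 v14 cuv; have uT := near_type Au u14; have cu := near_colour Au u14.
have tu := has_type_of Gsimple Gclass Airr cf Af Au.
have nt : nb v (tyo u) by exists u; split; [exact: Au | exact: vu | exact: tu].
have only t : t \in types -> sg v t -> tyo u = t.
  move=> tT /(_ u Au); rewrite es => /(_ vu); rewrite (negbTE u14) orbF => ut.
  exact: (type_unique (type_lt uT) (type_lt tT) tu ut).
have cuE : colour u = type_colour (tyo u) by rewrite /colour (negbTE u14).
case: (kindP Av v14) => [s c|t tL n s c|t tD' n s c _|p pT n1 n2 c _].
- have := s u Au; rewrite es => /(_ vu); rewrite orbb; exact/negP.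
- by rewrite cuv c in cu.
- have tT := D_types tD'.
  have ut := only t tT s; have := allP table_single t tT.
  by rewrite -ut -cuE cuv c ut eqxx => /eqP c0; rewrite cuv c c0 in cu.
have := allP (allP table_star p pT) _ uT; rewrite -cuE -c cuv eqxx.
have [p1 p2 _] := type_pairsP pT.
have [l l1 l2] := And3 (type_lt uT) (type_lt p1) (type_lt p2).
case: ifP => [x _|_]; first exact: (pair_no l l1 x Av v14 nt n1).
case: ifP => [x _|_ x]; first exact: (pair_no l l2 x Av v14 nt n2).
exact: (triple_no l l1 l2 x Av v14 nt n1 n2).
Qed.

Lemma colour_proper u v : A u -> A v -> e u v -> colour u = colour v -> colour u = 0.
Proof.
move=> Au Av uv cuv; have vu : e v u by rewrite es.
case u14: (ht u 14); case v14: (ht v 14).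
- have D15 t : t \in iota 0 7 -> t < 15 by move/D_types/type_lt.
  have D7 t : t \in iota 0 7 -> (t < 7) && ([:: 0; 1; 3] == [:: 0; 1; 3]) ||
    (7 <= t < 13) && ([:: 0; 1; 3] == [:: 0; 1; 2; 3]).
    by rewrite mem_iota eqxx andbT => /andP[_ ->].
  case: (kindP Au u14) => [_ c|? _ _ _ c|t tD' n s c cu|p pT n1 n2 c cu]; [exact: c | exact: c | |];
  (case: (kindP Av v14) => [_ c'|? _ _ _ c'|t' tD'' n' s' c' cv|p' pT' n1' n2' c' cv];
    [rewrite cuv; exact: c' | rewrite cuv; exact: c' | exfalso | exfalso]).
  + have := allP2 table_single_single tD' tD''; rewrite -c -c' cuv eqxx => /orP[] x.
      by apply: (single_single_no _ (D15 t tD') (D15 t' tD'') x Au Av vu u14 v14 n s n' s');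
        rewrite !inE eqxx !orbT.
    by apply: (single_single_no _ (D15 t' tD'') (D15 t tD') x Av Au uv v14 u14 n' s' n s);
      rewrite !inE eqxx !orbT.
  + have := allP (allP table_single_multi t tD') p' pT'; rewrite -c -c' cuv eqxx.
    exact: (hanging_excluded Gsimple Gclass Airr (And5 sf (conj Au Av) vu (conj u14 v14) (conj (conj n s) (conj n1' n2')))
      (pair_types pT') no6 (D7 t tD')).
  + have := allP (allP table_single_multi t' tD'') p pT; rewrite -c -c' cuv eqxx.
    exact: (hanging_excluded Gsimple Gclass Airr (And5 sf (conj Av Au) uv (conj v14 u14) (conj (conj n' s') (conj n1 n2)))
      (pair_types pT) no6 (D7 t' tD'')).
  have := allP (allP table_multi_multi p pT) p' pT'; rewrite -c -c' cuv eqxx.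
  exact: (link_excluded Gsimple Gclass Airr (And5 sf (conj Au Av) vu (conj u14 v14) (conj (conj n1 n2) (conj n1' n2')))
      (pair_types pT) (pair_types pT') no6).
- by case: (near_far Av Au uv (negbT v14) u14 (esym cuv)).
- by case: (near_far Au Av vu (negbT u14) v14 cuv).
have uT := near_type Au (negbT u14); have vT := near_type Av (negbT v14).
have x := allP2 table_edge uT vT.
have cuv' : type_colour (tyo u) = type_colour (tyo v) by move: cuv; rewrite /colour u14 v14.
move: x; rewrite (introT eqP cuv') => x.
have tu := has_type_of Gsimple Gclass Airr cf Af Au.
have tv := has_type_of Gsimple Gclass Airr cf Af Av.
by case: (edge_no (type_lt uT) (type_lt vT) x Au Av uv tu tv).
Qed.

Lemma rest_far w : A w -> colour w = 0 -> ht w 14.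
Proof.
move=> Aw c; apply: contraPT (near_colour Aw) => w14; by move=> /(_ w14); rewrite c.
Qed.

Lemma multi_far z y p : A z -> A y -> e z y -> ht z 14 -> ht y 14 -> sg z 14 ->
  p \in type_pairs -> nb y p.1 -> nb y p.2 -> False.
Proof.
move=> Az Ay zy z14 y14 sz pT n1 n2; have /andP[l1 l2] := pair_types pT.
have L t : t \in far_L -> nb y t -> False.
  move=> tL n; apply: (remote_no (allP table_far_L t tL) Ay Az zy y14 z14 sz) => t'.
  rewrite inE => /eqP->; split=> //; move: tL; rewrite !inE => /or4P[|||/or3P[]] /eqP-> //.
have farL t : t \in types -> (t \in far_L) || (t < 7).
  by move=> tT; have /allP/(_ t tT) : all (fun t => (t \in far_L) || (t < 7)) types by vm_compute.
have [/farL t1 /farL t2 lt] := type_pairsP pT.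
case/orP: t1 => [/L/(_ n1) //|p1]; case/orP: t2 => [/L/(_ n2) //|p2].
have := allP2 table_far_D (_ : p.1 \in iota 0 7) (_ : p.2 \in iota 0 7).
rewrite !mem_iota => /(_ p1 p2).
rewrite lt; case: ifP => [x _|_].
  exact: (pair_no l1 l2 x Ay y14 n1 n2).
by case/orP=> x; apply: (remote_no x Ay Az zy y14 z14 sz) => t; rewrite !inE => /orP[]/eqP->.
Qed.

Lemma rest_rest z x : A z -> A x -> e z x -> colour z = 0 -> colour x = 0 ->
  sg z 14 /\ sg x 14.
Proof.
move=> Az Ax zx cz cx; have [z14 x14] := (rest_far Az cz, rest_far Ax cx).
have xz : e x z by rewrite es.
have L15 t : t \in far_L -> t < 15.
  by rewrite !inE => /or4P[|||/or3P[]] /eqP->.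
have LI u v t : A u -> A v -> e v u -> ht u 14 -> ht v 14 -> t \in far_L -> nb u t -> sg v 14 -> False.
  move=> Au Av vu u14 v14 tL n sv; apply: (remote_no (allP table_far_L t tL) Au Av vu u14 v14 sv) => t'.
  by rewrite inE => /eqP->; split=> //; apply: L15.
case: (kindP Az z14) => [sz _|t tL n s _|t _ _ _ _|p _ _ _ _]; rewrite ?cz //;
case: (kindP Ax x14) => [sx _|t' tL' n' s' _|t' _ _ _ _|p' _ _ _ _]; rewrite ?cx //; exfalso.
- exact: (LI x z t').
- exact: (LI z x t).
have := allP2 table_L_L tL tL' => /orP[] y.
  by apply: (single_single_no _ (L15 _ tL) (L15 _ tL') y Az Ax xz z14 x14 n s n' s'); rewrite !inE eqxx !orbT.
by apply: (single_single_no _ (L15 _ tL') (L15 _ tL) y Ax Az zx x14 z14 n' s' n s); rewrite !inE eqxx !orbT.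
Qed.

(** Together with [rest_rest] this separates the uncoloured vertices: one that has a coloured neighbour has
    only coloured neighbours.  So the greedy step colours pairwise nonadjacent vertices, in any order. *)
Lemma rest_alone z x y : A z -> A x -> e z x -> colour z = 0 -> colour x = 0 ->
  A y -> e z y -> colour y = 0.
Proof.
move=> Az Ax zx cz cx Ay zy; have [sz sx] := rest_rest Az Ax zx cz cx.
have [z14 x14] := (rest_far Az cz, rest_far Ax cx).
have y14 : ht y 14 by have := sz y Ay; rewrite es => /(_ zy); rewrite orbb.
have xz : e x z by rewrite es.
case: (kindP Ay y14) => [_ c|? _ _ _ c|t tD' n s _ _|p pT n1 n2 _ _];
  [exact: c | exact: c | exfalso | exfalso].
  exact: (remote_remote_no (type_lt (D_types tD')) (allP table_far_far t tD') Ay Az Ax zy xz y14 z14 x14 n s sz sx).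
exact: (multi_far Az Ay zy z14 y14 sz pT n1 n2).
Qed.

Lemma free_colour c0 c1 : exists2 c, c \in [:: 1; 2; 3] & (c != c0) && (c != c1).
Proof.
apply/hasP; rewrite /= orbF.
by case: c0 => [|[|[|[|c0]]]]; case: c1 => [|[|[|[|c1]]]].
Qed.

(** The coloured neighbours of [z] are of at most two sorts: those of the one type that [z] sees, and
    vertices of type R that all see the same single type.  Each sort has one colour. *)
Lemma rest_free z : A z -> colour z = 0 ->
  exists2 c, c \in [:: 1; 2; 3] & forall x, A x -> e z x -> colour x != c.
Proof.
move=> Az cz; have z14 := rest_far Az cz.
pose far1 x := [&& A x, e z x, ht x 14 & colour x != 0].
pose c1 := if [pick x | far1 x] is Some x then colour x else 0.
suff [c0 h] : exists c0, forall x, A x -> e z x -> [\/ colour x = c0, colour x = 0 | far1 x /\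
    forall y, far1 y -> colour y = colour x].
  have [c cP /andP[n0 n1]] := free_colour c0 c1; exists c => // x Ax zx.
  case: (h x Ax zx) => [->|->|[fx same]]; first by rewrite eq_sym.
    by move: cP; rewrite !inE => /or3P[]/eqP->.
  rewrite eq_sym; move: n1; rewrite /c1; case: pickP => [y fy|/(_ x)]; last by rewrite fx.
  by rewrite (same y fy).
case: (kindP Az z14) => [sz _|t tL n s _|t _ _ _ _ cP|p _ _ _ _ cP];
  [ | | by rewrite cz in cP | by rewrite cz in cP].
  exists 0 => x Ax zx; have x14 : ht x 14.
    by have := sz x Ax; rewrite es => /(_ zx); rewrite orbb.
  case: (kindP Ax x14) => [_ c|? _ _ _ c|t tD' n s c cP|p pT n1 n2 c _];
    [exact: Or31 | exact: Or31 | | ].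
    apply: Or33; split=> [|y /and4P[Ay zy y14 cy]].
      by rewrite /far1 Ax zx x14; case: (colour x) cP.
    case: (kindP Ay y14) => [_ c'|? _ _ _ c'|t' tD'' n' s' c' _|p' pT' n1' n2' _ _];
      [case: (negP cy (introT eqP c')) | case: (negP cy (introT eqP c')) | | ].
      case: (eqVneq t t') => [tt|tt]; first by rewrite c' c tt.
      exfalso; have [t15 t15'] := (type_lt (D_types tD'), type_lt (D_types tD'')).
      have := allP2 table_far_fork tD' tD''; rewrite (negbTE tt) => /orP[] w.
        exact: (remote_fork_no t15 t15' w Ax Ay Az zx zy x14 y14 z14 n s n' s' sz).
      exact: (remote_fork_no t15' t15 w Ay Ax Az zy zx y14 x14 z14 n' s' n s sz).
    by case: (multi_far Az Ay zy z14 y14 sz pT' n1' n2').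
  by case: (multi_far Az Ax zx z14 x14 sz pT n1 n2).
have t15 : t < 15 by move: tL; rewrite !inE => /or4P[|||/or3P[]] /eqP->.
exists (type_colour t) => x Ax zx; have xz : e x z by rewrite es.
case x14: (ht x 14); last first.
  apply: Or31; rewrite /colour x14; congr type_colour.
  have := s x Ax xz; rewrite x14 orbF => xt.
  have xT := near_type Ax (negbT x14).
  exact: (type_unique (type_lt xT) t15 (has_type_of Gsimple Gclass Airr cf Af Ax) xt).
have dsingle y : A y -> e z y -> ht y 14 -> colour y != 0 ->
    exists d, [/\ d \in iota 0 7, nb y d, sg y d & colour y = far_colour d 14].
  move=> Ay zy y14 cy; case: (kindP Ay y14) => [_ c'|? _ _ _ c'|d dD n' s' c' _|p' pT' n1' n2' _ _];
    [case: (negP cy (introT eqP c')) | case: (negP cy (introT eqP c')) | by exists d; split | ].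
  exfalso; have := allP (allP table_L_multi t tL) p' pT'.
  apply: (hanging_excluded Gsimple Gclass Airr _ (pair_types pT') no6 _) => //.
    by apply: (And5 sf (conj Az Ay) _ (conj z14 y14)) => //; rewrite es.
  by move: tL; rewrite !inE => /or4P[|||/or3P[]] /eqP->; rewrite ?orbT.
case: (eqVneq (colour x) 0) => cx; first exact: Or32.
apply: Or33; split=> [|y /and4P[Ay zy y14 cy]]; first by rewrite /far1 Ax zx x14 cx.
have [d [dD n1 s1 c1E]] := dsingle x Ax zx x14 cx.
have [d' [dD' n1' s1' c1E']] := dsingle y Ay zy y14 cy.
case: (eqVneq d d') => [dd|dd]; first by rewrite c1E c1E' dd.
exfalso; have := allP (allP2 table_fork tL dD) d' dD'; rewrite (negbTE dd).
have [d15 d15'] := (type_lt (D_types dD), type_lt (D_types dD')).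
have yz : e y z by rewrite es.
case: ifP => [w _|_].
  by apply: (single_single_no _ t15 d15 w Az Ax xz z14 x14 n s n1 s1); rewrite !inE eqxx !orbT.
case: ifP => [w _|_].
  by apply: (single_single_no _ t15 d15' w Az Ay yz z14 y14 n s n1' s1'); rewrite !inE eqxx !orbT.
case: ifP => [w _|_ w].
  exact: (fork_no t15 d15 d15' w Az Ax Ay xz yz z14 x14 y14 n s n1 s1 n1' s1').
exact: (fork_no t15 d15' d15 w Az Ay Ax yz xz z14 y14 x14 n s n1' s1' n1 s1).
Qed.
End Colour.

Section Gap.
Variables (T : finType) (e : rel T) (A : pred T).
Hypotheses (Gsimple : simple_graph e) (Gclass : class_G 10 7 e).
Hypothesis Airr : irreducible e A.

(** Seven vertices, one of each type L_i, would form the configuration in [no_gap_cases]. *)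
Lemma exists_gap f : seven e A f -> exists r, r < 7 /\
  forall w, A w -> ~~ has_type e (fun i => f (turn (unturn r false) false i)) w 13.
Proof.
move=> [cf Af].
have [/hasP[i]|] := boolP (has (fun i => [forall w, A w ==> ~~ has_type e f w (7 + i)]) (iota 0 7)).
  rewrite mem_iota => /= i7 /forallP no.
  have [r [r7 tr]] : exists r, r < 7 /\ turn_type r false (7 + i) = 13.
    exists ((13 - i) %% 7); rewrite ltn_mod; split=> //.
    have /allP/(_ i) : all (fun i => turn_type ((13 - i) %% 7) false (7 + i) == 13) (iota 0 7) by vm_compute.
    by rewrite mem_iota => /(_ i7) /eqP->.
  exists r; split=> // w Aw; rewrite -tr has_type_turn //; first exact: (implyP (no w)).
  by rewrite (leq_trans (_ : 7 + i < 14)) // (ltn_add2l 7 i 7).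
move=> /hasPn full; exfalso.
pose P : pattern := ([seq (tL i, [::]) | i <- iota 0 7], [::]).
have inD : P \in map fst cases by vm_cast_no_check (erefl true).
have [wf [c vc]] := cases_verified inD.
pose g i := odflt (f 0) [pick w | A w && has_type e f w (7 + i)].
have gP i : i < 7 -> A (g i) /\ has_type e f (g i) (7 + i).
  move=> i7; rewrite /g; case: pickP => [w /andP[]//|no].
  have := full i; rewrite mem_iota => /(_ i7)/negP[]; apply/forallP => w.
  by apply/implyP => Aw; have := no w; rewrite Aw /= => ->.
apply: (verified_sound Gsimple Gclass Airr wf vc (cyc_ext cf [seq g i | i <- iota 0 7]) (@A_ext _ _ _ Af _)).
apply: verts_ext => // k k7; have [Ag tg] := gP k k7.
have -> : nth (0, [::]) P.1 k = (7 + k, [::]).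
  by rewrite /P (nth_map 0) ?size_iota // nth_iota // /tL modn_small.
rewrite /= (_ : nth (f 0) _ k = g k); last first.
  by rewrite -[LHS]/(nth (f 0) [seq g i | i <- iota 0 7] k) (nth_map 0) ?size_iota // nth_iota.
by split=> //; rewrite tg andbT (leq_trans (_ : 7 + k < 14)) // (ltn_add2l 7 k 7).
Qed.
End Gap.

(** * Bipartite components *)

Section Bipartite.
Variables (T : finType) (e : rel T) (H : pred T).
Hypotheses (Gsimple : simple_graph e) (Gclass : class_G 10 7 e).
Hypothesis no7 : forall f, cyc e f -> (forall i, i < 7 -> H (f i)) -> False.

Let es : symmetric e. Proof. by case: Gsimple. Qed.

Definition closed_walk k (f : nat -> T) : Prop :=
  [/\ forall i, e (f i) (f i.+1), forall i, H (f i) & forall i, f (i + k) = f i].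

(** A walk closed by an edge between its ends is repeated periodically. *)
Lemma close_walk f i l : (forall i, e (f i) (f i.+1)) -> (forall i, H (f i)) -> 0 < l ->
  e (f (i + l.-1)) (f i) -> closed_walk l (fun x => f (i + x %% l)).
Proof.
move=> fe fH l0 el; split=> // x; last by rewrite modnDr.
rewrite -(addn1 x) -modnDml addn1.
have : x %% l < l by rewrite ltn_mod.
rewrite leq_eqVlt => /orP[/eqP xl|xl]; last by rewrite (modn_small xl) addnS.
by rewrite xl modnn addn0 -[in x %% l](prednK l0) (_ : x %% l.-1.+1 = l.-1) // prednK //; lia.
Qed.

(** A shortest odd closed walk is an induced cycle: a repeated vertex or a chord would split it into
    two closed walks, one of which is odd and shorter.  The class makes this cycle a C_7. *)
Lemma no_odd_walk k f : odd k -> closed_walk k f -> False.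
Proof.
elim/ltn_ind: k f => k IH f ok [fe fH fk]; have [_ ei] := Gsimple.
have short i l : odd l -> l < k -> ~ e (f (i + l.-1)) (f i).
  move=> ol lk el; apply: (IH l lk _ ol (close_walk fe fH _ el)).
  by case: (l) ol.
(* Length 1 would be a loop. *)
have k3 : 2 < k.
  case: k ok fk {IH short} => [|[|[|k]]] // _ fk; have := fe 0.
  by have := fk 0; rewrite add0n => ->; rewrite ei.
have inj i d : 0 < d < k -> f i <> f (i + d).
  move=> /andP[d0 dk] eq; case od: (odd d).
    by apply: (short i d od dk); rewrite eq -{2}(prednK d0) addnS.
  have okd : odd (k - d) by rewrite oddB ?od ?ok // ltnW.
  apply: (short (i + d) (k - d) okd); first lia.
  rewrite -eq -[f i]fk (_ : i + k = (i + d + (k - d).-1).+1) //; lia.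
have chord i d : 1 < d < k.-1 -> ~~ e (f i) (f (i + d)).
  move=> /andP[d0 dk]; apply/negP => c; case od: (odd d).
    have okd : odd (k - d).+1 by rewrite /= oddB ?od ?ok //; lia.
    apply: (short (i + d) (k - d).+1 okd); first lia.
    by rewrite /= -addnA subnKC ?fk //; lia.
  by apply: (short i d.+1); rewrite /= ?od //; [lia | rewrite es].
have adj x y : x < y -> y < k -> e (f x) (f y) = ((x.+1 %% k == y) || (y.+1 %% k == x)).
  move=> xy yk; rewrite (modn_small (leq_ltn_trans xy yk)).
  case: (eqVneq x.+1 y) => [<-|ne]; first by rewrite fe.
  move: yk; rewrite leq_eqVlt => /orP[/eqP yk|yk].
    rewrite yk modnn; case: (posnP x) => [->|x0].
      by rewrite es -[f 0]fk -yk add0n fe.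
    rewrite (_ : 0 == x = false); last by case: (x) x0.
    by apply/negbTE; rewrite -(subnKC (ltnW xy)); apply: chord; lia.
  rewrite (modn_small yk) /= (_ : (y.+1 == x) = false); last by apply/negbTE; lia.
  by apply/negbTE; rewrite -(subnKC (ltnW xy)); apply: chord; lia.
have sym_adj (x y : nat) : x < k -> y < k -> e (f x) (f y) = ((x.+1 %% k == y) || (y.+1 %% k == x)).
  move=> xk yk; case: (ltngtP x y) => [xy|yx|->]; first exact: adj.
    by rewrite es orbC; apply: adj.
  rewrite ei orbb; apply/esym/negbTE/eqP; move: yk; rewrite leq_eqVlt => /orP[/eqP yk|yk].
    by rewrite yk modnn; lia.
  by rewrite modn_small //; lia.
have k7 : k = 7.
  case: Gclass => _; apply=> //.
  exists (fun i : 'I_k => f i) => [x y fxy|x y]; last exact: sym_adj.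
  apply/val_inj => /=; case: (ltngtP x y) => // xy; exfalso.
    by apply: (inj x (y - x)); [have := ltn_ord y; lia | rewrite subnKC // ltnW].
  by apply: (inj y (x - y)); [have := ltn_ord x; lia | rewrite subnKC // ltnW].
by apply: (@no7 f) => [i j|i _] //; rewrite k7 in sym_adj; apply: sym_adj.
Qed.

(** Adjacency in the bipartite double cover.  An odd closed walk at [x] is a path between the two
    copies of [x]. *)
Definition cover_step (p q : T * bool) := [&& H p.1, H q.1, e p.1 q.1 & q.2 == ~~ p.2].

Lemma cover_flip p q : connect cover_step p q -> connect cover_step (p.1, ~~ p.2) (q.1, ~~ q.2).
Proof.
move/connectP=> [s]; elim: s p => [|x s IH] p /= => [_ ->|]; first exact: connect0.
case/andP=> px /IH{}IH /IH; apply: connect_trans; apply: connect1.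
by move: px; rewrite /cover_step /= => /and4P[-> -> -> /eqP->] /=.
Qed.

Lemma cover_sym : connect_sym cover_step.
Proof.
apply: sym_connect_sym => p q; rewrite /cover_step es.
by case: (H p.1); case: (H q.1); case: (e _ _) => //=; case: p.2; case: q.2.
Qed.

Lemma cover_path p s : path cover_step p s -> forall i, i <= size s ->
  (nth p (p :: s) i).2 = odd i (+) p.2 /\
  (i < size s -> [/\ H (nth p (p :: s) i).1, H (nth p (p :: s) i.+1).1
     & e (nth p (p :: s) i).1 (nth p (p :: s) i.+1).1]).
Proof.
elim: s p => [|q s IH] p; first by move=> _ [|i].
move=> /= /andP[/and4P[Hp Hq pq /eqP q2] ps] [|i] /= is1; first by split.
rewrite (set_nth_default q) //; have [h1 h2] := IH q ps i is1.
split; first by rewrite h1 q2; case: odd; case: p.2.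
by move=> i1; have := h2 i1; rewrite /= (set_nth_default q) //.
Qed.

Lemma cover_free x : ~~ connect cover_step (x, false) (x, true).
Proof.
apply/negP => /connectP[s ps ls]; have steps := cover_path ps.
have os : odd (size s).
  have [] := steps (size s) (leqnn _); rewrite addbF => <- _.
  by rewrite -last_nth -ls.
have s0 : 0 < size s by case: (size s) os.
pose f i := (nth (x, false) ((x, false) :: s) i).1.
have fs i : i < size s -> [/\ H (f i), H (f i.+1) & e (f i) (f i.+1)].
  by move=> is1; case: (steps i (ltnW is1)) => _ /(_ is1).
have fl : f (size s) = f 0.
  by rewrite /f -last_nth -ls.
apply: (no_odd_walk (f := fun i => f (i %% size s)) os); split=> i; last by rewrite modnDr.
  have im : i %% size s < size s by rewrite ltn_mod.
  have [_ _ ei] := fs _ im; rewrite -[in X in e _ X](addn1 i) -modnDml addn1.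
  move: (im); rewrite leq_eqVlt => /orP[/eqP im'|im']; last by rewrite (modn_small im').
  by rewrite im' modnn -fl -[in X in e _ X]im'.
by have [] := fs (i %% size s) (ltn_pmod i s0).
Qed.

Definition within_step x y := [&& H x, H y & e x y].
(** The parity of the walks from the root of the component to [v]. *)
Definition side v := connect cover_step (root within_step v, false) (v, true).

Lemma within_cover x y : connect within_step x y ->
  exists b, connect cover_step (x, false) (y, b).
Proof.
move/connectP=> [s]; elim/last_ind: s y => [|s z IH] y /=; first by move=> _ ->; exists false.
rewrite rcons_path last_rcons => /andP[ps /and3P[Hl Hz lz]] ->.
have [b hb] := IH _ ps erefl; exists (~~ b); apply: connect_trans hb _.
by apply: connect1; rewrite /cover_step /= Hl Hz lz eqxx.
Qed.

Lemma side_edge v w : H v -> H w -> e v w -> side v != side w.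
Proof.
move=> Hv Hw vw.
have wsym : connect_sym within_step.
  by apply: sym_connect_sym => x y; rewrite /within_step es; case: (H x); case: (H y).
have rr : root within_step v = root within_step w.
  by apply/(rootP wsym); apply: connect1; rewrite /within_step Hv Hw vw.
have step b : cover_step (v, b) (w, ~~ b) by rewrite /cover_step /= Hv Hw vw eqxx.
rewrite /side -rr; set r := root _ v.
have [b hb] : exists b, connect cover_step (r, false) (v, b).
  by apply: within_cover; rewrite wsym; apply: connect_root.
have both x : connect cover_step (r, false) (x, true) -> connect cover_step (r, false) (x, false) -> False.
  move=> h1 h0; apply: (negP (cover_free r)); apply: connect_trans h0 _.
  by rewrite cover_sym; exact: cover_flip h1.
have hw : connect cover_step (r, false) (w, ~~ b) by apply: connect_trans hb (connect1 (step b)).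
case: b hb hw => hb hw; apply/eqP => eq.
  by apply: (both w); rewrite -?eq.
by apply: (both v); rewrite ?eq.
Qed.

Lemma bipartition : exists h : T -> bool, forall v w, H v -> H w -> e v w -> h v != h w.
Proof. by exists side; apply: side_edge. Qed.
End Bipartite.

(** * A language of bounded loops and its compilation *)

(** There is no addition and no multiplication: values never exceed the number of vertices and the
    constants, which makes overflow a matter of addresses only.  [TR t] counts down from [n - 1]. *)
Inductive term := TC of nat | TV of nat | TA of nat & term | TR of term.
Inductive formula :=
  | FEq of term & term | FLt of term & term | FAdj of term & term
  | FNot of formula | FAnd of formula & formula | FEx of nat & formula.
Inductive code :=
  | CSet of nat & term & term
  | CSeq of code & code
  | CIf of formula & code & code
  | CFor of nat & code
  | CSkip.

Definition store := nat -> nat -> nat.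
(** Loop variables live in an environment apart from the store of arrays. *)
Definition bind (rho : nat -> nat) x v : nat -> nat := fun y => if y == x then v else rho y.
Definition assign (st : store) a i v : store :=
  fun b j => if (b == a) && (j == i) then v else st b j.

Section Semantics.
Variables (n : nat) (adj : nat -> nat -> bool).
Implicit Types (rho : nat -> nat) (st : store).

Fixpoint tval rho st t : nat :=
  match t with
  | TC k => k
  | TV x => rho x
  | TA a t => st a (tval rho st t)
  | TR t => n.-1 - tval rho st t
  end.

Fixpoint holds rho st f : bool :=
  match f with
  | FEq t u => tval rho st t == tval rho st u
  | FLt t u => tval rho st t < tval rho st u
  | FAdj t u => adj (tval rho st t) (tval rho st u)
  | FNot f => ~~ holds rho st f
  | FAnd f g => holds rho st f && holds rho st g
  | FEx x f => has (fun v => holds (bind rho x v) st f) (iota 0 n)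
  end.

Fixpoint run c rho st : store :=
  match c with
  | CSet a t u => assign st a (tval rho st t) (tval rho st u)
  | CSeq c d => run d rho (run c rho st)
  | CIf f c d => if holds rho st f then run c rho st else run d rho st
  | CFor x c => foldl (fun s v => run c (bind rho x v) s) st (iota 0 n)
  | CSkip => st
  end.
End Semantics.

Section Translation.
Variable K : nat.

Definition base_expr : expr :=
  Add (Read (Const 0)) (Add (Mul (Const 2) (Read (Const 1))) (Const 2)).
(** Memory is cut into blocks of [n + K + 1] cells, one for each array, variable and temporary.  They start
    at address [n + 2m + 2], behind the input and behind the cells of the output. *)
Definition cell s i : expr :=
  Add (Add base_expr (Mul (Const s) (Add (Read (Const 0)) (Const K.+1)))) i.
Definition slot0 s := cell s (Const 0).
(** Residues modulo 3 keep the blocks of variables, arrays and temporaries apart. *)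
Definition var x := 3 * x.
Definition arr a := 3 * a + 1.
Definition tmp k := 3 * k + 2.

Fixpoint tcomp t : expr :=
  match t with
  | TC k => Const k
  | TV x => Read (slot0 (var x))
  | TA a t => Read (cell (arr a) (tcomp t))
  | TR t => Defs.Sub (Defs.Sub (Read (Const 0)) (Const 1)) (tcomp t)
  end.

Definition eqE a b : expr := Defs.Sub (Const 1) (Add (Defs.Sub a b) (Defs.Sub b a)).
Definition ltE a b : expr := Defs.Sub (Const 1) (Defs.Sub (Const 1) (Defs.Sub b a)).

Definition count_loop s (N : expr) c : cmd :=
  Seq (Write (slot0 s) (Const 0))
    (While (Defs.Sub N (Read (slot0 s)))
      (Seq c (Write (slot0 s) (Add (Read (slot0 s)) (Const 1))))).

Definition edge_end d j : expr := Read (Add (Const d) (Mul (Const 2) (Read (slot0 (tmp j))))).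
Definition edge_test j a b : expr :=
  Add (Mul (eqE (edge_end 2 j) a) (eqE (edge_end 3 j) b))
      (Mul (eqE (edge_end 2 j) b) (eqE (edge_end 3 j) a)).

(** The truth value is left in the temporary [k], and only temporaries from [k] on are used.  A
    quantifier saves and restores its variable, so that environments are preserved. *)
Fixpoint fcomp f k : cmd :=
  match f with
  | FEq t u => Write (slot0 (tmp k)) (eqE (tcomp t) (tcomp u))
  | FLt t u => Write (slot0 (tmp k)) (ltE (tcomp t) (tcomp u))
  | FAdj t u => Seq (Write (slot0 (tmp k)) (Const 0))
      (count_loop (tmp k.+1) (Read (Const 1))
        (If (edge_test k.+1 (tcomp t) (tcomp u)) (Write (slot0 (tmp k)) (Const 1)) Skip))
  | FNot f => Seq (fcomp f k)
      (Write (slot0 (tmp k)) (Defs.Sub (Const 1) (Read (slot0 (tmp k)))))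
  | FAnd f g => Seq (fcomp f k) (Seq (fcomp g k.+1)
      (Write (slot0 (tmp k)) (Mul (Read (slot0 (tmp k))) (Read (slot0 (tmp k.+1))))))
  | FEx x f => Seq (Write (slot0 (tmp k)) (Const 0))
      (Seq (Write (slot0 (tmp k.+1)) (Read (slot0 (var x))))
        (Seq (count_loop (var x) (Read (Const 0))
               (Seq (fcomp f k.+2)
                 (If (Read (slot0 (tmp k.+2))) (Write (slot0 (tmp k)) (Const 1)) Skip)))
          (Write (slot0 (var x)) (Read (slot0 (tmp k.+1))))))
  end.

Fixpoint ccomp c k : cmd :=
  match c with
  | CSet a t u => Write (cell (arr a) (tcomp t)) (tcomp u)
  | CSeq c d => Seq (ccomp c k) (ccomp d k)
  | CIf f c d => Seq (fcomp f k) (If (Read (slot0 (tmp k))) (ccomp c k) (ccomp d k))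
  | CFor x c => Seq (Write (slot0 (tmp k)) (Read (slot0 (var x))))
      (Seq (count_loop (var x) (Read (Const 0)) (ccomp c k.+1))
        (Write (slot0 (var x)) (Read (slot0 (tmp k)))))
  | CSkip => Skip
  end.

Variable S : nat.

Fixpoint tfits t : bool :=
  match t with
  | TC k => k <= K
  | TV x => var x < S
  | TA a t => (arr a < S) && tfits t
  | TR t => tfits t
  end.
Fixpoint ffits f k : bool :=
  match f with
  | FEq t u | FLt t u => [&& tmp k < S, tfits t & tfits u]
  | FAdj t u => [&& tmp k.+1 < S, tfits t & tfits u]
  | FNot f => ffits f k
  | FAnd f g => ffits f k && ffits g k.+1
  | FEx x f => (var x < S) && ffits f k.+2
  end.
Fixpoint cfits c k : bool :=
  match c with
  | CSet a t u => [&& arr a < S, tfits t & tfits u]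
  | CSeq c d => cfits c k && cfits d k
  | CIf f c d => [&& ffits f k, cfits c k & cfits d k]
  | CFor x c => [&& var x < S, tmp k < S & cfits c k.+1]
  | CSkip => true
  end.

Fixpoint fdepth f : nat :=
  match f with
  | FEq _ _ | FLt _ _ => 0
  | FAdj _ _ => 2
  | FNot f => fdepth f
  | FAnd f g => maxn (fdepth f) (fdepth g)
  | FEx _ f => (fdepth f).+1
  end.
Fixpoint cdepth c : nat :=
  match c with
  | CSet _ _ _ | CSkip => 0
  | CSeq c d => maxn (cdepth c) (cdepth d)
  | CIf f c d => maxn (fdepth f) (maxn (cdepth c) (cdepth d))
  | CFor _ c => (cdepth c).+1
  end.
End Translation.

(** The time that the program takes if every loop body is executed once. *)
Fixpoint weight c : nat :=
  match c with
  | Skip => 1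
  | Write a b => (expr_cost a + expr_cost b).+1
  | Seq c d => weight c + weight d
  | If b c d => (expr_cost b).+1 + (weight c + weight d)
  | While b c => (expr_cost b).+1 + weight c
  end.

Section Machine.
Variables (n m K S W : nat).
Local Notation B := (n + K).
Hypothesis (HW : n + (2 * m + 2) + S * (n + K.+1) + K < W).
Local Notation cell := (cell K).
Local Notation slot0 := (slot0 K).

Definition addr s i := n + (2 * m + 2) + s * (n + K.+1) + i.

Definition runs c mu T mu' := exists2 t, exec W c mu t mu' & t <= T.

Lemma runs_le c mu T T' mu' : T <= T' -> runs c mu T mu' -> runs c mu T' mu'.
Proof. by move=> TT [t h tT]; exists t => //; apply: leq_trans TT. Qed.

Lemma runs_seq c d mu1 mu2 mu3 T1 T2 :
  runs c mu1 T1 mu2 -> runs d mu2 T2 mu3 -> runs (Seq c d) mu1 (T1 + T2) mu3.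
Proof. by move=> [t h l] [t' h' l']; exists (t + t'); [apply: ExecSeq h h' | apply: leq_add]. Qed.

Lemma runs_write a b mu i v : eval W mu a = Some i -> eval W mu b = Some v ->
  runs (Write a b) mu (weight (Write a b)) (update mu i v).
Proof. by move=> ea eb; exists (weight (Write a b)) => //; apply: ExecWrite. Qed.

Lemma runs_if b c d mu v T mu' : eval W mu b = Some v ->
  runs (if 0 < v then c else d) mu T mu' -> runs (If b c d) mu ((expr_cost b).+1 + T) mu'.
Proof.
move=> eb [t h l]; exists (expr_cost b + t).+1; last by rewrite addSn ltnS leq_add2l.
by case: v eb h => [|v] eb h; [apply: ExecIfFalse eb h | apply: ExecIfTrue eb h].
Qed.

Definition ready mu := mu 0 = n /\ mu 1 = m.

Lemma word_lt v : v < W -> word W v = Some v.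
Proof. by rewrite /word => ->. Qed.

Lemma eval_const mu v : v < W -> eval W mu (Const v) = Some v.
Proof. exact: word_lt. Qed.

Lemma S_bound s : s < S -> s * (n + K.+1) + (n + K.+1) <= S * (n + K.+1).
Proof. by move=> sS; rewrite -mulSnr leq_mul2r sS orbT. Qed.

Lemma eval_read mu e i : eval W mu e = Some i -> mu i < W -> eval W mu (Read e) = Some (mu i).
Proof. by move=> /= -> /word_lt. Qed.
Lemma eval_add mu a b x y : eval W mu a = Some x -> eval W mu b = Some y -> x + y < W ->
  eval W mu (Add a b) = Some (x + y).
Proof. by move=> /= -> -> /word_lt. Qed.
Lemma eval_sub mu a b x y : eval W mu a = Some x -> eval W mu b = Some y -> x < W ->
  eval W mu (Defs.Sub a b) = Some (x - y).
Proof. by move=> /= -> -> xW; apply: word_lt; lia. Qed.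
Lemma eval_mul mu a b x y : eval W mu a = Some x -> eval W mu b = Some y -> x * y < W ->
  eval W mu (Mul a b) = Some (x * y).
Proof. by move=> /= -> -> /word_lt. Qed.

Lemma eval_n mu : ready mu -> n < W -> eval W mu (Read (Const 0)) = Some n.
Proof.
move=> [r0 _] nW; have := @eval_read mu (Const 0) 0; rewrite r0; apply=> //.
by apply: word_lt; lia.
Qed.
Lemma eval_m mu : ready mu -> eval W mu (Read (Const 1)) = Some m.
Proof.
move=> [_ r1]; have h := HW; have := @eval_read mu (Const 1) 1; rewrite r1; apply; last lia.
by apply: word_lt; lia.
Qed.

Lemma eval_cell mu s e i : ready mu -> s < S -> eval W mu e = Some i -> i <= B ->
  eval W mu (cell s e) = Some (addr s i).
Proof.
move=> rmu sS ee iB; have := S_bound sS; have := HW.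
have : s <= s * (n + K.+1) by rewrite leq_pmulr // addnS.
rewrite /addr; set a := s * _; move: (S * (n + K.+1)) => b h1 h2 h3.
apply: eval_add ee _; last by rewrite -!addnA; lia.
apply: eval_add; [|apply: eval_mul; [apply: eval_const; lia | |] |]; rewrite -/a; try lia.
  apply: eval_add; [apply: eval_n => //; lia | | lia].
  by apply: eval_add; [apply: eval_mul; [apply: eval_const | apply: eval_m |] | apply: eval_const |] => //;
    lia.
by apply: eval_add; [apply: eval_n => // | apply: eval_const |]; lia.
Qed.

Lemma S_pos s : s < S -> n + K < W.
Proof. by move/S_bound; have := HW; move: (S * (n + K.+1)) (s * (n + K.+1)) => a b; lia. Qed.

Lemma eval_slot0 mu s : ready mu -> s < S -> eval W mu (slot0 s) = Some (addr s 0).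
Proof. by move=> r sS; apply: eval_cell => //; apply: word_lt; have := S_pos sS; lia. Qed.

(** Indices are below the length of a block. *)
Lemma addr_inj s i s' i' : i <= B -> i' <= B -> addr s i = addr s' i' -> s = s' /\ i = i'.
Proof.
rewrite /addr => iB i'B; rewrite -2!(addnA (_ + _)) => /addnI.
have [d0 l l'] : [/\ 0 < n + K.+1, i < n + K.+1 & i' < n + K.+1] by split; lia.
move=> eq; have /(congr1 (fun x => x %/ (n + K.+1))) := eq.
rewrite /= !divnMDl // !divn_small // !addn0 => ss; split=> //.
by move: eq; rewrite ss => /addnI.
Qed.

Lemma addr_big s i : n + (2 * m + 2) <= addr s i.
Proof. by rewrite /addr -addnA leq_addr. Qed.

Lemma ready_update mu s i v : ready mu -> ready (update mu (addr s i) v).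
Proof.
by move=> [r0 r1]; rewrite /ready /update; have := addr_big s i => h; rewrite !ifN //; lia.
Qed.

(** The counter is incremented by the loop and not by its body, which is why the invariant is stated
    for the memory after the update. *)
Lemma runs_loop s N e c T (P : nat -> memory -> Prop) mu : s < S -> N < W ->
  ready mu ->
  (forall i mu, i <= N -> P i mu -> ready mu /\ mu (addr s 0) = i) ->
  (forall mu, ready mu -> eval W mu e = Some N) ->
  (forall i mu, i < N -> P i mu -> exists2 mu', runs c mu T mu' &
     [/\ ready mu', mu' (addr s 0) = i & P i.+1 (update mu' (addr s 0) i.+1)]) ->
  P 0 (update mu (addr s 0) 0) ->
  exists2 mu', runs (count_loop K s e c) mu
    (((weight (count_loop K s e Skip)).-1 + T) * N.+1) mu' & P N mu'.
Proof.
move=> sS NW rmu Pi eN body P0; have SW := S_pos sS.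
set b := Defs.Sub e (Read (slot0 s)).
set inc := Write (slot0 s) (Add (Read (slot0 s)) (Const 1)).
have [w1 wE] : exists w1, weight (count_loop K s e Skip) = w1 + ((expr_cost b).+1 + (1 + weight inc)).
  by exists (weight (Write (slot0 s) (Const 0))).
have loop : forall k i mu, N - i = k -> i <= N -> P i mu ->
    exists2 mu', runs (While b (Seq c inc)) mu
      ((expr_cost b).+1 + k * ((expr_cost b).+1 + (T + weight inc))) mu' & P N mu'.
  have rd i mu1 : i <= N -> P i mu1 -> eval W mu1 (Read (slot0 s)) = Some i.
    move=> iN Pmu; have [r1 c1] := Pi i mu1 iN Pmu.
    by have := eval_read (eval_slot0 r1 sS); rewrite c1; apply; lia.
  elim=> [|k IH] i mu1 ik iN Pmu; have [r1 c1] := Pi i mu1 iN Pmu;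
  have := eval_sub (eN mu1 r1) (rd i mu1 iN Pmu) NW; rewrite ik => eb.
    have iE : i = N by apply/eqP; rewrite eqn_leq iN -subn_eq0 ik.
    exists mu1; last by rewrite -iE.
    by exists (expr_cost b).+1; [apply: ExecWhileFalse | rewrite leq_addr].
  have iN' : i < N by rewrite -subn_gt0 ik.
  have [mu2 [t2 h2 l2] [r2 c2 Pmu2]] := body i mu1 iN' Pmu.
  have ki : N - i.+1 = k by rewrite subnS ik.
  have [mu3 [t3 h3 l3] P3] := IH i.+1 _ ki iN' Pmu2.
  exists mu3 => //; exists (expr_cost b + (t2 + weight inc) + t3).+1.
    apply: ExecWhileTrue eb _ h3.
    apply: ExecSeq h2 _; apply: ExecWrite; first exact: eval_slot0.
    rewrite -(addn1 i); apply: eval_add; last lia; last by apply: eval_const; lia.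
    by have := eval_read (eval_slot0 r2 sS); rewrite c2; apply; lia.
  move: l2 l3; rewrite mulSn; move: (k * _) => z; lia.
have [mu3 h3 P3] := loop N 0 _ (subn0 N) (leq0n N) P0.
exists mu3 => //; apply: runs_le; last first.
  apply: (runs_seq _ h3); apply: runs_write; first exact: eval_slot0.
  by apply: eval_const; lia.
rewrite (_ : (weight (count_loop K s e Skip)).-1 = weight (Write (slot0 s) (Const 0)) + ((expr_cost b).+1 + weight inc)); last by rewrite /= -/b -/inc; lia.
by move: (weight _) (weight inc) (expr_cost b).+1 => w0 wi wb; nia.
Qed.

Lemma pow_pos d : 0 < n.+1 ^ d. Proof. by rewrite expn_gt0. Qed.
Lemma pow_mono d d' : d <= d' -> n.+1 ^ d <= n.+1 ^ d'.
Proof. by move=> h; rewrite leq_pexp2l. Qed.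

Lemma weight_loop s e c :
  weight (count_loop K s e c) = (weight (count_loop K s e Skip)).-1 + weight c.
Proof. by rewrite /=; lia. Qed.

(** Each enclosing loop over the vertices multiplies the time by at most [n + 1]. *)
Definition within c d mu mu' := runs c mu (weight c * n.+1 ^ d) mu'.

Lemma within_le c d d' mu mu' : d <= d' -> within c d mu mu' -> within c d' mu mu'.
Proof. by move=> dd; apply: runs_le; rewrite leq_mul2l pow_mono ?orbT. Qed.

Lemma within_runs c d mu mu' : runs c mu (weight c) mu' -> within c d mu mu'.
Proof. by apply: runs_le; rewrite leq_pmulr ?pow_pos. Qed.

Lemma within_write d mu a b i v : eval W mu a = Some i -> eval W mu b = Some v ->
  within (Write a b) d mu (update mu i v).
Proof. by move=> ea eb; apply: within_runs; apply: runs_write. Qed.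

Lemma within_skip d mu : within Skip d mu mu.
Proof. by apply: within_runs; exists 1; [apply: ExecSkip | ]. Qed.

Lemma within_seq c1 c2 d mu1 mu2 mu3 :
  within c1 d mu1 mu2 -> within c2 d mu2 mu3 -> within (Seq c1 c2) d mu1 mu3.
Proof. by move=> h1 h2; rewrite /within /= mulnDl; apply: runs_seq h1 h2. Qed.

Lemma within_if b c1 c2 d mu v mu' : eval W mu b = Some v ->
  within (if 0 < v then c1 else c2) d mu mu' -> within (If b c1 c2) d mu mu'.
Proof.
move=> eb h; apply: runs_le (runs_if eb h); have := pow_pos d; rewrite [weight (If _ _ _)]/=.
by case: (0 < v); move: (_ ^ d) (weight c1) (weight c2) (expr_cost b).+1 => *; nia.
Qed.

Lemma within_loop s N e c d d' (P : nat -> memory -> Prop) mu : s < S -> N < W ->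
  ready mu -> N.+1 * n.+1 ^ d <= n.+1 ^ d' ->
  (forall i mu, i <= N -> P i mu -> ready mu /\ mu (addr s 0) = i) ->
  (forall mu, ready mu -> eval W mu e = Some N) ->
  (forall i mu, i < N -> P i mu -> exists2 mu', within c d mu mu' &
     [/\ ready mu', mu' (addr s 0) = i & P i.+1 (update mu' (addr s 0) i.+1)]) ->
  P 0 (update mu (addr s 0) 0) ->
  exists2 mu', within (count_loop K s e c) d' mu mu' & P N mu'.
Proof.
move=> sS NW r le h1 h2 h3 h4; have [mu' run PN] := runs_loop sS NW r h1 h2 h3 h4.
exists mu' => //; apply: runs_le run; rewrite (weight_loop _ _ c).
move: (weight _).-1 (weight c) => a b; have := pow_pos d.
by move=> p0; apply: leq_trans _ (leq_mul (leqnn (a + b)) le); move: (_ ^ d) p0 => p p0; nia.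
Qed.

Variable ed : seq (nat * nat).
Definition edge u v := has (fun p => (p.1 == u) && (p.2 == v) || (p.1 == v) && (p.2 == u)) ed.

(** The memory represents the environment and the store, whose values are bounded by [n + K]. *)
Definition good (rho : nat -> nat) (st : store) mu : Prop :=
  [/\ ready mu,
      forall j, j < m -> mu (2 + 2 * j) = (nth (0, 0) ed j).1 /\ mu (3 + 2 * j) = (nth (0, 0) ed j).2,
      forall x, var x < S -> mu (addr (var x) 0) = rho x,
      forall a i, arr a < S -> i <= B -> mu (addr (arr a) i) = st a i
    & (forall x, rho x <= B) /\ (forall a i, st a i <= B)].

(** Temporaries below [k] hold values that the surrounding code still needs. *)
Definition keep k (mu mu' : memory) := forall j, j < k -> mu' (addr (tmp j) 0) = mu (addr (tmp j) 0).

Lemma nW : n + K < W. Proof. by have := HW; lia. Qed.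

Lemma update_same mu i v : update mu i v i = v.
Proof. by rewrite /update eqxx. Qed.

Lemma update_other mu s i s' i' v : i <= B -> i' <= B -> (s != s') || (i != i') ->
  update mu (addr s i) v (addr s' i') = mu (addr s' i').
Proof.
move=> iB iB' ne; rewrite /update; case: eqP => // /(addr_inj iB' iB)[ss ii].
by rewrite ss ii !eqxx in ne.
Qed.

Lemma update_input mu s i v j : j < n + (2 * m + 2) -> update mu (addr s i) v j = mu j.
Proof. by move=> h; rewrite /update ifN //; have := addr_big s i; lia. Qed.

Lemma good_tmp rho st mu k v : good rho st mu -> good rho st (update mu (addr (tmp k) 0) v).
Proof.
case=> [r inp vs ars bd]; split=> //; first exact: ready_update.
- by move=> j jm; rewrite !update_input; [apply: inp | lia | lia].
- by move=> x xS; rewrite update_other ?vs // /var /tmp; lia.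
by move=> a i aS iB; rewrite update_other ?ars // /arr /tmp; lia.
Qed.

Lemma good_var rho st mu x v : good rho st mu -> v <= B ->
  good (bind rho x v) st (update mu (addr (var x) 0) v).
Proof.
case=> [r inp vs ars [b1 b2]] vB; split=> //; first exact: ready_update.
- by move=> j jm; rewrite !update_input; [apply: inp | lia | lia].
- move=> y yS; rewrite /bind; case: eqP => [->|xy]; first by rewrite update_same.
  by rewrite update_other ?vs // /var; lia.
- by move=> a i aS iB; rewrite update_other ?ars // /arr /var; lia.
by split=> // y; rewrite /bind; case: eqP.
Qed.

Lemma good_arr rho st mu a i v : good rho st mu -> v <= B -> i <= B ->
  good rho (assign st a i v) (update mu (addr (arr a) i) v).
Proof.
case=> [r inp vs ars [b1 b2]] vB iB; split=> //; first exact: ready_update.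
- by move=> j jm; rewrite !update_input; [apply: inp | lia | lia].
- by move=> x xS; rewrite update_other ?vs // /var /arr; lia.
- move=> b j bS jB; rewrite /assign; case: ifP => [/andP[/eqP-> /eqP->]|ne].
    by rewrite update_same.
  by rewrite update_other ?ars // /arr; lia.
by split=> // b j; rewrite /assign; case: ifP.
Qed.

Lemma good_ext rho rho' st mu : rho =1 rho' -> good rho st mu -> good rho' st mu.
Proof.
move=> rr [r inp vs ars [b1 b2]]; split=> //; first by move=> x /vs->.
by split=> // x; rewrite -rr.
Qed.

Lemma good_unbind rho st mu x v : good (bind rho x v) st mu -> rho x <= B ->
  good rho st (update mu (addr (var x) 0) (rho x)).
Proof.
move=> g xB; apply: good_ext (good_var x g xB) => y; rewrite /bind; by case: eqP => [->|].
Qed.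

Lemma keep_tmp k j mu v : k <= j -> keep k mu (update mu (addr (tmp j) 0) v).
Proof. by move=> kj i ik; rewrite update_other // /tmp; lia. Qed.
Lemma keep_var k x mu v : keep k mu (update mu (addr (var x) 0) v).
Proof. by move=> i ik; rewrite update_other // /tmp /var; lia. Qed.
Lemma keep_arr k a i mu v : i <= B -> keep k mu (update mu (addr (arr a) i) v).
Proof. by move=> iB j ik; rewrite update_other // /tmp /arr; lia. Qed.
Lemma keep_trans k k' mu mu1 mu2 : keep k mu mu1 -> keep k' mu1 mu2 -> k <= k' -> keep k mu mu2.
Proof. by move=> h1 h2 kk j jk; rewrite h2 ?h1 //; apply: leq_trans kk. Qed.

Lemma keep_refl k mu : keep k mu mu. Proof. by []. Qed.
Lemma keep_tmp_after k j mu mu1 v :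
  keep k mu mu1 -> k <= j -> keep k mu (update mu1 (addr (tmp j) 0) v).
Proof. by move=> km kj; apply: keep_trans km (keep_tmp _ _ kj) _. Qed.
Lemma keep_var_after k x mu mu1 v : keep k mu mu1 -> keep k mu (update mu1 (addr (var x) 0) v).
Proof. by move=> km; apply: keep_trans km (@keep_var k x mu1 v) _. Qed.

Lemma eval_slot mu s : ready mu -> s < S -> mu (addr s 0) <= B ->
  eval W mu (Read (slot0 s)) = Some (mu (addr s 0)).
Proof. by move=> r sS b; apply: eval_read (eval_slot0 r sS) _; have := nW; lia. Qed.

Lemma eval_term rho st mu t : good rho st mu -> tfits K S t ->
  eval W mu (tcomp K t) = Some (tval n rho st t) /\ tval n rho st t <= B.
Proof.
case=> [r inp vs ars [b1 b2]]; have nKW := nW.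
elim: t => [k|x|a t IH|t IH]; rewrite [tfits _ _ _]/= [tval _ _ _ _]/=.
- by move=> kK; split; [apply: eval_const; lia | lia].
- by move=> xS; split=> //; rewrite -vs //; apply: eval_slot => //; rewrite vs.
- case/andP=> aS /IH[et tB]; split=> //; rewrite -ars //.
  by apply: eval_read; [apply: eval_cell | rewrite ars //; apply: leq_ltn_trans (b2 _ _) nKW].
case/IH=> et tB; split; last lia.
rewrite -subn1; apply: eval_sub et _; last lia.
by apply: eval_sub; [apply: eval_n => //; lia | apply: eval_const; lia | lia].
Qed.

Lemma eval_eq mu a b x y : eval W mu a = Some x -> eval W mu b = Some y -> x <= B -> y <= B ->
  eval W mu (eqE a b) = Some (x == y : nat).
Proof.
move=> ea eb xB yB; have h := nW.
have -> : (x == y : nat) = 1 - ((x - y) + (y - x)) by case: eqP => ? /=; lia.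
apply: eval_sub; [apply: eval_const; lia | | lia].
by apply: eval_add; [apply: eval_sub ea eb _ | apply: eval_sub eb ea _ |]; lia.
Qed.

Lemma eval_lt mu a b x y : eval W mu a = Some x -> eval W mu b = Some y -> x <= B -> y <= B ->
  eval W mu (ltE a b) = Some (x < y : nat).
Proof.
move=> ea eb xB yB; have h := nW.
have -> : (x < y : nat) = 1 - (1 - (y - x)) by case: ltnP => ? /=; lia.
by do 2!(apply: eval_sub; [apply: eval_const; lia | | lia]); apply: eval_sub eb ea _; lia.
Qed.

Lemma ffits_tmp f k : ffits K S f k -> tmp k < S.
Proof.
rewrite /tmp; elim: f k => [t u|t u|t u|f IH|f IH g _|x f IH] k /=; try by case/and3P; rewrite /tmp; lia.
- exact: IH.
- by case/andP=> /IH.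
by case/andP=> _ /IH; lia.
Qed.

Hypotheses (mn : m <= n * n).
(** A scan of the edges counts as two nested loops. *)
Lemma m_bound d : m.+1 * n.+1 ^ d <= n.+1 ^ d.+2.
Proof. by rewrite !expnS mulnA leq_mul2r; apply/orP; right; move: mn; nia. Qed.

Hypotheses (edm : size ed = m) (edn : forall p, p \in ed -> (p.1 < n) && (p.2 < n)).
Lemma eval_edge_end i j mu d : ready mu -> tmp j < S -> mu (addr (tmp j) 0) = i ->
  i < m -> d <= 3 -> mu (d + 2 * i) < n ->
  eval W mu (edge_end K d j) = Some (mu (d + 2 * i)).
Proof.
move=> r jS ci im d3 en; have h := HW; have h' := nW.
have ei : eval W mu (Read (slot0 (tmp j))) = Some i.
  by have := eval_read (eval_slot0 r jS); rewrite ci; apply; lia.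
apply: eval_read; last lia.
apply: eval_add; [by apply: eval_const; lia | | lia].
by apply: eval_mul ei _; [apply: eval_const; lia | lia].
Qed.

Lemma adj_sound t u k rho st mu : good rho st mu -> ffits K S (FAdj t u) k ->
  exists2 mu', within (fcomp K (FAdj t u) k) 2 mu mu' &
    [/\ good rho st mu', keep k mu mu' &
       mu' (addr (tmp k) 0) = holds n edge rho st (FAdj t u)].
Proof.
move=> g /and3P[kS tS uS]; have h := HW; have h' := nW; have kS0 : tmp k < S by move: kS; rewrite /tmp; lia.
set x := tval n rho st t; set y := tval n rho st u.
pose hit i := let p := nth (0, 0) ed i in (p.1 == x) && (p.2 == y) || (p.1 == y) && (p.2 == x).
pose P i mu' := [/\ good rho st mu', keep k mu mu', mu' (addr (tmp k) 0) = has hit (iota 0 i) &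
   mu' (addr (tmp k.+1) 0) = i].
set mu0 := update mu (addr (tmp k) 0) 0.
have g0 : good rho st mu0 by apply: good_tmp.
have r0 : ready mu0 by case: g0.
have r : ready mu by case: g.
pose body := If (edge_test K k.+1 (tcomp K t) (tcomp K u)) (Write (slot0 (tmp k)) (Const 1)) Skip.
have mW : m < W by lia.
have [||||mu' hm [g' km' hk _]] := @within_loop (tmp k.+1) m (Read (Const 1)) body 0 2 P mu0 kS mW r0 (m_bound 0).
- by move=> i mu1 _ [[]].
- exact: eval_m.
- move=> i mu1 im [g1 k1 v1 c1].
  have [r1 inp _ _ _] := g1; have [i1 i2] := inp i im.
  have [et tB] := eval_term g1 tS; have [eu uB] := eval_term g1 uS.
  have ni : nth (0, 0) ed i \in ed by rewrite mem_nth ?edm.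
  have /andP[n1 n2] := edn ni; rewrite -i1 in n1; rewrite -i2 in n2.
  have e1 := eval_edge_end r1 kS c1 im (isT : 2 <= 3) n1.
  have e2 := eval_edge_end r1 kS c1 im (isT : 3 <= 3) n2.
  have [b1 b2] : mu1 (2 + 2 * i) <= B /\ mu1 (3 + 2 * i) <= B by lia.
  set a1 := mu1 (2 + 2 * i) in i1 n1 e1 b1; set a2 := mu1 (3 + 2 * i) in i2 n2 e2 b2.
  have small (p q : bool) : (p : nat) * q < W by case: p; case: q; lia.
  have ed_ev : eval W mu1 (edge_test K k.+1 (tcomp K t) (tcomp K u)) =
      Some ((a1 == x) * (a2 == y) + (a1 == y) * (a2 == x)).
    apply: eval_add.
    - by apply: eval_mul (eval_eq e1 et b1 tB) (eval_eq e2 eu b2 uB) (small _ _).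
    - by apply: eval_mul (eval_eq e1 eu b1 uB) (eval_eq e2 et b2 tB) (small _ _).
    - have one (p q : bool) : (p : nat) * q <= 1 by case: p; case: q.
      by apply: leq_ltn_trans (leq_add (one _ _) (one _ _)) _; lia.
  have pos : (0 < (a1 == x) * (a2 == y) + (a1 == y) * (a2 == x)) = hit i.
    rewrite /hit -i1 -i2 addn_gt0 !muln_gt0 !lt0b //.
  have next : has hit (iota 0 i.+1) = has hit (iota 0 i) || hit i.
    by rewrite -addn1 iotaD has_cat /= orbF.
  case hi: (hit i) pos => pos.
    exists (update mu1 (addr (tmp k) 0) 1).
      apply: within_if ed_ev _; rewrite pos; apply: within_write; first exact: eval_slot0.
      by apply: eval_const; lia.
    split; [exact: ready_update | by rewrite update_other // /tmp; lia |].
    split; first by do 2!apply: good_tmp.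
    - by do 2!apply: keep_tmp_after => //.
    - by rewrite next hi orbT update_other ?update_same // /tmp; lia.
    exact: update_same.
  exists mu1.
    by apply: within_if ed_ev _; rewrite pos; apply: within_skip.
  split=> //; split; first exact: good_tmp.
  - exact: keep_tmp_after.
  - by rewrite next hi orbF update_other // /tmp; lia.
  exact: update_same.
- split; first exact: good_tmp.
  + by do 2!apply: keep_tmp_after => //; exact: keep_refl.
  + by rewrite /= update_other ?/mu0 ?update_same // /tmp; lia.
  exact: update_same.
exists mu'; last first.
  split=> //; rewrite hk /= -/x -/y; congr nat_of_bool.
  rewrite /edge -[in RHS](mkseq_nth (0, 0) ed) has_map edm; exact: eq_has.
apply: within_seq _ hm; apply: within_write (eval_slot0 r kS0) _.
by apply: eval_const; lia.
Qed.

Lemma formula_sound f k rho st mu : good rho st mu -> ffits K S f k ->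
  exists2 mu', within (fcomp K f k) (fdepth f) mu mu' &
    [/\ good rho st mu', keep k mu mu' & mu' (addr (tmp k) 0) = holds n edge rho st f].
Proof.
have h' := nW.
have out g d mu0 e v j dd : good g d mu0 -> tmp j < S -> eval W mu0 e = Some v ->
    within (Write (slot0 (tmp j)) e) dd mu0 (update mu0 (addr (tmp j) 0) v).
  by case=> r _ _ _ _ jS; apply: within_write; apply: eval_slot0.
have rd g d mu0 j (b : bool) : good g d mu0 -> tmp j < S -> mu0 (addr (tmp j) 0) = b ->
    eval W mu0 (Read (slot0 (tmp j))) = Some (b : nat).
  case=> r _ _ _ _ jS mb; have := eval_read (eval_slot0 r jS); rewrite mb; apply.
  by case: (b); lia.
have bW (b : bool) : b < W by case: b; lia.
elim: f k rho st mu => [t u|t u|t u|f IH|f IHf g IHg|x f IH] k rho st mu gd fit.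
- have /and3P[kS tS uS] := fit; have [et tB] := eval_term gd tS; have [eu uB] := eval_term gd uS.
  eexists; first by apply: out (eval_eq et eu tB uB) => //; exact: gd.
  by split; [apply: good_tmp | apply: keep_tmp | rewrite update_same].
- have /and3P[kS tS uS] := fit; have [et tB] := eval_term gd tS; have [eu uB] := eval_term gd uS.
  eexists; first by apply: out (eval_lt et eu tB uB) => //; exact: gd.
  by split; [apply: good_tmp | apply: keep_tmp | rewrite update_same].
- exact: adj_sound.
- have kS := ffits_tmp fit; have [mu1 h1 [g1 k1 v1]] := IH k rho st mu gd fit.
  eexists; last first.
    split; last exact: update_same; [exact: good_tmp g1 | exact: keep_tmp_after].
  apply: within_seq h1 (out _ _ _ _ _ _ _ g1 kS _).
  rewrite (_ : (holds _ _ _ _ (FNot f) : nat) = 1 - holds n edge rho st f); last by rewrite /=; case: holds.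
  by apply: eval_sub; [apply: eval_const | apply: rd g1 kS v1 |]; lia.
- have /andP[fS gS] := fit; have kS := ffits_tmp fS; have kS' := ffits_tmp gS.
  have [mu1 h1 [g1 k1 v1]] := IHf k rho st mu gd fS.
  have [mu2 h2 [g2 k2 v2]] := IHg k.+1 rho st mu1 g1 gS.
  eexists; last first.
    split; last exact: update_same; [exact: good_tmp g2 |].
    by apply: keep_tmp_after => //; apply: keep_trans k1 k2 _.
  apply: within_seq (within_le (leq_maxl _ _) h1) _.
  apply: within_seq (within_le (leq_maxr _ _) h2) (out _ _ _ _ _ _ _ g2 kS _).
  rewrite (_ : (holds _ _ _ _ (FAnd f g) : nat) = holds n edge rho st f * holds n edge rho st g).
    apply: eval_mul; [apply: rd g2 kS _; rewrite k2 // | apply: rd g2 kS' v2 |].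
    by case: holds; case: holds; lia.
  by rewrite /=; case: holds; case: holds.
have /andP[xS fS] := fit; have kS2 := ffits_tmp fS.
have [kS kS1] : tmp k < S /\ tmp k.+1 < S by move: kS2; rewrite /tmp; lia.
have [r _ vs _ [rB sB]] := gd.
pose hit v := holds n edge (bind rho x v) st f.
pose mu0 := update mu (addr (tmp k) 0) 0.
pose mu1 := update mu0 (addr (tmp k.+1) 0) (rho x).
pose P i mu' := [/\ good (bind rho x i) st mu', keep k mu mu',
   mu' (addr (tmp k) 0) = has hit (iota 0 i) & mu' (addr (tmp k.+1) 0) = rho x].
have g0 : good rho st mu0 by apply: good_tmp.
have g1 : good rho st mu1 by apply: good_tmp.
have r1 : ready mu1 by case: g1.
pose body := Seq (fcomp K f k.+2) (If (Read (slot0 (tmp k.+2))) (Write (slot0 (tmp k)) (Const 1)) Skip).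
have nW' : n < W by lia.
have [|||||mu' hm [g' km' hk hx]] := @within_loop (var x) n (Read (Const 0)) body (fdepth f) (fdepth f).+1 P mu1 xS nW' r1.
- by rewrite expnS.
- move=> i mu2 _ [[r2 _ vs2 _ _] _ _ _]; split=> //; by rewrite vs2 // /bind eqxx.
- by move=> mu2 r2; apply: eval_n.
- move=> i mu2 im [g2 k2 v2 c2].
  have [mu3 h3 [g3 k3 v3]] := IH _ _ _ _ g2 fS.
  have next : has hit (iota 0 i.+1) = has hit (iota 0 i) || hit i.
    by rewrite -addn1 iotaD has_cat /= orbF.
  have k3' : mu3 (addr (tmp k) 0) = has hit (iota 0 i) by rewrite k3.
  have c3 : mu3 (addr (tmp k.+1) 0) = rho x by rewrite k3.
  have x3 : mu3 (addr (var x) 0) = i by case: g3 => _ _ -> //; rewrite /bind eqxx.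
  have k23 : keep k mu mu3 by apply: keep_trans k2 k3 _; lia.
  have e3 := rd _ _ _ _ _ g3 kS2 v3.
  have iB : i.+1 <= B by lia.
  have gx mu4 : good (bind rho x i) st mu4 -> good (bind rho x i.+1) st (update mu4 (addr (var x) 0) i.+1).
    move=> g4; apply: good_ext (good_var x g4 iB) => y; rewrite /bind; by case: eqP.
  case hi: (holds n edge (bind rho x i) st f) e3 v3 => e3 v3.
    exists (update mu3 (addr (tmp k) 0) 1).
      apply: within_seq h3 (within_if e3 _).
      by apply: out g3 kS _; apply: eval_const; lia.
    split; [by apply: ready_update; case: g3 | by rewrite update_other // /tmp /var; lia |].
    split; first by apply: gx; apply: good_tmp.
    - by apply: keep_var_after; apply: keep_tmp_after.
    - by rewrite next /hit hi orbT update_other ?update_same // /tmp /var; lia.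
    by rewrite !update_other // /tmp /var; lia.
  exists mu3; first by apply: within_seq h3 (within_if e3 _); apply: within_skip.
  split=> //; first by case: g3.
  split; first exact: gx.
  - exact: keep_var_after.
  - by rewrite next /hit hi orbF update_other // /tmp /var; lia.
  by rewrite !update_other // /tmp /var; lia.
- split; first exact: good_var.
  + by apply: keep_var_after; do 2!apply: keep_tmp_after => //; exact: keep_refl.
  + by rewrite /= update_other ?/mu1 ?update_other ?/mu0 ?update_same // /tmp /var; lia.
  by rewrite update_other ?/mu1 ?update_same // /tmp /var; lia.
exists (update mu' (addr (var x) 0) (rho x)).
  have r' : ready mu' by case: g'.
  apply: within_seq (out _ _ _ _ _ _ _ gd kS (eval_const _ _)) _; first lia.
  have vx : eval W mu0 (Read (slot0 (var x))) = Some (rho x).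
    by case: g0 => r0 _ v0 _ _; rewrite -(v0 x xS); apply: eval_slot => //; rewrite v0.
  apply: within_seq (out _ _ _ _ _ _ _ g0 kS1 vx) _.
  apply: within_seq hm (within_write _ _ _); first exact: eval_slot0.
  by rewrite -hx; apply: eval_slot => //; rewrite hx.
split; [exact: good_unbind g' (rB x) | exact: keep_var_after |].
by rewrite update_other //= /tmp /var; lia.
Qed.

Lemma code_sound c k rho st mu : good rho st mu -> cfits K S c k ->
  exists2 mu', within (ccomp K c k) (cdepth c) mu mu' &
    good rho (run n edge c rho st) mu' /\ keep k mu mu'.
Proof.
have h' := nW.
elim: c k rho st mu => [a t u|c IHc d IHd|f c IHc d IHd|x c IH|] k rho st mu gd fit.
- have /and3P[aS tS uS] := fit; have [et tB] := eval_term gd tS; have [eu uB] := eval_term gd uS.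
  have r : ready mu by case: gd.
  eexists; first exact: (within_write _ (eval_cell r aS et tB) eu).
  by split; [apply: good_arr | apply: keep_arr].
- have /andP[cS dS] := fit; have [mu1 h1 [g1 k1]] := IHc k rho st mu gd cS.
  have [mu2 h2 [g2 k2]] := IHd k _ _ mu1 g1 dS.
  exists mu2; last by split=> //; apply: keep_trans k1 k2 _.
  exact: within_seq (within_le (leq_maxl _ _) h1) (within_le (leq_maxr _ _) h2).
- have /and3P[fS cS dS] := fit; have [mu1 h1 [g1 k1 v1]] := formula_sound gd fS.
  have kS := ffits_tmp fS; have r1 : ready mu1 by case: g1.
  have ev : eval W mu1 (Read (slot0 (tmp k))) = Some (holds n edge rho st f : nat).
    by have := eval_read (eval_slot0 r1 kS); rewrite v1; apply; have := HW; case: holds; lia.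
  have [mu2 h2 [g2 k2]] : exists2 mu2, within (if 0 < holds n edge rho st f then ccomp K c k else ccomp K d k) (cdepth (CIf f c d)) mu1 mu2 &
      good rho (run n edge (CIf f c d) rho st) mu2 /\ keep k mu1 mu2.
    rewrite [run _ _ _ _ _]/=; case: holds.
      have [mu2 h2 [g2 k2]] := IHc k rho st mu1 g1 cS; exists mu2 => //.
      by apply: within_le h2; rewrite /= !leq_max leqnn orbT.
    have [mu2 h2 [g2 k2]] := IHd k rho st mu1 g1 dS; exists mu2 => //.
    by apply: within_le h2; rewrite /= !leq_max leqnn !orbT.
  exists mu2; last by split=> //; apply: keep_trans k1 k2 _.
  by apply: within_seq (within_le (leq_maxl _ _) h1) (within_if ev h2).
- have /and3P[xS kS cS] := fit; have [r _ vs _ [rB sB]] := gd.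
  pose step s v := run n edge c (bind rho x v) s.
  pose mu0 := update mu (addr (tmp k) 0) (rho x).
  pose P i mu' := [/\ good (bind rho x i) (foldl step st (iota 0 i)) mu', keep k mu mu'
    & mu' (addr (tmp k) 0) = rho x].
  have g0 : good rho st mu0 by apply: good_tmp.
  have r0 : ready mu0 by case: g0.
  have nW' : n < W by lia.
  have [|||||mu' hm [g' km' hx]] := @within_loop (var x) n (Read (Const 0)) (ccomp K c k.+1) (cdepth c) (cdepth c).+1 P mu0 xS nW' r0.
  + by rewrite expnS.
  + move=> i mu2 _ [[r2 _ vs2 _ _] _ _]; split=> //; by rewrite vs2 // /bind eqxx.
  + by move=> mu2 r2; apply: eval_n.
  + move=> i mu2 im [g2 k2 v2].
    have [mu3 h3 [g3 k3]] := IH _ _ _ _ g2 cS.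
    exists mu3 => //; have x3 : mu3 (addr (var x) 0) = i by case: g3 => _ _ -> //; rewrite /bind eqxx.
    split=> //; first by case: g3.
    have iB : i.+1 <= B by lia.
    split.
    * rewrite -addn1 iotaD foldl_cat /= addn1; apply: good_ext (good_var x g3 iB) => y.
      by rewrite /bind; case: eqP.
    * by apply: keep_var_after; apply: keep_trans k2 k3 _; lia.
    by rewrite update_other ?k3 // /tmp /var; lia.
  + split; first exact: good_var.
      by apply: keep_var_after; apply: keep_tmp_after => //; exact: keep_refl.
    by rewrite update_other ?/mu0 ?update_same // /tmp /var; lia.
  exists (update mu' (addr (var x) 0) (rho x)).
    have r' : ready mu' by case: g'.
    have vx : eval W mu (Read (slot0 (var x))) = Some (rho x).
      by rewrite -(vs x xS); apply: eval_slot => //; rewrite vs.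
    apply: within_seq (within_write _ (eval_slot0 r kS) vx) _.
    apply: within_seq hm (within_write _ _ _); first exact: eval_slot0.
    by rewrite -hx; apply: eval_slot => //; rewrite hx.
  by split; [exact: good_unbind g' (rB x) | exact: keep_var_after].
by exists mu; [apply: within_skip | split].
Qed.

End Machine.

(** * From a program in this language to the theorem *)

(** The cells are filled from the last one downwards. *)
Definition out_index K : expr :=
  Defs.Sub (Defs.Sub (Read (Const 0)) (Const 1)) (Read (slot0 K (var 0))).
Definition output K a : cmd :=
  Seq (count_loop K (var 0) (Defs.Sub (Read (Const 0)) (Const 1))
        (Write (Defs.Sub (Read (Const 0)) (Read (slot0 K (var 0))))
               (Read (cell K (arr a) (out_index K)))))
    (Seq (Write (Const 1) (Read (slot0 K (arr a)))) (Write (Const 0) (Const 1))).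

Section Output.
Variables (n m K S W : nat) (ed : seq (nat * nat)).
Hypothesis (HW : n + (2 * m + 2) + S * (n + K.+1) + K < W).

Local Notation addr := (addr n m K).

(** The numbers [n] and [m] in the cells 0 and 1 are needed to address the array of colours, so these two
    cells are overwritten last.  The other cells of the output lie below all blocks. *)
Lemma output_sound a rho st mu : good n m K S ed rho st mu -> arr a < S ->
  exists2 mu', within n W (output K a) 1 mu mu' &
    mu' 0 = 1 /\ forall v, v < n -> mu' v.+1 = st a v.
Proof.
move=> [r _ _ ars [_ sB]] aS; have nKW := nW HW.
have vS : var 0 < S by rewrite /var; lia.
pose P i mu' := [/\ ready n m mu', mu' (addr (var 0) 0) = i,
   forall v, v <= n -> mu' (addr (arr a) v) = st a v &
   forall v, v < n -> n <= v + i -> mu' v.+1 = st a v].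
have big v s i : v <= n -> (v == addr s i) = false.
  by move=> vn; have := addr_big n m K s i => h; apply/eqP; lia.
have NW : n.-1 < W by lia.
have dd : n.-1.+1 * n.+1 ^ 0 <= n.+1 ^ 1 by rewrite expn0 expn1; lia.
have rd_ctr i mu1 : P i mu1 -> i <= n -> eval W mu1 (Read (slot0 K (var 0))) = Some i.
  by move=> [r1 c1 _ _] iN; have := eval_read (eval_slot0 HW r1 vS); rewrite c1; apply; lia.
have nW' : n < W by lia.
have [||||mu1 h1 [r1 c1 col1 out1]] := @within_loop n m K S W HW (var 0) n.-1
    (Defs.Sub (Read (Const 0)) (Const 1))
    (Write (Defs.Sub (Read (Const 0)) (Read (slot0 K (var 0)))) (Read (cell K (arr a) (out_index K))))
    0 1 P mu vS NW r dd.
- by move=> i mu1 _ [].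
- move=> mu1 r1; rewrite -subn1; apply: (eval_sub HW) => //; first exact: (eval_n HW r1 nW').
  by apply: eval_const; lia.
- move=> i mu1 im P1; have [r1 c1 col1 out1] := P1.
  have ctr := rd_ctr i mu1 P1 ltac:(lia).
  have ei : eval W mu1 (out_index K) = Some (n - 1 - i).
    apply: (eval_sub HW) ctr _; last lia.
    by apply: (eval_sub HW) => //; [exact: (eval_n HW r1 nW') | apply: eval_const; lia].
  have iB : n - 1 - i <= n + K by lia.
  have ev : eval W mu1 (Read (cell K (arr a) (out_index K))) = Some (st a (n - 1 - i)).
    have := eval_read (eval_cell HW r1 aS ei iB); rewrite col1; last lia.
    by apply; apply: leq_ltn_trans (sB _ _) nKW.
  exists (update mu1 (n - i) (st a (n - 1 - i))).
    by apply: within_write ev; apply: (eval_sub HW) ctr _; [exact: (eval_n HW r1 nW') |].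
  have old s j : update mu1 (n - i) (st a (n - 1 - i)) (addr s j) = mu1 (addr s j).
    by rewrite /update eq_sym big //; lia.
  have r2 : ready n m (update mu1 (n - i) (st a (n - 1 - i))).
    by case: r1 => r10 r11; split; rewrite /update ifN //; lia.
  split=> //; first by rewrite old.
  split.
  + exact: (ready_update HW).
  + exact: update_same.
  + move=> v vn; rewrite (update_other HW) ?old ?col1 //; try lia.
    by rewrite /var /arr; lia.
  move=> v vn vi; rewrite {1}/update big //; rewrite /update; case: eqP => h; first by congr st; lia.
  by apply: out1; lia.
- split; [exact: (ready_update HW) | exact: update_same | |] => v vn; last lia.
  by rewrite (update_other HW) ?ars //; try lia; rewrite /var /arr; lia.
have ev : eval W mu1 (Read (slot0 K (arr a))) = Some (st a 0).
  have := eval_read (eval_slot0 HW r1 aS); rewrite col1 //.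
  by apply; apply: leq_ltn_trans (sB _ _) nKW.
exists (update (update mu1 1 (st a 0)) 0 1).
  apply: within_seq h1 (within_seq (within_write _ _ _ ev) (within_write _ _ _ _)); apply: eval_const; lia.
split=> // v vn; rewrite /update /=; case: eqP => [[->] //|v0].
by apply: out1; lia.
Qed.
End Output.

Section Realization.
Variables (p : code) (a d K S : nat).
Hypotheses (fit : cfits K S p 0) (aS : arr a < S) (dp : cdepth p <= d.+1).
Hypothesis correct : forall n (e : rel 'I_n) adj, simple_graph e -> class_G 10 7 e ->
  (forall u v : 'I_n, adj (val u) (val v) = e u v) ->
  coloring 3 e (fun v => run n adj p (fun=> 0) (fun _ _ => 0) a v).

(** The largest address is at most a constant times (n + 2)^2, and a constant is less than 2 to its
    power. *)
Lemma word_bound n m : m <= n * n ->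
  n + (2 * m + 2) + S * (n + K.+1) + K < (n + 2) ^ (S * K.+1 + K + 2 + 2).
Proof.
move=> mn; rewrite expnD; set c := S * K.+1 + K + 2.
have h : c < (n + 2) ^ c by apply: leq_trans (ltn_expl c (isT : 1 < 2)) _; rewrite leq_exp2r; rewrite /c; lia.
apply: leq_ltn_trans (_ : _ <= c * (n + 2) ^ 2) _; last by rewrite ltn_pmul2r // expn_gt0 addn2.
rewrite /c -mulnn; nia.
Qed.

Lemma time_bound w n x : w * n.+1 ^ d.+1 <= w * 2 ^ d.+1 * (n ^ d * (n + x) + 1).
Proof.
rewrite -mulnA leq_mul2l; apply/orP; right; case: n => [|n].
  by rewrite exp1n -[1]muln1 leq_mul ?expn_gt0 ?addn1.
apply: leq_trans (_ : (2 * n.+1) ^ d.+1 <= _); first by rewrite leq_exp2r //; lia.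
rewrite expnMn leq_mul2l; apply/orP; right.
by rewrite expnSr; apply: leq_trans (leq_addr _ _); rewrite leq_mul2l leq_addr orbT.
Qed.

Lemma input_memory_edge n (s : seq ('I_n * 'I_n)) j (p0 : nat * nat) : j < size s ->
  input_memory s (2 + 2 * j) = (nth p0 [seq (val q.1, val q.2) | q <- s] j).1 /\
  input_memory s (3 + 2 * j) = (nth p0 [seq (val q.1, val q.2) | q <- s] j).2.
Proof.
rewrite /input_memory !(addSn, add0n) /=; elim: s j => // q s IH [|j] js; first by split.
by rewrite mulnS !(addSn, add0n); apply: IH.
Qed.

Lemma input_good n (s : seq ('I_n * 'I_n)) :
  good n (size s) K S [seq (val q.1, val q.2) | q <- s] (fun=> 0) (fun _ _ => 0) (input_memory s).
Proof.
have z t i : input_memory s (addr n (size s) K t i) = 0.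
  rewrite /input_memory nth_default // /= size_flatten /shape -map_comp.
  rewrite (_ : sumn _ = 2 * size s); last by elim: s => //= q s ->; lia.
  by have := addr_big n (size s) K t i; lia.
by split=> // j js; apply: input_memory_edge.
Qed.

Lemma edge_list_size n (e : rel 'I_n) s : edge_list e s -> #|edge_set e| = size s.
Proof. by move/perm_size; rewrite size_map -cardE. Qed.

Lemma edge_count n (e : rel 'I_n) s : edge_list e s -> size s <= n * n.
Proof.
move/edge_list_size<-; apply: leq_trans (leq_imset_card _ _) _.
by apply: leq_trans (max_card _) _; rewrite card_prod card_ord.
Qed.

Lemma edge_list_adj n (e : rel 'I_n) s : simple_graph e -> edge_list e s -> forall u v : 'I_n,
  edge [seq (val q.1, val q.2) | q <- s] (val u) (val v) = e u v.
Proof.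
move=> [es ei] /perm_mem es_mem u v; rewrite /edge has_map.
have key : ([set u; v] \in [seq [set q.1; q.2] | q <- s]) = e u v.
  rewrite es_mem mem_enum; apply/imsetP/idP => [[[x y]]|uv]; last by exists (u, v) => //; rewrite inE.
  rewrite inE /= => xy eq; have nxy : x != y by apply: contraTneq xy => ->; rewrite ei.
  have := set22 u v; have := set21 u v; rewrite eq !inE.
  case/orP=> /eqP eu /orP[]/eqP ev; subst u v => //; [|by rewrite es|].
    by have := set22 x y; rewrite -eq !inE orbb => /eqP h; rewrite h eqxx in nxy.
  by have := set21 x y; rewrite -eq !inE orbb => /eqP h; rewrite h eqxx in nxy.
rewrite -key; apply/hasP/mapP => -[[x y] xys].
  rewrite /= => h; exists (x, y) => //=; case/orP: h => /andP[/eqP/val_inj-> /eqP/val_inj->] //.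
  exact: setUC.
move=> /= eq; exists (x, y) => //=; have := set22 u v; have := set21 u v; rewrite eq !inE.
have := set22 x y; have := set21 x y; rewrite -eq !inE.
rewrite !val_eqE !(eq_sym x) !(eq_sym y).
by case: (u == x); case: (u == y); case: (v == x); case: (v == y).
Qed.

Lemma realization : exists (P : cmd) (c k : nat),
  forall (n : nat) (e : rel 'I_n) (s : seq ('I_n * 'I_n)),
    simple_graph e -> class_G 10 7 e -> edge_list e s ->
    exists (t : nat) (mu : memory),
      [/\ exec ((n + 2) ^ c) P (input_memory s) t mu,
          t <= k * (n ^ d * (n + #|edge_set e|) + 1)
        & correct_output 3 e mu].
Proof.
exists (Seq (ccomp K p 0) (output K a)), (S * K.+1 + K + 2 + 2),
  (weight (Seq (ccomp K p 0) (output K a)) * 2 ^ d.+1).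
move=> n e s Ge Ce el; have mn := edge_count el.
have HW := word_bound mn; set W := _ ^ _ in HW *.
set ed := [seq (val q.1, val q.2) | q <- s].
have edm : size ed = size s by rewrite size_map.
have edn q : q \in ed -> (q.1 < n) && (q.2 < n) by case/mapP => x _ ->; rewrite /= !ltn_ord.
have [mu1 h1 [g1 _]] := code_sound HW mn edm edn (input_good s) fit.
have [mu2 h2 [o0 o1]] := output_sound HW g1 aS.
have [t ht le] := within_seq (within_le dp h1) (within_le (isT : 1 <= d.+1) h2).
exists t, mu2; split=> //; first exact: leq_trans le (time_bound _ _ _).
left; split=> //.
have [c1 c2] := correct Ge Ce (edge_list_adj Ge el).
split=> [v|u v uv]; first by rewrite o1 ?ltn_ord.
by rewrite !o1 ?ltn_ord //; apply: c2.
Qed.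
End Realization.

(** * The algorithm *)

(** The arrays: colours, where 0 means none; marks of deleted vertices; rounds of their deletion.  The
    variables 0, ..., 6 run over the tuples of vertices, 7 is the vertex that is being treated, and
    8, 9, 10 are bound in formulas; 9, 10, 11 also count outer loops. *)
Definition COL := 0.
Definition DEL := 1.
Definition ORD := 2.

Definition FTrue := FEq (TC 0) (TC 0).
Definition FOr f g := FNot (FAnd (FNot f) (FNot g)).
Definition FImp f g := FNot (FAnd f (FNot g)).
Definition FAll x f := FNot (FEx x (FNot f)).
Definition FConj fs := foldr FAnd FTrue fs.
Definition adjacent x y := FAdj (TV x) (TV y).
Definition is_alive x := FEq (TA DEL (TV x)) (TC 0).
Definition has_colour x c := FEq (TA COL (TV x)) (TC c).
Definition same x y := FEq (TV x) (TV y).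
Definition when f c := CIf f c CSkip.
Definition paint_with x k := CSet COL (TV x) (TC k).

Definition is_dominated := FEx 8 (FConj [:: is_alive 8; FNot (same 8 7);
  FAll 9 (FImp (FAnd (is_alive 9) (adjacent 7 9)) (adjacent 8 9))]).
Definition has_low_degree := FEx 8 (FEx 9
  (FAll 10 (FImp (FAnd (is_alive 10) (adjacent 7 10)) (FOr (same 10 8) (same 10 9))))).
Definition is_reducible := FOr is_dominated has_low_degree.
(** At most one vertex is deleted in each round, so that rounds order the deleted vertices. *)
Definition round_used := FEx 8 (FAnd (FNot (is_alive 8)) (FEq (TA ORD (TV 8)) (TV 11))).
Definition deletion_round := CFor 7
  (when (FConj [:: is_alive 7; is_reducible; FNot round_used])
    (CSeq (CSet DEL (TV 7) (TC 1)) (CSet ORD (TV 7) (TV 11)))).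
Definition reduction := CFor 11 deletion_round.

Definition is_free c := FNot (FEx 8 (FAnd (adjacent 7 8) (has_colour 8 c))).
Definition greedy := CIf (is_free 1) (paint_with 7 1) (CIf (is_free 2) (paint_with 7 2) (paint_with 7 3)).
Definition uncoloured_alive x := FAnd (is_alive x) (has_colour x 0).
(** Serves twice: to complete the colouring around a cycle, and to spread colours through a bipartite
    component. *)
Definition sweep := CFor 7 (when
  (FAnd (uncoloured_alive 7) (FEx 8 (FAnd (adjacent 7 8) (FNot (has_colour 8 0))))) greedy).

Definition is_type x t := FConj
  ([seq adjacent x i | i <- on_cycle t] ++ [seq FNot (adjacent x i) | i <- off_cycle t]).
Definition is_cycle := FConj [seq (if cycle_adj 7 p.1 p.2 then adjacent p.1 p.2 else FNot (adjacent p.1 p.2))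
  | p <- [seq (i, j) | i <- iota 0 7, j <- iota 0 7]].
Definition sees_type t := FEx 8 (FConj [:: is_alive 8; adjacent 7 8; is_type 8 t]).
Definition sees_only t := FAll 8 (FImp (FAnd (is_alive 8) (adjacent 8 7)) (FOr (is_type 8 t) (is_type 8 14))).
Definition is_labelled (p : nat * nat) :=
  if p.1 == 14 then sees_only 14 else
  FAnd (sees_type p.1) (if p.2 == 14 then sees_only p.1 else sees_type p.2).
Definition labels : seq (nat * nat) :=
  (14, 14) :: [seq (a, 14) | a <- iota 0 14] ++
  [seq p <- [seq (a, b) | a <- iota 0 14, b <- iota 0 14] | p.1 != p.2].
(** The cases need not exclude each other; the last one that applies decides. *)
Definition switch (I : Type) (F : I -> formula) (k : I -> nat) (l : seq I) :=
  foldr (fun i c => CSeq (when (F i) (paint_with 7 (k i))) c) CSkip l.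
Definition near_switch := switch (is_type 7) type_colour (iota 0 14).
Definition far_switch :=
  switch (fun p => FAnd (is_type 7 14) (is_labelled p)) (fun p => far_colour p.1 p.2) labels.
Definition paint := CFor 7 (when (uncoloured_alive 7) (CSeq near_switch far_switch)).
(** The tuple is an induced seven-cycle, not yet coloured, for which L_6 is empty.  Trying all tuples
    includes trying all rotations of a cycle. *)
Definition good_cycle := FAnd (FConj [seq is_alive i | i <- iota 0 7])
  (FAnd (has_colour 0 0) (FAnd is_cycle (FAll 7 (FImp (is_alive 7) (FNot (is_type 7 13)))))).
Definition nest xs c := foldr CFor c xs.
Definition cycle_phase := nest (iota 0 7) (when good_cycle (CSeq paint sweep)).

Definition bipartite_phase := CFor 9 (when (uncoloured_alive 9)
  (CSeq (paint_with 9 1) (CFor 10 sweep))).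
Definition reinsertion_round := CFor 7
  (when (FAnd (FNot (is_alive 7)) (FEq (TA ORD (TV 7)) (TR (TV 9)))) greedy).
(** Rounds are undone in the reverse order. *)
Definition reinsertion := CFor 9 reinsertion_round.
Definition program := CSeq reduction (CSeq cycle_phase (CSeq bipartite_phase reinsertion)).

Lemma program_fits : cfits 3 400 program 0 && (arr COL < 400).
Proof. by vm_cast_no_check (erefl true). Qed.
(** The depth is the exponent in the bound on the running time. *)
Lemma program_depth : cdepth program <= 22.
Proof. by vm_cast_no_check (erefl true). Qed.

Lemma eq_foldl A B (F G : A -> B -> A) a l : (forall a b, F a b = G a b) ->
  foldl F a l = foldl G a l.
Proof. by move=> FG; elim: l a => //= b l IH a; rewrite FG. Qed.

Section Semantics.
Variables (n : nat) (e : rel 'I_n) (adj : nat -> nat -> bool).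
Hypothesis adjE : forall u v : 'I_n, adj (val u) (val v) = e u v.
Implicit Types (st : store) (rho : nat -> nat) (u v w : 'I_n).
Local Notation holds := (holds n adj).
Local Notation run := (run n adj).

Definition alive st : pred 'I_n := fun v => st DEL v == 0.
Definition col st v := st COL v.

Lemma holds_ex rho st x f : holds rho st (FEx x f) = [exists v : 'I_n, holds (bind rho x v) st f].
Proof.
rewrite /= -val_enum_ord has_map; apply/hasP/existsP => [[v _ h]|[v h]]; first by exists v.
by exists v => //; rewrite mem_enum.
Qed.

Lemma holds_not rho st f : holds rho st (FNot f) = ~~ holds rho st f.
Proof. by []. Qed.
Lemma holds_and rho st f g : holds rho st (FAnd f g) = holds rho st f && holds rho st g.
Proof. by []. Qed.
Lemma holds_all rho st x f : holds rho st (FAll x f) = [forall v : 'I_n, holds (bind rho x v) st f].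
Proof. by rewrite holds_not holds_ex negb_exists; apply: eq_forallb => v; rewrite holds_not negbK. Qed.
Lemma holds_imp rho st f g : holds rho st (FImp f g) = (holds rho st f ==> holds rho st g).
Proof. by rewrite !(holds_not, holds_and) negb_and negbK implybE. Qed.
Lemma holds_or rho st f g : holds rho st (FOr f g) = holds rho st f || holds rho st g.
Proof. by rewrite !(holds_not, holds_and) negb_and !negbK. Qed.
Lemma holds_conj rho st fs : holds rho st (FConj fs) = all (holds rho st) fs.
Proof. by elim: fs => //= f fs <-. Qed.
Lemma all_cons T (P : pred T) x s : all P (x :: s) = P x && all P s. Proof. by []. Qed.
Lemma all_nil T (P : pred T) : all P [::] = true. Proof. by []. Qed.
Lemma holds_alive rho st x v : rho x = v -> holds rho st (is_alive x) = alive st v.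
Proof. by rewrite /= => ->. Qed.
Lemma holds_adjacent rho st x y u v : rho x = u -> rho y = v ->
  holds rho st (adjacent x y) = e u v.
Proof. by move=> rx ry; rewrite /= rx ry adjE. Qed.
Lemma holds_same rho st x y u v : rho x = u -> rho y = v -> holds rho st (same x y) = (u == v).
Proof. by rewrite /= => -> ->. Qed.
Lemma holds_colour rho st x c v : rho x = v -> holds rho st (has_colour x c) = (col st v == c).
Proof. by rewrite /= => ->. Qed.

Lemma run_for rho st x c : run (CFor x c) rho st =
  foldl (fun s v => run c (bind rho x v) s) st (enum 'I_n).
Proof.
rewrite /= -val_enum_ord; elim: (enum 'I_n) st => //= v l IH st; exact: IH.
Qed.

Definition reducible_in (B : pred 'I_n) u :=
  [exists v, [&& B v, v != u & [forall w, B w && e u w ==> e v w]]] ||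
  [exists a, exists b, forall w, B w && e u w ==> (w == a) || (w == b)].

Lemma holds_reducible rho st u : rho 7 = u -> holds rho st is_reducible = reducible_in (alive st) u.
Proof.
move=> ru; rewrite holds_or; congr (_ || _).
  rewrite holds_ex; apply: eq_existsb => v; rewrite holds_conj !all_cons all_nil andbT holds_not.
  rewrite (@holds_alive _ _ _ v) // (@holds_same _ _ _ _ v u) // holds_all.
  congr [&& _, _ & _]; apply: eq_forallb => w; rewrite holds_imp holds_and.
  by rewrite (@holds_alive _ _ _ w) // (@holds_adjacent _ _ _ _ u w) // (@holds_adjacent _ _ _ _ v w).
rewrite holds_ex; apply: eq_existsb => a; rewrite holds_ex; apply: eq_existsb => b.
rewrite holds_all; apply: eq_forallb => w; rewrite holds_imp holds_or holds_and.
by rewrite (@holds_alive _ _ _ w) // (@holds_adjacent _ _ _ _ u w) // (@holds_same _ _ _ _ w a) // (@holds_same _ _ _ _ w b).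
Qed.

Definition free st v c := [forall w, e v w ==> (col st w != c)].
Definition pick_colour st v := if free st v 1 then 1 else if free st v 2 then 2 else 3.
Definition pending st v := [&& alive st v, col st v == 0 & [exists w, e v w && (col st w != 0)]].
Definition sweep_step st v :=
  if pending st v then assign st COL v (pick_colour st v) else st.

Lemma holds_free rho st v c : rho 7 = v -> holds rho st (is_free c) = free st v c.
Proof.
move=> rv; rewrite holds_not holds_ex negb_exists; apply: eq_forallb => w.
by rewrite holds_and (@holds_adjacent _ _ _ _ v w) // (@holds_colour _ _ _ _ w) // negb_and implybE.
Qed.

Lemma run_if rho st f c d : run (CIf f c d) rho st = if holds rho st f then run c rho st else run d rho st.
Proof. by []. Qed.

Lemma run_paint_with rho st x v c : rho x = v -> run (paint_with x c) rho st = assign st COL v c.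
Proof. by rewrite /= => ->. Qed.

Lemma run_greedy rho st v : rho 7 = v -> run greedy rho st = assign st COL v (pick_colour st v).
Proof.
move=> rv; rewrite !run_if !(@holds_free _ _ v) // !(@run_paint_with _ _ _ v) //.
by rewrite /pick_colour; case: free => //; case: free.
Qed.

Lemma run_sweep rho st : run sweep rho st = foldl sweep_step st (enum 'I_n).
Proof.
rewrite run_for; apply: eq_foldl => {}st v; rewrite run_if !holds_and (@holds_alive _ _ _ v) // (@holds_colour _ _ _ _ v) // holds_ex.
rewrite (@run_greedy _ _ v) // /sweep_step /pending -andbA; congr (if [&& _, _ & _] then _ else _).
apply: eq_existsb => w; rewrite holds_and holds_not.
by rewrite (@holds_adjacent _ _ _ _ v w) // (@holds_colour _ _ _ _ w).
Qed.

Section Around.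
Variable f : nat -> 'I_n.
Definition tuned rho := forall i, i < 7 -> rho i = f i.

Lemma tuned_bind rho x v : 7 <= x -> tuned rho -> tuned (bind rho x v).
Proof. by move=> x7 tr i i7; rewrite /bind; case: eqP => [ix|_]; [lia | apply: tr]. Qed.

Lemma holds_type rho st x w t : tuned rho -> rho x = w -> t < 15 ->
  holds rho st (is_type x t) = has_type e f w t.
Proof.
move=> tr rx t15; rewrite holds_conj all_cat !all_map; congr (_ && _); apply: eq_in_all => i.
  by move/(on_cycle_lt t15) => i7; apply: (@holds_adjacent _ _ _ _ w (f i)) => //; rewrite tr.
move/off_cycle_lt => i7; congr (~~ _).
by apply: (@holds_adjacent _ _ _ _ w (f i)) => //; rewrite tr.
Qed.

Definition sees st w t := [exists x, [&& alive st x, e w x & has_type e f x t]].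
Definition only st w t :=
  [forall x, alive st x && e x w ==> has_type e f x t || has_type e f x 14].
Definition labelled_by st w (p : nat * nat) :=
  if p.1 == 14 then only st w 14 else sees st w p.1 && (if p.2 == 14 then only st w p.1 else sees st w p.2).

Lemma holds_sees rho st w t : tuned rho -> rho 7 = w -> t < 15 -> holds rho st (sees_type t) = sees st w t.
Proof.
move=> tr r7 t15; rewrite holds_ex; apply: eq_existsb => x; rewrite holds_conj !all_cons all_nil andbT.
rewrite (@holds_alive _ _ _ x) // (@holds_adjacent _ _ _ _ w x) // (@holds_type _ _ _ x) //.
exact: tuned_bind.
Qed.

Lemma holds_only rho st w t : tuned rho -> rho 7 = w -> t < 15 -> holds rho st (sees_only t) = only st w t.
Proof.
move=> tr r7 t15; rewrite holds_all; apply: eq_forallb => x; rewrite holds_imp holds_and holds_or.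
rewrite (@holds_alive _ _ _ x) // (@holds_adjacent _ _ _ _ x w) //.
by rewrite !(@holds_type _ _ _ x) //; exact: tuned_bind.
Qed.

Lemma labels_lt p : p \in labels ->
  [/\ p.1 < 15, p.2 < 15, p.1 = 14 -> p.2 = 14 & p.1 <> 14 -> p.1 != p.2].
Proof.
have /allP h : all (fun p => [&& p.1 < 15, p.2 < 15, (p.1 == 14) ==> (p.2 == 14) &
  (p.1 != 14) ==> (p.1 != p.2)]) labels by vm_compute.
by move/h/and4P=> [-> -> /implyP i /implyP j]; split=> // [/eqP/i/eqP|/eqP/j].
Qed.

Lemma holds_labelled rho st w p : tuned rho -> rho 7 = w -> p \in labels ->
  holds rho st (is_labelled p) = labelled_by st w p.
Proof.
move=> tr r7 /labels_lt[p1 p2 _ _]; rewrite /is_labelled /labelled_by; case: eqP => _.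
  exact: holds_only.
rewrite holds_and (holds_sees _ tr r7 p1); congr (_ && _); case: eqP => _; first exact: holds_only.
exact: holds_sees.
Qed.

Definition same_deletions st st' := st' DEL =1 st DEL /\ st' ORD =1 st ORD.

Lemma switchP (I : eqType) (F : I -> formula) k (P : pred I) l rho st v : rho 7 = v ->
  (forall st' i, st' DEL =1 st DEL -> i \in l -> holds rho st' (F i) = P i) ->
  let st' := run (switch F k l) rho st in
  [/\ same_deletions st st', forall u, u != v -> col st' u = col st u &
      (~~ has P l /\ col st' v = col st v) \/
      exists2 i, i \in l & P i /\ col st' v = k i].
Proof.
move=> r7; elim: l st => [|i l IH] st FP; first by split=> //; left.
rewrite [switch _ _ _]/= -/(switch F k l) -[run _ _ _]/(run (switch F k l) rho (run (when (F i) (paint_with 7 (k i))) rho st)).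
rewrite /when run_if (FP st i) ?mem_head // (@run_paint_with _ _ _ v) //.
have FPl st1 : st1 DEL =1 st DEL -> forall st' j, st' DEL =1 st1 DEL -> j \in l -> holds rho st' (F j) = P j.
  by move=> d1 st' j d jl; apply: FP; rewrite ?inE ?jl ?orbT // => u; rewrite d d1.
case Pi: (P i); last first.
  have [[d o] c k'] := IH st (FPl st (fun=> erefl)); split=> //.
  case: k' => [[np cv]|[j jl Pj]]; first by left; rewrite /= Pi.
  by right; exists j => //; rewrite inE jl orbT.
have [[d o] c k'] := IH (assign st COL v (k i)) (FPl (assign st COL v (k i)) (fun=> erefl)).
split=> //.
  move=> u uv; rewrite c // /col /assign (_ : (val u == v) = false) ?andbF //; exact: negbTE.
right; case: k' => [[np cv]|[j jl Pj]]; last by exists j => //; rewrite inE jl orbT.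
by exists i; rewrite ?mem_head // Pi cv /col /assign !eqxx.
Qed.

End Around.

Lemma foldl_all (A : Type) (I : A -> Prop) (P : 'I_n -> A -> Prop) (F : A -> 'I_n -> A) a :
  (forall s v, I s -> I (F s v) /\ P v (F s v)) ->
  (forall s u v, I s -> P u s -> P u (F s v)) -> I a ->
  I (foldl F a (enum 'I_n)) /\ forall v, P v (foldl F a (enum 'I_n)).
Proof.
move=> h1 h2 Ia; suff : forall l a, I a -> I (foldl F a l) /\
   forall v, v \in l \/ P v a -> P v (foldl F a l).
  case/(_ (enum 'I_n) a Ia) => I' P'; split=> // v; apply: P'; left; exact: mem_enum.
elim=> [|x l IH] b Ib /=; first by split=> // v [].
have [IF PF] := h1 b x Ib; have [I' P'] := IH _ IF; split=> // v [|Pv].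
  by rewrite inE => /orP[/eqP->|vl]; apply: P'; [right | left].
by apply: P'; right; apply: h2.
Qed.

Definition binds rho xs (vs : seq 'I_n) := foldl (fun r p => bind r p.1 (val p.2)) rho (zip xs vs).

Lemma foldl_inv (A B : Type) (J : A -> Prop) (F : A -> B -> A) l a :
  (forall s (x : B), J s -> J (F s x)) -> J a -> J (foldl F a l).
Proof. by move=> h; elim: l a => //= x l IH a Ja; apply: IH; apply: h. Qed.

Lemma nest_inv (J : store -> Prop) c xs rho st :
  (forall s vs, size vs = size xs -> J s -> J (run c (binds rho xs vs) s)) ->
  J st -> J (run (nest xs c) rho st).
Proof.
elim: xs rho st => [|x xs IH] rho st h Jst; first exact: (h st [::]).
rewrite [nest _ _]/= run_for; apply: foldl_inv Jst => st' v J'; apply: IH J' => s vs vss Js.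
by apply: (h s (v :: vs)) => //=; rewrite vss.
Qed.

(** What the body achieves for the tuple [vs0] is kept by all later iterations. *)
Lemma nest_done (I P : store -> Prop) c xs rho st vs0 : size vs0 = size xs ->
  (forall s vs, size vs = size xs -> I s -> I (run c (binds rho xs vs) s)) ->
  (forall s, I s -> P (run c (binds rho xs vs0) s)) ->
  (forall s vs, size vs = size xs -> I s -> P s -> P (run c (binds rho xs vs) s)) ->
  I st -> P (run (nest xs c) rho st).
Proof.
elim: xs vs0 rho st => [|x xs IH] [|v0 vs0] // rho st vs0s hI hv hP Ist; first exact: hv.
case: vs0s => vs0s; rewrite -[nest _ _]/(CFor x (nest xs c)) run_for.
have keepI v s : I s -> I (run (nest xs c) (bind rho x (val v)) s).
  by apply: nest_inv => s' vs vss; apply: (hI s' (v :: vs)); rewrite /= vss.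
have keepP v s : I s /\ P s -> I (run (nest xs c) (bind rho x (val v)) s) /\
  P (run (nest xs c) (bind rho x (val v)) s).
  apply: (nest_inv (J := fun s => I s /\ P s)) => s' vs vss [Is Ps]; split.
    by apply: (hI s' (v :: vs)); rewrite /= ?vss.
  by apply: (hP s' (v :: vs)); rewrite /= ?vss.
have /path.splitPr[l1 l2] : v0 \in enum 'I_n by rewrite mem_enum.
rewrite foldl_cat; set s1 := foldl _ _ l1.
have Is1 : I s1 by apply: (foldl_inv (J := I)) Ist => s v; apply: keepI.
pose F s v := run (nest xs c) (bind rho x (val v)) s.
suff [] : I (foldl F (F s1 v0) l2) /\ P (foldl F (F s1 v0) l2) by [].
apply: (foldl_inv (J := fun s => I s /\ P s)) => [s v|]; first exact: keepP.
split; first exact: keepI.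
apply: (IH vs0) Is1 => // s vs vss; first by apply: (hI s (v0 :: vs)); rewrite /= vss.
by apply: (hP s (v0 :: vs)); rewrite /= vss.
Qed.

Lemma binds_tuned rho (f : nat -> 'I_n) :
  tuned f (binds rho (iota 0 7) [seq f i | i <- iota 0 7]).
Proof. by move=> i; do 7?[case: i => [|i] //]. Qed.

Lemma tuned_binds rho vs : size vs = 7 -> exists2 f, vs = [seq f i | i <- iota 0 7] &
  tuned f (binds rho (iota 0 7) vs).
Proof.
case: vs => // v vs vss; exists (fun i => nth v (v :: vs) i).
  by case: vs vss => [|? [|? [|? [|? [|? [|? []]]]]]].
rewrite (_ : v :: vs = [seq nth v (v :: vs) i | i <- iota 0 7]); first exact: binds_tuned.
by case: vs vss => [|? [|? [|? [|? [|? [|? []]]]]]].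
Qed.

Definition begins_cycle f st := [/\ cyc e f, forall i, i < 7 -> alive st (f i),
  col st (f 0) = 0 & forall w, alive st w -> ~~ has_type e f w 13].

Lemma holds_good_cycle f rho st : tuned f rho ->
  reflect (begins_cycle f st) (holds rho st good_cycle).
Proof.
move=> tr; rewrite holds_and holds_conj holds_and holds_and.
have t0 := tr 0 isT.
rewrite (@holds_colour _ _ _ _ (f 0)) // holds_all.
have -> : holds rho st is_cycle = all (fun p => e (f p.1) (f p.2) == cycle_adj 7 p.1 p.2)
    [seq (i, j) | i <- iota 0 7, j <- iota 0 7].
  rewrite holds_conj all_map; apply: eq_in_all => p /allpairsP[[i j] [iI jI ->]].
  have [i7 j7] : i < 7 /\ j < 7 by move: iI jI; rewrite !mem_iota => /andP[_ i7] /andP[_ j7].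
  rewrite [preim _ _ _]/= -/(holds rho st _) [fst _]/= [snd _]/=.
  have aE : holds rho st (adjacent i j) = e (f i) (f j).
    by apply: holds_adjacent; apply: tr.
  by case: cycle_adj; rewrite ?holds_not aE; case: e.
have -> : all (holds rho st) [seq is_alive i | i <- iota 0 7] = all (fun i => alive st (f i)) (iota 0 7).
  rewrite all_map; apply: eq_in_all => i; rewrite mem_iota => i7; apply: holds_alive; exact: tr.
have -> : [forall v : 'I_n, holds (bind rho 7 v) st (FImp (is_alive 7) (FNot (is_type 7 13)))] =
          [forall w, alive st w ==> ~~ has_type e f w 13].
  apply: eq_forallb => w; rewrite holds_imp holds_not (@holds_alive _ _ _ w) //.
  by rewrite (@holds_type f _ _ _ w) //; apply: tuned_bind.
apply: (iffP and4P) => [[/allP h1 /eqP h2 /allP h3 /forallP h4]|[h3 h1 h2 h4]].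
  split=> //.
  - by move=> i j i7 j7; apply/eqP; apply: (h3 (i, j)); apply: allpairs_f; rewrite mem_iota.
  - by move=> i i7; apply: h1; rewrite mem_iota.
  by move=> w; apply/implyP.
split; [|exact/eqP| |].
- by apply/allP => i; rewrite mem_iota; apply: h1.
- by apply/allP => p /allpairsP[[i j] [iI jI ->]]; move: iI jI; rewrite !mem_iota => /andP[_ i7] /andP[_ j7];
  rewrite h3.
by apply/forallP => w; apply/implyP/h4.
Qed.
End Semantics.

(** * Colouring the irreducible part *)

Lemma labels_all : all (fun a => all (fun b => (a == b) || ((a, b) \in labels)) (iota 0 15)) (iota 0 14).
Proof. by vm_cast_no_check (erefl true). Qed.
Lemma mem_labels_none : (14, 14) \in labels.
Proof. by vm_cast_no_check (erefl true). Qed.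
Lemma nth_le3 s i : all (fun k => k <= 3) s -> nth 0 s i <= 3.
Proof.
move=> h; case: (ltnP i (size s)) => [l|l]; last by rewrite nth_default.
exact: (allP h) _ (mem_nth 0 l).
Qed.
Lemma far_colour_le3 a b : far_colour a b <= 3.
Proof. by rewrite /far_colour; case: eqP => _; apply: nth_le3. Qed.
Lemma type_colour_le3 t : type_colour t <= 3.
Proof. exact: nth_le3. Qed.
Lemma colour_le3 (T : finType) (e : rel T) f lab v : colour e f lab v <= 3.
Proof. rewrite /colour; case: (has_type e f v 14); [exact: far_colour_le3 | exact: type_colour_le3]. Qed.
Lemma has_type_eq (T : finType) (e : rel T) f g w t : (forall i, i < 7 -> f i = g i) ->
  t < 15 -> has_type e f w t = has_type e g w t.
Proof.
move=> fg t15; rewrite /has_type; congr (_ && _); apply: eq_in_all => i.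
  by move/(on_cycle_lt t15)/fg->.
by move/off_cycle_lt/fg->.
Qed.
Lemma far_type (T : finType) (e : rel T) f w i : i < 7 -> has_type e f w 14 -> ~~ e w (f i).
Proof. by move=> i7 /andP[_ /allP]; apply; rewrite mem_off_cycle. Qed.
Opaque labels far_colour type_colour type_of has_type.

Lemma mem_labels a b : a < 14 -> b <= 14 -> a != b -> (a, b) \in labels.
Proof.
move=> a14 b14 /negbTE ab.
have aI : a \in iota 0 14 by rewrite mem_iota a14.
have bI : b \in iota 0 15 by rewrite mem_iota ltnS b14.
have := allP2 labels_all aI bI; rewrite ab orFb; exact: id.
Qed.

Section Phases.
Variables (n : nat) (e : rel 'I_n) (adj : nat -> nat -> bool).
Hypotheses (Gsimple : simple_graph e) (Gclass : class_G 10 7 e).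
Hypothesis adjE : forall u v : 'I_n, adj (val u) (val v) = e u v.
Implicit Types (st : store) (rho : nat -> nat) (u v w : 'I_n).
Local Notation run := (run n adj).
Local Notation holds := (holds n adj).

Let es : symmetric e. Proof. by case: Gsimple. Qed.

Lemma labelled_by_two f st w a b : (a == 14) = false -> (b == 14) = false ->
  labelled_by e f st w (a, b) = sees e f st w a && sees e f st w b.
Proof. by rewrite /labelled_by /= => -> ->. Qed.
Lemma labelled_by_one f st w a : (a == 14) = false ->
  labelled_by e f st w (a, 14) = sees e f st w a && only e f st w a.
Proof. by rewrite /labelled_by /= => ->. Qed.

Section Painting.
Variables (A : pred 'I_n) (f : nat -> 'I_n).
Hypotheses (Airr : irreducible e A) (sf : seven e A f).
Hypothesis no6 : forall w, A w -> ~~ has_type e f w 13.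

Lemma labelled_byP st w p : alive st =1 A -> p \in labels ->
  labelled_by e f st w p -> labelled e A f w p.1 p.2.
Proof.
move=> sA /labels_lt[p1 p2 p12 p12']; rewrite /labelled_by /labelled.
have seesP t : sees e f st w t -> nbr e A f w t.
  by case/existsP=> x /and3P[Ax wx xt]; exists x; split=> //; rewrite -sA.
have onlyP t : only e f st w t -> single e A f w t.
  by move/forallP=> h x Ax xw; have := h x; rewrite sA Ax xw.
have lt14 a : a < 15 -> a <> 14 -> a < 14.
  by move=> a15 a14; rewrite ltn_neqAle -ltnS a15 andbT; apply/eqP.
case: eqP => [p14|p14]; first by move=> o; split; [apply: p12 | apply: onlyP].
case/andP=> /seesP s1 h; split=> //; first exact: lt14.
move: h; case: eqP => [_ /onlyP //|p24 /seesP s2].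
by split=> //; [apply: lt14 | apply: p12'].
Qed.

Lemma label_exists st w : alive st =1 A -> A w -> has_type e f w 14 ->
  exists2 p, p \in labels & labelled_by e f st w p.
Proof.
move=> sA Aw w14; have [cf Af] := sf.
have key x : A x -> type_of e f x < 15 /\ has_type e f x (type_of e f x).
  by move=> Ax; split; [apply: (type_of_lt Gsimple Gclass Airr cf Af) | apply: (has_type_of Gsimple Gclass Airr cf Af)].
pose lab a := [exists x, [&& A x, e w x, type_of e f x == a & a < 14]].
have seesI x : A x -> e w x -> sees e f st w (type_of e f x).
  by move=> Ax wx; apply/existsP; exists x; rewrite sA Ax wx; case: (key x Ax).
have onlyI t : t < 15 -> (forall x, A x -> e w x -> type_of e f x != t -> type_of e f x = 14) ->
  only e f st w t.
  move=> t15 h; apply/forallP => x; apply/implyP; rewrite sA => /andP[Ax xw].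
  have wx : e w x by rewrite es.
  have [x15 xt] := key x Ax; case: (eqVneq (type_of e f x) t) xt => [-> ->//|ne xt].
  by rewrite -(h x Ax wx ne) xt orbT.
have [/existsP[x /and3P[Ax wx x14]]|none] := boolP [exists x, [&& A x, e w x & type_of e f x < 14]];
  last first.
  exists (14, 14); [exact: mem_labels_none | rewrite /labelled_by eqxx].
  apply: onlyI => // x Ax wx ne; move/existsPn: none => /(_ x); rewrite Ax wx /=.
  by have [x15 _] := key x Ax; lia.
have x14' : (type_of e f x == 14) = false by apply/negbTE; lia.
have [/existsP[y /and4P[Ay wy y14 yx]]|none] :=
  boolP [exists y, [&& A y, e w y, type_of e f y < 14 & type_of e f x != type_of e f y]].
  exists (type_of e f x, type_of e f y); first by apply: mem_labels => //; apply: ltnW.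
  have y14' : (type_of e f y == 14) = false by apply/negbTE; lia.
  rewrite (labelled_by_two _ _ _ x14' y14'); apply/andP; split; exact: seesI.
exists (type_of e f x, 14); first by apply: mem_labels => //; lia.
rewrite (labelled_by_one _ _ _ x14'); apply/andP; split; first exact: seesI.
apply: onlyI => [|y]; first exact: ltnW.
move=> Ay wy ne; move/existsPn: none => /(_ y); rewrite Ay wy eq_sym ne andbT /=.
by have [y15 _] := key y Ay; lia.
Qed.

(** The label is not determined by the vertex: any label that applies is allowed. *)
Definition painted st v k : bool :=
  if has_type e f v 14 then has (fun p => labelled_by e f st v p && (far_colour p.1 p.2 == k)) labels
  else k == type_colour (type_of e f v).

Lemma labelled_by_ext st st' w p : st' DEL =1 st DEL -> labelled_by e f st' w p = labelled_by e f st w p.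
Proof.
move=> d; have sa x : alive st' x = alive st x by rewrite /alive d.
have s1 t : sees e f st' w t = sees e f st w t by apply: eq_existsb => x; rewrite sa.
have s2 t : only e f st' w t = only e f st w t by apply: eq_forallb => x; rewrite sa.
by rewrite /labelled_by !s1 !s2.
Qed.

Lemma painted_ext st st' v k : st' DEL =1 st DEL -> painted st' v k = painted st v k.
Proof.
move=> d; rewrite /painted; case: (has_type e f v 14); last exact: erefl.
by apply: eq_has => p; rewrite (@labelled_by_ext st).
Qed.

Lemma switches_paint st rho v : alive st =1 A -> tuned f rho -> rho 7 = v -> A v -> col st v = 0 ->
  let st' := run (CSeq near_switch far_switch) rho st in
  [/\ same_deletions st st', forall u, u != v -> col st' u = col st u & painted st v (col st' v)].
Proof.
move=> sA tr r7 Av c0; have [cf Af] := sf.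
have v15 := type_of_lt Gsimple Gclass Airr cf Af Av.
have vt := has_type_of Gsimple Gclass Airr cf Af Av.
rewrite -[run _ _ _]/(run far_switch rho (run near_switch rho st)).
have nearP : forall st' t, st' DEL =1 st DEL -> t \in iota 0 14 ->
  holds rho st' (is_type 7 t) = has_type e f v t.
  move=> st' t _; rewrite mem_iota => /= t14; apply: (holds_type adjE) => //; exact: ltnW.
have [[d1 o1] u1 k1] := switchP type_colour r7 nearP; rewrite -/near_switch in d1 o1 u1 k1.
set st1 := run near_switch rho st in d1 o1 u1 k1 *.
have farP : forall st' p, st' DEL =1 st1 DEL -> p \in labels ->
    holds rho st' (FAnd (is_type 7 14) (is_labelled p)) = has_type e f v 14 && labelled_by e f st v p.
  move=> st' p d pl; rewrite holds_and (holds_type adjE st' tr r7) // (holds_labelled adjE st' tr r7 pl).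
  by rewrite (@labelled_by_ext st) // => u; rewrite d d1.
have [[d2 o2] u2 k2] := switchP (fun p => far_colour p.1 p.2) r7 farP; rewrite -/far_switch in d2 o2 u2 k2.
set st2 := run far_switch rho st1 in d2 o2 u2 k2 *.
split; first by split=> u; rewrite ?d2 ?d1 ?o2 ?o1.
  by move=> u uv; rewrite u2 // u1.
rewrite /painted; case v14: (has_type e f v 14) k2 => k2.
  have [p pl lp] := label_exists sA Av v14.
  case: k2 => [[np _]|[q ql [lq ->]]].
    by case/negP: np; apply/hasP; exists p.
  by apply/hasP; exists q; rewrite // eqxx andbT.
case: k2 => [[_ ->]|[q _ []//]].
case: k1 => [[np _]|[t tI [ht ->]]].
  case/negP: np; apply/hasP; exists (type_of e f v) => //.
  rewrite mem_iota /= ltn_neqAle -ltnS v15 andbT; apply/eqP => t14.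
  by rewrite t14 v14 in vt.
rewrite (type_unique _ v15 ht vt) //; move: tI; rewrite mem_iota /= => t14; exact: ltnW.
Qed.

(** A labelling that explains all colours is recovered afterwards from the colours themselves. *)
Lemma paintP st rho : alive st =1 A -> tuned f rho ->
  let st' := run paint rho st in
  same_deletions st st' /\
  exists2 lab, forall w, A w -> has_type e f w 14 -> labelled e A f w (lab w).1 (lab w).2 &
    forall v, col st' v = if A v && (col st v == 0) then colour e f lab v else col st v.
Proof.
move=> sA tr st'.
pose I s := same_deletions st s /\ forall v, col s v = col st v \/
   (A v && (col st v == 0)) /\ painted st v (col s v).
pose P v s := A v && (col st v == 0) -> painted st v (col s v).
have sa s : same_deletions st s -> alive s =1 A by case=> d _ v; rewrite -sA /alive d.
pose F s v := run (when (uncoloured_alive 7) (CSeq near_switch far_switch)) (bind rho 7 v) s.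
have stE : st' = foldl F st (enum 'I_n) by exact: run_for.
have Fv s v : I s -> if A v && (col s v == 0)
    then [/\ same_deletions s (F s v), forall u, u != v -> col (F s v) u = col s u,
      A v && (col st v == 0) & painted st v (col (F s v) v)] else F s v = s.
  move=> [[d o] c]; rewrite /F /when run_if holds_and (@holds_alive _ _ _ _ _ v) // (@holds_colour _ _ _ _ _ _ v) //.
  rewrite sa //; case cond: (A v && (col s v == 0)) => //.
  have /andP[Av /eqP cv] := cond.
  have cv0 : col st v = 0.
    by case: (c v) => [<-//|[]]; case/andP=> _ /eqP.
  have tr7 : tuned f (bind rho 7 v) by apply: tuned_bind.
  have [sd u pv] := switches_paint (sa s (conj d o)) tr7 (erefl : bind rho 7 v 7 = v) Av cv.
  split; [exact: sd | exact: u | by rewrite Av cv0 |].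
  by rewrite -(painted_ext _ _ d).
have [] : I st' /\ forall v, P v st'.
  rewrite stE; apply: foldl_all => [s v Is|s u v Is Pu|].
  - have [[d o] c] := Is; have := Fv s v Is; case: ifP => [_ [[d' o'] u Av pv]|cond ->].
      split; last by move=> _.
      split; first by split=> w; rewrite ?d' ?d ?o' ?o.
      move=> w; case: (eqVneq w v) => [->|wv]; first by right.
      by rewrite u //; apply: c.
    split=> // /andP[Av cv]; case: (c v) => [cv'|[_ //]].
    by rewrite cv' Av cv in cond.
  - have := Fv s v Is; case: ifP => [_ [_ c Av pv]|_ ->//].
    by rewrite /P; case: (eqVneq u v) => [->|uv]; [move=> _; exact: pv | rewrite c //; exact: Pu].
  by split=> [|v]; [split | left].
move=> [sd c] pnt; split=> //.
pose ok v p := labelled_by e f st v p && ((A v && (col st v == 0)) ==> (far_colour p.1 p.2 == col st' v)).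
pose lab v := nth (14, 14) labels (find (ok v) labels).
have labE v : A v -> has_type e f v 14 -> lab v \in labels /\ ok v (lab v).
  move=> Av v14; have h : has (ok v) labels.
    case cv: (A v && (col st v == 0)).
      have := pnt v cv; rewrite /painted v14 => /hasP[p pl /andP[lp cp]].
      by apply/hasP; exists p => //; rewrite /ok lp cp implybT.
    by have [p pl lp] := label_exists sA Av v14; apply/hasP; exists p => //; rewrite /ok lp cv.
  split; [by apply: mem_nth; rewrite -has_find | exact: nth_find].
exists lab.
  by move=> w Aw w14; have [lw /andP[okw _]] := labE w Aw w14; apply: labelled_byP okw.
move=> v; case: ifP => [Av|nAv]; last by case: (c v) => [//|[Av _]]; rewrite Av in nAv.
rewrite /colour; case v14: (has_type e f v 14).
  have /andP[Av' _] := Av; have [_ /andP[_]] := labE v Av' v14.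
  by rewrite Av implyTb => /eqP->.
by have := pnt v Av; rewrite /painted v14 => /eqP->.
Qed.
End Painting.

Opaque colour.
Lemma col_assign st v k u : col (assign st COL v k) u = if u == v then k else col st u.
Proof. by rewrite /col /assign /= -val_eqE. Qed.

Lemma same_assign st v k : same_deletions st (assign st COL v k).
Proof. by []. Qed.

Lemma same_trans st1 st2 st3 : same_deletions st1 st2 -> same_deletions st2 st3 -> same_deletions st1 st3.
Proof. by move=> [d o] [d' o']; split=> u; rewrite ?d' ?o'. Qed.

Lemma same_alive (A : pred 'I_n) st st' : same_deletions st st' -> alive st =1 A -> alive st' =1 A.
Proof. by move=> [d _] sA v; rewrite -sA /alive d. Qed.

Definition proper (c : 'I_n -> nat) := forall u v, e u v -> c u = c v -> c u = 0.
(** The last condition closes the set of coloured vertices under adjacency in [A], so that components are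
    coloured entirely or not at all. *)
Definition partial (A : pred 'I_n) (c : 'I_n -> nat) :=
  [/\ forall v, c v <= 3, forall v, ~~ A v -> c v = 0, proper c
    & forall u v, A v -> e u v -> c u != 0 -> c v != 0].
Definition extends (c c' : 'I_n -> nat) := forall v, c v != 0 -> c' v = c v.

Lemma pick_colourP st v : (exists2 k, k \in [:: 1; 2; 3] & forall w, e v w -> col st w != k) ->
  pick_colour e st v \in [:: 1; 2; 3] /\ forall w, e v w -> col st w != pick_colour e st v.
Proof.
case=> k kI kf; have freeP c : free e st v c -> forall w, e v w -> col st w != c.
  by move/forallP=> h w; apply/implyP.
have kfree : free e st v k by apply/forallP => w; apply/implyP/kf.
rewrite /pick_colour; case f1: (free e st v 1); first by split=> //; apply: freeP.
case f2: (free e st v 2); first by split=> //; apply: freeP.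
split=> //; apply: freeP; move: kI kfree; rewrite !inE => /or3P[]/eqP-> //; by rewrite ?f1 ?f2.
Qed.

(** The hypothesis on the uncoloured vertices makes the order of the sweep irrelevant: the vertices it
    colours have neighbours that are all coloured beforehand, hence are pairwise nonadjacent. *)
Lemma sweep_once (A : pred 'I_n) st : alive st =1 A ->
  (forall v, col st v <= 3) -> (forall v, ~~ A v -> col st v = 0) -> proper (col st) ->
  (forall z x, A z -> col st z = 0 -> e z x -> col st x != 0 ->
     (forall y, A y -> e z y -> col st y != 0) /\
     exists2 k, k \in [:: 1; 2; 3] & forall y, e z y -> col st y != k) ->
  let st' := foldl (sweep_step e) st (enum 'I_n) in
  [/\ same_deletions st st', partial A (col st') & extends (col st) (col st')].
Proof.
move=> sA c3 c0 pr rest st'.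
pose R v := pending e st v.
have RP z : R z -> [/\ A z, col st z = 0, forall y, A y -> e z y -> col st y != 0 &
    exists2 k, k \in [:: 1; 2; 3] & forall y, e z y -> col st y != k].
  move=> /and3P[az /eqP cz /existsP[x /andP[zx cx]]]; rewrite sA in az.
  by have [h1 h2] := rest z x az cz zx cx; split.
pose I s := [/\ same_deletions st s, extends (col st) (col s) &
  forall v, col st v = 0 -> col s v != 0 ->
    [/\ R v, col s v \in [:: 1; 2; 3] & forall y, e v y -> col st y != col s v]].
pose P v s := R v -> col s v != 0.
have RN z y s : I s -> R z -> e z y -> col s y = col st y.
  move=> [_ ex new] Rz zy; case: (eqVneq (col st y) 0) => [cy|/ex //].
  have [Az cz h _] := RP z Rz; case: (eqVneq (col s y) 0) => [->//|cy'].
  have [Ry _ _] := new y cy cy'; have [Ay _ _ _] := RP y Ry.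
  by have := h y Ay zy; rewrite cy.
have step s v : I s -> I (sweep_step e s v) /\ P v (sweep_step e s v).
  move=> Is; have [sd ex new] := Is; rewrite /sweep_step; case: ifP => [pd|npd].
    have /and3P[av /eqP cv /existsP[w /andP[vw cw]]] := pd.
    rewrite (same_alive sd sA) in av.
    have cv0 : col st v = 0 by apply/eqP; apply: contraT => h; move: (h); rewrite -(ex v h) cv.
    have cw0 : col st w != 0.
      apply/negP => /eqP cw0; have [Rw _ _] := new w cw0 cw; have [_ _ h _] := RP w Rw.
      by have := h v av; rewrite es vw cv0 => /(_ isT).
    have Rv : R v by rewrite /R /pending sA av cv0 eqxx; apply/existsP; exists w; rewrite vw.
    have [_ _ _ [k kI kf]] := RP v Rv.
    have [|pI pf] := @pick_colourP s v.
      by exists k => // y vy; rewrite (RN v y s Is Rv vy); apply: kf.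
    have p0 : pick_colour e s v != 0 by move: pI; rewrite !inE => /or3P[]/eqP->.
    split; last by move=> _; rewrite col_assign eqxx.
    split; first exact: same_trans sd (same_assign _ _ _).
      by move=> u cu; rewrite col_assign; case: eqP => [uv|_]; [rewrite uv cv0 in cu | apply: ex].
    move=> u cu; rewrite col_assign; case: (eqVneq u v) => [->|_]; last exact: (new u cu).
    by move=> _; split=> // y vy; rewrite -(RN v y s Is Rv vy) pf.
  split=> // Rv; have [Av cv _ _] := RP v Rv; apply: contraFT npd; rewrite negbK => /eqP c.
  have /and3P[_ _ /existsP[w /andP[vw cw]]] := Rv.
  rewrite /pending (same_alive sd sA) Av c eqxx; apply/existsP; exists w.
  by rewrite vw ex.
have [] : I st' /\ forall v, P v st'.
  apply: foldl_all => [s v|s u v Is Pu Ru|]; first exact: step.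
    rewrite /sweep_step; case: ifP => _; last exact: (Pu Ru).
    rewrite col_assign; case: (eqVneq u v) => _; last exact: (Pu Ru).
    by rewrite /pick_colour; case: ifP => //; case: ifP.
  by split=> // v ->.
move=> Is PR; have [sd ex new] := Is; split=> //.
have cases v : col st v = col st' v \/ col st v = 0 /\ col st' v != 0.
  case: (eqVneq (col st v) 0) => [c|/ex ->]; last by left.
  by case: (eqVneq (col st' v) 0) => [c'|c']; [left; rewrite c c' | right].
have one u v : R u -> col st u = 0 -> col st' u != 0 -> e u v -> col st' u = col st' v -> False.
  move=> Ru cu cu' uv eq; have [_ _ f] := new u cu cu'.
  by have := f v uv; rewrite -(RN u v st' Is Ru uv) eq eqxx.
split.
- move=> v; case: (cases v) => [<-//|[cv cv']]; have [_] := new v cv cv'.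
  by rewrite !inE => /or3P[]/eqP->.
- move=> v nA; case: (cases v) => [<-|[cv cv']]; first exact: c0.
  by have [/RP[Av _ _ _] _ _] := new v cv cv'; rewrite Av in nA.
- move=> u v uv eq; case: (cases u) => [cu|[cu cu']]; last first.
    by have [Ru _ _] := new u cu cu'; case: (one u v Ru cu cu' uv eq).
  case: (cases v) => [cv|[cv cv']]; first by rewrite -cu; apply: (pr u v uv); rewrite cu cv.
  have [Rv _ _] := new v cv cv'; case: (one v u Rv cv cv' _ (esym eq)); by rewrite es.
move=> u v Av uv cu'; case: (cases u) => [cu|[cu _]].
  case: (eqVneq (col st v) 0) => [cv|cv]; last by rewrite ex.
  apply: PR; rewrite /R /pending sA Av cv eqxx; apply/existsP; exists u.
  by rewrite es uv cu.
have [Ru _ _] := new u cu cu'; have [_ _ h _] := RP u Ru.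
by rewrite ex ?h.
Qed.

Section Cycles.
Variables (A : pred 'I_n) (Airr : irreducible e A).

(** This includes all tuples that are passed over because their first vertex is coloured already. *)
Definition covers f st := cyc e f -> (forall i, i < 7 -> A (f i)) ->
  (forall w, A w -> ~~ has_type e f w 13) -> col st (f 0) != 0.
Definition cycle_body := when good_cycle (CSeq paint sweep).
Definition valid st0 st := [/\ same_deletions st0 st, alive st =1 A & partial A (col st)].

(** By closure, the components that contain coloured vertices are not touched.  In the other components
    [paint] installs [colour], and the sweep colours what is left in the components that it has reached. *)
Lemma cycle_body_step st0 st rho f : tuned f rho -> valid st0 st ->
  let st' := run cycle_body rho st in
  [/\ valid st0 st', extends (col st) (col st') & covers f st'].
Proof.
move=> tr [sd0 sA [c3 c0 pr cl]] st'; rewrite /st' /cycle_body /when run_if.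
case: (holds_good_cycle adjE st tr) => [[cf Af f0 no6]|ng]; last first.
  split=> // cf Af no6; apply/negP => /eqP f0; case: ng; split=> // [i i7|w aw].
    by rewrite sA Af.
  by apply: no6; rewrite -sA.
have Af' i : i < 7 -> A (f i) by rewrite -sA; apply: Af.
have no6' w : A w -> ~~ has_type e f w 13 by rewrite -sA; apply: no6.
have sf : seven e A f by split.
have [sd1 [lab labP colE]] := paintP Airr sf sA tr.
set st1 := run paint rho st in sd1 colE.
have cE : run (CSeq paint sweep) rho st = foldl (sweep_step e) st1 (enum 'I_n) by exact: run_sweep.
have old u v : A u -> A v -> e u v -> (col st u == 0) = (col st v == 0).
  move=> Au Av uv; apply/idP/idP; apply: contraLR => h.
    by apply: (cl v u) h => //; rewrite es.
  exact: (cl u v) h.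
have colA v : A v -> col st v = 0 -> col st1 v = colour e f lab v.
  by move=> Av cv; rewrite colE Av cv.
have colO v : col st v != 0 -> col st1 v = col st v.
  by move=> /negbTE cv; rewrite colE cv andbF.
have colN v : ~~ A v -> col st1 v = 0.
  by move=> nA; rewrite colE (negbTE nA) c0.
have [||||| sd2 pt ex] := @sweep_once A st1.
- exact: same_alive sd1 sA.
- move=> v; rewrite colE; case: ifP => _ //.
  exact: colour_le3.
- exact: colN.
- move=> u v uv; case: (boolP (A u)) => [Au|/colN-> //]; case: (boolP (A v)) => [Av|/colN-> //].
  have := old u v Au Av uv; case: (eqVneq (col st u) 0) => [cu|cu] /esym; last first.
    by move/negbT => cv; rewrite !colO //; apply: pr.
  move/eqP => cv; rewrite (colA u Au cu) (colA v Av cv) => eq.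
  exact: (colour_proper Gsimple Gclass Airr sf no6' labP Au Av uv eq).
- move=> z x Az cz zx cx.
  have Ax : A x by apply: contraT => /colN h; rewrite h in cx.
  have cz0 : col st z = 0.
    by apply/eqP; apply: contraT => h; move: (h); rewrite -(colO z h) cz.
  have nb y : A y -> e z y -> col st1 y = colour e f lab y.
    by move=> Ay zy; apply: colA => //; apply/eqP; rewrite -(old z y) // cz0.
  have czE : colour e f lab z = 0 by rewrite -(colA z Az cz0).
  split=> [y Ay zy|].
    rewrite (nb y Ay zy); apply/negP => /eqP cy; case/negP: cx; apply/eqP; rewrite (nb x Ax zx).
    exact: (rest_alone Gsimple Gclass Airr sf no6' labP Az Ay zy czE cy Ax zx).
  have [k kI kf] := rest_free Gsimple Gclass Airr sf no6' labP Az czE.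
  exists k => // y zy; case: (boolP (A y)) => [Ay|/colN->]; first by rewrite (nb y Ay zy); exact: kf.
  by move: kI; rewrite !inE => /or3P[]/eqP->.
rewrite cE.
have ex1 : extends (col st) (col st1) by move=> v cv; rewrite colO.
split.
- split=> //; first exact: same_trans (same_trans sd0 sd1) sd2.
  exact: same_alive (same_trans sd1 sd2) sA.
- by move=> v cv; rewrite ex ?ex1.
move=> _ _ _; have f07 : A (f 0) by apply: Af'.
(* The vertex c_0 has type D_0, in particular not R, so its colour is not 0. *)
have c1 : col st1 (f 0) = colour e f lab (f 0) by apply: colA.
have nf : ~~ has_type e f (f 0) 14.
  by apply/negP => /(far_type (i := 1) isT); rewrite cf.
have := near_colour Gsimple Gclass Airr sf no6' lab f07 nf; rewrite -c1 => k.
have k0 : col st1 (f 0) != 0 by move: k; rewrite !inE => /or3P[]/eqP->.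
by rewrite ex.
Qed.

(** An uncoloured seven-cycle has a rotation without vertices of type L_6; when this tuple was treated,
    its first vertex got a colour. *)
Lemma cycle_phaseP st0 st rho : valid st0 st ->
  let st' := run cycle_phase rho st in
  valid st0 st' /\
  forall f, cyc e f -> (forall i, i < 7 -> A (f i) && (col st' (f i) == 0)) -> False.
Proof.
move=> v0 st'.
have step s vs : size vs = size (iota 0 7) -> valid st0 s -> exists2 f, vs = [seq f i | i <- iota 0 7] &
    let s' := run cycle_body (binds rho (iota 0 7) vs) s in
    [/\ valid st0 s', extends (col s) (col s') & covers f s'].
  move=> vs7 vst; have [f vsE tr] := tuned_binds rho vs7.
  by exists f => //; apply: cycle_body_step.
have vld : valid st0 st'.
  by apply: nest_inv v0 => s vs vs7 /(step s vs vs7)[f _ []].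
split=> // f cf Hf; have sf : seven e A f by split=> // i /Hf/andP[].
have [r [r7 no6]] := exists_gap Gsimple Gclass Airr sf.
pose g i := f (turn (unturn r false) false i).
have [cg Ag] : seven e A g := seven_turn false r7 sf.
have : covers g st'.
  apply: (@nest_done _ _ (valid st0) (covers g) cycle_body (iota 0 7) rho st [seq g i | i <- iota 0 7]) v0;
    first by rewrite size_map.
  - by move=> s vs vs7 /(step s vs vs7)[f' _ []].
  - move=> s Is; have [|f' eq [_ _ cov]] := step s [seq g i | i <- iota 0 7] _ Is; first by rewrite size_map.
    have fg i : i < 7 -> f' i = g i.
      move=> i7; have := congr1 (nth (g 0)^~ i) eq.
      by rewrite !(nth_map 0) ?size_iota // nth_iota.
    move=> _ Ag' no13; rewrite -(fg 0) //; apply: cov.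
    + by move=> i j i7 j7; rewrite !fg // cg.
    + by move=> i i7; rewrite fg //; apply: Ag.
    move=> w Aw; rewrite (has_type_eq e w fg (isT : 13 < 15)); exact: no13.
  move=> s vs vs7 Is cov; have [f' _ [_ ex _]] := step s vs vs7 Is.
  by move=> cg' Ag' no13; rewrite ex; apply: cov.
move=> cov; have := cov cg Ag no6; have u7 : unturn r false < 7 by rewrite /unturn ltn_mod.
have t7 : turn (unturn r false) false 0 < 7 by apply: turn_lt.
by have /andP[_ ->] := Hf _ t7.
Qed.
End Cycles.

Section Seeds.
Variables (A : pred 'I_n).

Definition sweeps x := foldl (sweep_step e) x (enum 'I_n).
Definition coloured x := [set v : 'I_n | col x v != 0].

Lemma sweep_step_extends x v : extends (col x) (col (sweep_step e x v)).
Proof.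
rewrite /sweep_step; case: ifP => // /and3P[_ /eqP cv _] u cu; rewrite col_assign.
by case: (eqVneq u v) cu => // ->; rewrite cv.
Qed.

Lemma sweep_step_same x v : same_deletions x (sweep_step e x v).
Proof. by rewrite /sweep_step; case: ifP. Qed.

Lemma pick_pos x v : pick_colour e x v != 0.
Proof. by rewrite /pick_colour; case: ifP => // _; case: ifP. Qed.

Lemma extends_trans c1 c2 c3 : extends c1 c2 -> extends c2 c3 -> extends c1 c3.
Proof. by move=> h1 h2 v cv; rewrite h2 h1. Qed.

Lemma sweepsP x : [/\ same_deletions x (sweeps x), extends (col x) (col (sweeps x)) &
  forall v, pending e x v -> col (sweeps x) v != 0].
Proof.
have [|||[sd ex] pd] := @foldl_all _ _ (fun y => same_deletions x y /\ extends (col x) (col y))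
  (fun v y => pending e x v -> col y v != 0) (sweep_step e) x; last by split.
- move=> y v [sd ex]; split.
    split; first exact: same_trans sd (sweep_step_same _ _).
    exact: extends_trans ex (@sweep_step_extends _ _).
  move=> /and3P[av _ /existsP[w /andP[vw cw]]]; case: (eqVneq (col y v) 0) => cv; last first.
    by rewrite sweep_step_extends.
  rewrite /sweep_step (_ : pending e y v); first by rewrite col_assign eqxx pick_pos.
  rewrite /pending (same_alive sd (fun=> erefl)) av cv eqxx; apply/existsP; exists w.
  by rewrite vw ex.
- by move=> y u v _ Pu /Pu cu; rewrite sweep_step_extends.
by split.
Qed.

Lemma sweeps_stable x : (forall v, ~~ pending e x v) -> sweeps x = x.
Proof.
by move=> h; rewrite /sweeps; elim: (enum 'I_n) => //= v l IH; rewrite {2}/sweep_step (negbTE (h v)).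
Qed.

(** A sweep that meets an uncoloured vertex with a coloured neighbour colours a vertex; so [n] sweeps
    suffice. *)
Lemma many_sweeps (l : seq 'I_n) x : let y := foldl (fun y _ => sweeps y) x l in
  (forall v, ~~ pending e y v) \/ size l + #|coloured x| <= #|coloured y|.
Proof.
elim: l x => [|a l IH] x /=; first by right.
have [/existsP[v pv]|/existsPn no] := boolP [exists v, pending e x v]; last first.
  rewrite (sweeps_stable no); left => v; suff -> : foldl (fun y _ => sweeps y) x l = x by [].
  by elim: l {IH} => //= b l IH; rewrite (sweeps_stable no).
case: (IH (sweeps x)) => [st|le]; [by left | right; apply: leq_trans le].
rewrite addSnnS leq_add2l; apply: proper_card; have [_ ex pd] := sweepsP x.
rewrite properE; apply/andP; split; first by apply/subsetP => u; rewrite !inE => cu; rewrite ex.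
apply/subsetPn; exists v; rewrite !inE ?pd // negbK.
by case/and3P: pv.
Qed.

Variables (h : 'I_n -> bool) (st : store).
Hypothesis hP : forall v w, A v -> col st v = 0 -> A w -> col st w = 0 -> e v w -> h v != h w.

(** In the component of the seed, the colours are determined by the bipartition [h]: an uncoloured
    vertex sees colours of the other side only, so the smallest free colour is the expected one of 1
    and 2. *)
Lemma seed_step st0 st1 rho s : valid A st0 st1 -> extends (col st) (col st1) ->
  A s -> col st1 s = 0 ->
  let st2 := run (CSeq (paint_with 9 1) (CFor 10 sweep)) (bind rho 9 (val s)) st1 in
  [/\ valid A st0 st2, extends (col st1) (col st2) & col st2 s != 0].
Proof.
move=> [sd0 sA [c3 c0 pr cl]] ex1 As cs st2.
pose st1' := assign st1 COL (val s) 1.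
have E : st2 = foldl (fun y _ => sweeps y) st1' (enum 'I_n).
  rewrite /st2 -[run _ _ _]/(run (CFor 10 sweep) (bind rho 9 (val s)) (run (paint_with 9 1) (bind rho 9 (val s)) st1)).
  rewrite (@run_paint_with _ _ _ _ _ s) // run_for; apply: eq_foldl => y v.
  exact: run_sweep.
clearbody st2; pose tint v := if h v == h s then 1 else 2.
have tint_neq u v : h u != h v -> tint u = tint v -> False.
  by rewrite /tint; case: (h u) (h v) (h s) => [] [] [].
pose J x := [/\ same_deletions st1 x, extends (col st1) (col x),
  forall v, col st1 v = 0 -> col x v != 0 -> A v /\ col x v = tint v & col x s != 0].
have c0E v : col st1 v = 0 -> col st v = 0.
  by move=> cv; apply/eqP; apply: contraT => k; move: (k); rewrite -(ex1 v k) cv.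
have Jstep x v : J x -> J (sweep_step e x v).
  move=> [sd ex new xs]; split.
  - exact: same_trans sd (sweep_step_same _ _).
  - exact: extends_trans ex (@sweep_step_extends _ _).
  - rewrite /sweep_step; case: ifP => pd; last exact: new.
    move=> u cu; rewrite col_assign; case: (eqVneq u v) => [uv _|uv]; last exact: new.
    subst u; have /and3P[av /eqP cv /existsP[w /andP[vw cw]]] := pd.
    have Av : A v by rewrite -(same_alive sd sA).
    split=> //.
    have nbr y : e v y -> col x y != 0 -> [/\ A y, h y != h v & col x y = tint y].
      move=> vy cy; case: (eqVneq (col st1 y) 0) => [cy0|cy0]; last first.
        by have := cl y v Av; rewrite es vy cu => /(_ isT cy0).
      have [Ay cyE] := new y cy0 cy; split=> //; rewrite eq_sym.
      by apply: hP => //; apply: c0E.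
    have [Aw hw cwE] := nbr w vw cw.
    rewrite /pick_colour /tint; case: (eqVneq (h v) (h s)) => hvs.
      rewrite (_ : free e x v 1) //; apply/forallP => y; apply/implyP => vy.
      case: (eqVneq (col x y) 0) => [-> //|cy]; have [Ay hy ->] := nbr y vy cy.
      by rewrite /tint -hvs (negbTE hy).
    have opp y : h y != h v -> h y = h s.
      by move: hvs; case: (h y); case: (h v); case: (h s).
    rewrite (_ : free e x v 1 = false); last first.
      apply/negbTE/forallPn; exists w; rewrite vw cwE /tint (opp w hw) eqxx //.
    rewrite (_ : free e x v 2) //; apply/forallP => y; apply/implyP => vy.
    case: (eqVneq (col x y) 0) => [-> //|cy]; have [Ay hy ->] := nbr y vy cy.
    by rewrite /tint (opp y hy) eqxx.
  by rewrite sweep_step_extends.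
have J1 : J st1'.
  split=> //.
  - move=> u cu; rewrite col_assign; case: (eqVneq u s) cu => // ->; by rewrite cs.
  - move=> u cu; rewrite col_assign; case: (eqVneq u s) => [->|_]; last by rewrite cu.
    by rewrite /tint eqxx.
  by rewrite col_assign eqxx.
have [sd ex new xs] : J st2.
  rewrite E; apply: (foldl_inv (J := J)) J1 => x _ Jx; apply: (foldl_inv (J := J)) Jx => y v; exact: Jstep.
(* Otherwise the sweeps would have coloured [n] vertices besides the seed. *)
have stable v : ~~ pending e st2 v.
  have := many_sweeps (enum 'I_n) st1'; rewrite -E => -[st2s|]; first exact: st2s.
  rewrite size_enum_ord => le; have := max_card (mem (coloured st2)); rewrite card_ord => le'.
  have : 0 < #|coloured st1'| by apply/card_gt0P; exists s; rewrite inE col_assign eqxx.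
  by move: (leq_trans le le'); rewrite -[X in _ <= X]addn0 leq_add2l leqNgt => /negbTE->.
have A2 := same_alive sd sA.
have cases v : col st2 v = col st1 v \/ [/\ col st1 v = 0, A v & col st2 v = tint v].
  case: (eqVneq (col st1 v) 0) => [cv|/ex ->]; last by left.
  case: (eqVneq (col st2 v) 0) => [->|c2]; first by left.
  by right; have [] := new v cv c2.
split=> //; split=> //; first exact: same_trans sd0 sd.
have mixed u v : e u v -> [/\ col st1 u = 0, A u & col st2 u = tint u] -> col st1 v != 0 -> False.
  by move=> uv [cu Au _] cv; have := cl v u Au; rewrite es uv cu => /(_ isT cv).
split.
- by move=> v; case: (cases v) => [->//|[_ _ ->]]; rewrite /tint; case: ifP.
- by move=> v nA; case: (cases v) => [->|[_ Av _]]; [apply: c0 | rewrite Av in nA].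
- move=> u v uv eq; case: (eqVneq (col st2 u) 0) => // cu; exfalso.
  have cv : col st2 v != 0 by rewrite -eq.
  case: (cases u) => [cu1|nu]; case: (cases v) => [cv1|nv].
  + case/negP: cu; apply/eqP; rewrite cu1; apply: (pr u v uv); rewrite -cu1 -cv1; exact: eq.
  + by apply: (mixed v u _ nv); [rewrite es | rewrite -cu1].
  + by apply: (mixed u v uv nu); rewrite -cv1.
  case: nu nv => [cu0 Au cuE] [cv0 Av cvE]; have huv := hP Au (c0E u cu0) Av (c0E v cv0) uv.
  have tE : tint u = tint v by rewrite -cuE -cvE.
  exact: (tint_neq _ _ huv tE).
move=> u v Av uv cu; apply: contraT; rewrite negbK => /eqP cv.
case/negP: (stable v); rewrite /pending A2 Av cv eqxx; apply/existsP; exists u.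
by rewrite es uv cu.
Qed.
End Seeds.

Lemma bipartite_phaseP (A : pred 'I_n) st0 st rho : valid A st0 st ->
  (forall f, cyc e f -> (forall i, i < 7 -> A (f i) && (col st (f i) == 0)) -> False) ->
  let st' := run bipartite_phase rho st in
  valid A st0 st' /\ forall v, A v -> col st' v != 0.
Proof.
move=> vst no7 st'.
have [h hP] := bipartition (H := [pred v | A v && (col st v == 0)]) Gsimple Gclass no7.
have hP' v w : A v -> col st v = 0 -> A w -> col st w = 0 -> e v w -> h v != h w.
  by move=> Av cv Aw cw; apply: hP; rewrite inE ?Av ?Aw ?cv ?cw eqxx.
rewrite /st' /bipartite_phase run_for.
pose I s := valid A st0 s /\ extends (col st) (col s).
have step s v : I s -> let s' := run (when (uncoloured_alive 9) (CSeq (paint_with 9 1) (CFor 10 sweep))) (bind rho 9 (val v)) s in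
   [/\ I s', extends (col s) (col s') & A v -> col s' v != 0].
  move=> [vs ex]; have [_ sA _] := vs.
  rewrite /when run_if holds_and (@holds_alive _ _ _ _ _ v) // (@holds_colour _ _ _ _ _ _ v) // sA.
  case: ifP => [/andP[Av /eqP cv]|nc].
    have [vs' ex' cs] := seed_step hP' rho vs ex Av cv.
    by split=> //; split=> //; apply: extends_trans ex ex'.
  by split=> // Av; rewrite Av /= in nc; rewrite nc.
have [|||[vs _] all] := @foldl_all n _ I (fun v s => A v -> col s v != 0)
  (fun s v => run (when (uncoloured_alive 9) (CSeq (paint_with 9 1) (CFor 10 sweep))) (bind rho 9 (val v)) s) st;
  last by split.
- by move=> s v Is; have [Is' _ cv] := step s v Is; split.
- by move=> s u v Is Pu Au; have [_ ex _] := step s v Is; rewrite ex Pu.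
by split.
Qed.
End Phases.

(** * Deleting and reinserting reducible vertices *)

Lemma foldl_iota (A : Type) (I : nat -> A -> Prop) F a n :
  (forall i s, i < n -> I i s -> I i.+1 (F s i)) -> I 0 a -> I n (foldl F a (iota 0 n)).
Proof.
move=> h I0; have : forall k, k <= n -> I k (foldl F a (iota 0 k)).
  by elim=> // k IH kn; rewrite -addn1 iotaD foldl_cat addn1; apply: h => //; apply: IH; apply: ltnW.
exact.
Qed.

Section Order.
Variables (n : nat) (e : rel 'I_n) (adj : nat -> nat -> bool).
Hypotheses (Gsimple : simple_graph e) (Gclass : class_G 10 7 e).
Hypothesis adjE : forall u v : 'I_n, adj (val u) (val v) = e u v.
Implicit Types (st : store) (rho : nat -> nat) (u v w : 'I_n).
Local Notation run := (run n adj).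
Local Notation holds := (holds n adj).

Let es : symmetric e. Proof. by case: Gsimple. Qed.
Let ei : irreflexive e. Proof. by case: Gsimple. Qed.

Lemma reducibleP (B : pred 'I_n) u : reducible_in e B u ->
  (exists v, [/\ B v, v != u & forall w, B w -> e u w -> e v w]) \/
  exists a b, forall w, B w -> e u w -> w = a \/ w = b.
Proof.
case/orP=> [/existsP[v /and3P[Bv vu /forallP h]]|/existsP[a /existsP[b /forallP h]]].
  by left; exists v; split=> // w Bw uw; have := h w; rewrite Bw uw.
right; exists a, b => w Bw uw; have := h w; rewrite Bw uw => /orP[]/eqP; by [left | right].
Qed.

Lemma reducible_mono (B B' : pred 'I_n) u : (forall w, B' w -> B w) -> (forall w, B w -> w != u -> B' w) ->
  reducible_in e B u -> reducible_in e B' u.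
Proof.
move=> s1 s2 /orP[/existsP[v /and3P[Bv vu /forallP h]]|/existsP[a /existsP[b /forallP h]]]; apply/orP.
  left; apply/existsP; exists v; rewrite s2 //= vu; apply/forallP => w; apply/implyP => /andP[Bw uw].
  by have := h w; rewrite s1 ?uw.
right; apply/existsP; exists a; apply/existsP; exists b; apply/forallP => w; apply/implyP => /andP[Bw uw].
by have := h w; rewrite s1 ?uw.
Qed.

Lemma irreducibleI (A : pred 'I_n) : (forall u, A u -> ~~ reducible_in e A u) -> irreducible e A.
Proof.
move=> h; split=> [u v Au Av uv|u a b Au].
  have /existsP[w /and3P[Aw uw vw]] : [exists w, [&& A w, e u w & ~~ e v w]].
    apply: contraT => /existsPn no; case/negP: (h u Au); apply/orP; left.
    apply/existsP; exists v; rewrite Av eq_sym uv; apply/forallP => w; apply/implyP => /andP[Aw uw].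
    by have := no w; rewrite Aw uw negbK.
  by exists w; split.
have /existsP[w /and4P[Aw uw wa wb]] : [exists w, [&& A w, e u w, w != a & w != b]].
  apply: contraT => /existsPn no; case/negP: (h u Au); apply/orP; right.
  apply/existsP; exists a; apply/existsP; exists b; apply/forallP => w; apply/implyP => /andP[Aw uw].
  by have := no w; rewrite Aw uw /= negb_and !negbK.
by exists w; split.
Qed.

(** The vertices present just after the deletion in round [k]. *)
Definition remaining st k : pred 'I_n := fun w => alive st w || (k < st ORD w).
Definition ordered st := [/\ forall u, ~~ alive st u -> st ORD u < n,
  forall u v, ~~ alive st u -> ~~ alive st v -> st ORD u = st ORD v -> u = v
  & forall u, ~~ alive st u -> reducible_in e (remaining st (st ORD u)) u].

Definition delete st v r := assign (assign st DEL v 1) ORD v r.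
Lemma alive_delete st v r w : alive (delete st v r) w = alive st w && (w != v).
Proof. by rewrite /alive /delete /assign /= val_eqE; case: (eqVneq w v); rewrite ?andbT ?andbF. Qed.
Lemma ord_delete st v r w : delete st v r ORD w = if w == v then r else st ORD w.
Proof. by rewrite /delete /assign /= val_eqE. Qed.

Definition used st (r : nat) := [exists w : 'I_n, ~~ alive st w && (st ORD w == r)].
Definition delete_step r st v :=
  if [&& alive st v, reducible_in e (alive st) v & ~~ used st r] then delete st v r else st.

Lemma run_round rho st : run deletion_round rho st =
  foldl (delete_step (rho 11)) st (enum 'I_n).
Proof.
rewrite run_for; apply: eq_foldl => {}st v; rewrite /when run_if holds_conj !all_cons all_nil andbT holds_not.
rewrite (@holds_alive _ _ _ _ _ v) // (@holds_reducible _ _ _ adjE _ _ v) // /delete_step.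
congr (if [&& _, _ & ~~ _] then _ else _); rewrite holds_ex; apply: eq_existsb => w.
by rewrite holds_and holds_not (@holds_alive _ _ _ _ _ w).
Qed.

Definition dead st := [set v : 'I_n | ~~ alive st v].
(** Either no vertex can be deleted any more, or each round so far has deleted one. *)
Definition reducing r st := [/\ forall v, col st v = 0,
  forall u, ~~ alive st u -> st ORD u < r,
  forall u v, ~~ alive st u -> ~~ alive st v -> st ORD u = st ORD v -> u = v,
  forall u, ~~ alive st u -> reducible_in e (remaining st (st ORD u)) u
  & (forall u, alive st u -> ~~ reducible_in e (alive st) u) \/ r <= #|dead st|].

(** Deleting [u] does not change what remained after the earlier deletions, as [u] was present then. *)
Lemma round_step r st : reducing r st -> reducing r.+1 (foldl (delete_step r) st (enum 'I_n)).
Proof.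
move=> [c0 lt inj rd or].
have unused : used st r = false.
  by apply/negbTE/existsPn => w; apply/negP => /andP[nw /eqP eq]; have := lt w nw; rewrite eq ltnn.
have used_del u : used (delete st u r) r.
  by apply/existsP; exists u; rewrite alive_delete ord_delete !eqxx andbF.
pose ok u := alive st u && reducible_in e (alive st) u.
pose J x := x = st \/ exists2 u, ok u & x = delete st u r.
pose P v x := x = st -> ~~ ok v.
have [|||Jx Px] := @foldl_all _ _ J P (delete_step r) st.
- move=> x v [->|[u ou ->]]; last first.
    rewrite /delete_step used_del !andbF; split; first by right; exists u.
    move=> eq; have := used_del u; by rewrite eq unused.
  rewrite /delete_step unused andbT -/(ok v); case: ifP => okv.
    split; first by right; exists v.
    by move=> eq; have := used_del v; rewrite eq unused.
  by split; [left | rewrite /P okv].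
- move=> x u v [->|[u' ou ->]] Pu; first by move=> _; apply: Pu.
  by rewrite /delete_step used_del !andbF.
- by left.
set x := foldl _ _ _ in Jx Px *; case: Jx => [xE|[u /andP[au ru] xE]].
  rewrite xE; split=> //; first by move=> u /lt; apply: ltnW.
  by left => u au; have := Px u xE; rewrite /ok au.
rewrite {}xE {Px x}.
have deadE w : ~~ alive (delete st u r) w -> w = u \/ ~~ alive st w /\ w != u.
  by rewrite alive_delete; case: eqVneq => [->|wu]; [left | rewrite andbT; right].
split.
- exact: c0.
- by move=> w /deadE[->|[nw /negbTE wu]]; rewrite ord_delete ?eqxx ?wu // ltnW // ltnS; apply: lt.
- move=> v w /deadE[->|[nv /negbTE vu]] /deadE[->|[nw /negbTE wu]] //; rewrite !ord_delete ?eqxx ?vu ?wu.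
  + by move=> eq; have := lt w nw; rewrite -eq ltnn.
  + by move=> eq; have := lt v nv; rewrite eq ltnn.
  exact: inj.
- move=> v /deadE[->|[nv vu]]; rewrite ord_delete.
    rewrite eqxx; apply: reducible_mono ru => w; rewrite /remaining alive_delete ord_delete.
      case: eqVneq => [_|_]; first by rewrite andbF ltnn.
      rewrite andbT; case/orP=> // rw; apply: contraT => /lt; by rewrite ltnNge ltnW.
    by move=> aw wu; rewrite aw wu.
  rewrite (negbTE vu); apply: reducible_mono (rd v nv) => w; rewrite /remaining alive_delete ord_delete.
    by case: (eqVneq w u) => [->|_]; rewrite ?au ?andbT.
  by case: (eqVneq w u) => [-> _ _|_ h _]; [rewrite andbF /=; apply: lt | rewrite andbT].
right; have -> : dead (delete st u r) = u |: dead st.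
  by apply/setP => w; rewrite !inE alive_delete negb_and negbK orbC.
rewrite cardsU1 inE negbK au add1n ltnS; case: or => // no.
by have := no u au; rewrite ru.
Qed.

Lemma reductionP rho : let st := run reduction rho (fun _ _ => 0) in
  [/\ forall v, col st v = 0, ordered st & irreducible e (alive st)].
Proof.
have : reducing n (run reduction rho (fun _ _ => 0)).
  rewrite -[run _ _ _]/(foldl (fun s i => run deletion_round (bind rho 11 i) s) (fun _ _ => 0) (iota 0 n)).
  apply: foldl_iota => [i s _ h|]; first by rewrite run_round; apply: round_step.
  by split=> //; right.
move=> [c0 lt inj rd or] st; split=> //; apply: irreducibleI => u au.
(* If all [n] rounds have deleted a vertex, none is left. *)
case: or => [|full]; first exact.
have : dead st = setT by apply/eqP; rewrite eqEcard subsetT cardsT card_ord.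
by move/setP/(_ u); rewrite !inE au.
Qed.

(** All coloured neighbours of the reinserted vertex were present when it was deleted.  If it was dominated
    by [d], the colour of [d] is free, because these neighbours are adjacent to [d]; if it had at most two
    neighbours, some colour is left. *)
Lemma reinsertionP st rho : ordered st ->
  partial e (alive st) (col st) -> (forall v, alive st v -> col st v != 0) ->
  coloring 3 e (col (run reinsertion rho st)).
Proof.
move=> [lt inj rd] [c3 c0 pr _] full.
pose I i s := [/\ same_deletions st s, forall v, col s v <= 3, proper e (col s),
  forall v, alive st v -> col s v != 0 & forall v, ~~ alive st v -> (col s v != 0) = (n - i <= st ORD v)].
have : I n (run reinsertion rho st).
  rewrite -[run _ _ _]/(foldl (fun s i => run reinsertion_round (bind rho 9 i) s) st (iota 0 n)).
  apply: foldl_iota; last first.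
    split=> // v nv; rewrite c0 // subn0 eqxx; apply/esym/negbTE; rewrite -ltnNge; exact: lt.
  move=> i s iltn [sd s3 ps fs ds].
  (* Iteration [i] undoes the round [k]. *)
  set k := n.-1 - i; have kE : k.+1 = n - i by rewrite /k; lia.
  pose F x v := if ~~ alive x v && (x ORD v == k) then assign x COL (val v) (pick_colour e x v) else x.
  rewrite run_for (eq_foldl (G := F)); last first.
    move=> x v; rewrite /when run_if holds_and holds_not (@holds_alive _ _ _ _ _ v) //.
    rewrite (@run_greedy _ _ _ adjE _ _ v) // /F.
  pose J x := [/\ same_deletions st x, forall v, col x v <= 3, proper e (col x),
    forall v, alive st v -> col x v != 0 & forall v, ~~ alive st v ->
      (k < st ORD v -> col x v != 0) /\ (col x v != 0 -> k <= st ORD v)].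
  pose P v x := ~~ alive st v -> st ORD v = k -> col x v != 0.
  have Jstep x v : J x -> J (F x v) /\ P v (F x v).
    move=> Jx; have [sdx x3 px fx dx] := Jx; have [dd oo] := sdx.
    rewrite /F (same_alive sdx (fun=> erefl)) oo; case: ifP => [/andP[nv /eqP vk]|nc]; last first.
      by split=> // nv vk; rewrite nv vk eqxx in nc.
    have nbr w : e v w -> col x w != 0 -> remaining st k w.
      move=> vw cw; rewrite /remaining; case: (boolP (alive st w)) => //= nw.
      have [_ h] := dx w nw; rewrite ltn_neqAle (h cw) andbT; apply/eqP => kw.
      have eq : v = w by apply: inj => //; rewrite vk.
      by rewrite eq ei in vw.
    have colr d : remaining st k d -> col x d != 0.
      rewrite /remaining; case: (boolP (alive st d)) => [ad _|nd /= kd]; first exact: fx.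
      by have [h _] := dx d nd; apply: h.
    have [|pI pf] := @pick_colourP _ e x v.
      have := rd v nv; rewrite vk => /reducibleP[[d [rd' _ dom]]|[a [b two]]].
        exists (col x d); first by have := x3 d; have := colr d rd'; case: (col x d) => [|[|[|[|]]]].
        move=> w vw; case: (eqVneq (col x w) 0) => [->|cw]; first by rewrite eq_sym colr.
        apply/eqP => eq; have dw := dom w (nbr w vw cw) vw.
        by case/negP: cw; rewrite eq; apply/eqP; apply: (px d w).
      have [c cI /andP[ca cb]] := free_colour (col x a) (col x b); exists c => // w vw.
      case: (eqVneq (col x w) 0) => [->|cw]; first by move: cI; rewrite !inE => /or3P[]/eqP->.
      by case: (two w (nbr w vw cw) vw) => ->; rewrite eq_sym.
    have p0 : pick_colour e x v != 0 := pick_pos e x v.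
    have p3 : pick_colour e x v <= 3 by move: pI; rewrite !inE => /or3P[]/eqP->.
    split; last by move=> _ _; rewrite col_assign eqxx.
    split; first exact: same_trans sdx (same_assign _ _ _).
    - by move=> u; rewrite col_assign; case: (eqVneq u v).
    - move=> u w uw; rewrite !col_assign; case: (eqVneq u v) => [uv|uv]; case: (eqVneq w v) => [wv|wv].
      + by rewrite uv wv ei in uw.
      + by rewrite uv in uw => eq; have := pf w uw; rewrite eq eqxx.
      + by rewrite wv es in uw => eq; have := pf u uw; rewrite eq eqxx.
      exact: px.
    - by move=> u au; rewrite col_assign; case: (eqVneq u v) => // _; apply: fx.
    move=> u nu; rewrite col_assign; case: (eqVneq u v) => [->|_]; last exact: dx.
    by rewrite vk.
  have [|||[sdx x3 px fx dx] Px] := @foldl_all _ _ J P F s.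
  - exact: Jstep.
  - move=> x u v Jx Pu nu uk; rewrite /F; case: ifP => _; last exact: Pu.
    by rewrite col_assign; case: (eqVneq u v) => [_|_]; [apply: pick_pos | apply: Pu].
  - split=> // v nv; rewrite ds //; split; [by rewrite -kE | rewrite -kE; exact: ltnW].
  split=> // v nv; have [h1 h2] := dx v nv; rewrite (_ : n - i.+1 = k); last by rewrite /k; lia.
  apply/idP/idP => [/h2 //|]; rewrite leq_eqVlt => /orP[/eqP kv|]; [exact: Px | exact: h1].
move=> [_ s3 ps fs ds].
have all_coloured v : col (run reinsertion rho st) v != 0.
  by case: (boolP (alive st v)) => [/fs //|/ds ->]; rewrite subnn.
split=> [v|u v uv eq]; first by rewrite s3 lt0n all_coloured.
by have := all_coloured u; rewrite (ps u v uv eq).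
Qed.

(** The phases hand over to each other: an irreducible set, then a colouring of it without uncoloured
    seven-cycles, then a colouring of all of it. *)
Lemma program_correct : coloring 3 e (fun v => run program (fun=> 0) (fun _ _ => 0) COL (val v)).
Proof.
pose rho (_ : nat) := 0.
have [c0 or irr] := reductionP rho; set st0 := run reduction rho _ in c0 or irr.
have v0 : valid e (alive st0) st0 st0.
  split=> //; split=> [v|v _|u v _ _|u v _ _]; by rewrite c0.
have [v1 no7] := cycle_phaseP Gsimple Gclass adjE irr rho v0.
set st1 := run cycle_phase rho st0 in v1 no7.
have [v2 full] := bipartite_phaseP Gsimple Gclass adjE rho v1 no7.
set st2 := run bipartite_phase rho st1 in v2 full.
have [[dd oo] a2 p2] := v2.
have or2 : ordered st2.
  case: or => lt inj rd; split=> [u|u v|u]; rewrite !a2 ?oo; [exact: lt | exact: inj |].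
  by move/rd; apply: reducible_mono => w; rewrite /remaining a2 oo.
have p2' : partial e (alive st2) (col st2).
  case: p2 => h1 h2 h3 h4; split=> //; first by move=> v; rewrite a2; apply: h2.
  by move=> u v; rewrite a2; apply: h4.
have full2 v : alive st2 v -> col st2 v != 0 by rewrite a2; apply: full.
exact: reinsertionP rho or2 p2' full2.
Qed.
End Order.

Theorem theorem1 :
  exists (P : cmd) (c K : nat),
  forall (n : nat) (e : rel 'I_n) (s : seq ('I_n * 'I_n)),
    simple_graph e -> class_G 10 7 e -> edge_list e s ->
    exists (t : nat) (mu : memory),
      [/\ exec ((n + 2) ^ c) P (input_memory s) t mu,
          t <= K * (n ^ 21 * (n + #|edge_set e|) + 1)
        & correct_output 3 e mu].
Proof.
have /andP[fit aS] := program_fits.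
exact: (realization fit aS program_depth program_correct).
Qed.
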